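(* Let $d\ge2$ and let $T\subset\mathbb R^d$ be a $d$-simplex with vertices $\texttt{v}_0,\dots,\texttt{v}_d$. Let $\Sigma_{2^+}(T;\mathbb S)=\mathbb P_2(T;\mathbb S)\oplus\boldsymbol x\boldsymbol x^{\intercal}\mathbb H_1(T)$. The following degrees of freedom are unisolvent for $\Sigma_{2^+}(T;\mathbb S)$: (a) $(\operatorname{tr}_e(\boldsymbol\tau),q)_e$, for $q\in\mathbb P_2(e)$, $e\in\Delta_{d-2}(T)$; (b) $(\boldsymbol n^{\intercal}\boldsymbol\tau\boldsymbol n,q)_F$, for $q\in\mathbb P_2(F)$, $F\in\Delta_{d-1}(T)$; (c) $(\operatorname{tr}_2(\boldsymbol\tau),q)_F$, for $q\in\mathbb P_1(F)$, $F\in\Delta_{d-1}(T)$; (d) $(\Pi_f\boldsymbol\tau\boldsymbol n_{F_r},\boldsymbol q)_f$, for $\boldsymbol q\in\mathbb B_2^{\operatorname{div}}(f)$, $f=f_{0:r-2}$, $r=d,d-1,\dots,3$; (e) $(\boldsymbol\tau,\boldsymbol q)_T$, for $\boldsymbol q\in\mathbb P_1(T;\mathbb S)$ with $\boldsymbol x^{\intercal}\boldsymbol q(\boldsymbol x)\boldsymbol x=0$ for all $\boldsymbol x$.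
   Context: $\mathbb S$ is the space of symmetric real $d\times d$ matrices. $\mathbb P_k(D)$ is the space of polynomials of total degree at most $k$ on $D$, $\mathbb H_k(D)$ the homogeneous polynomials of degree $k$, $\mathbb P_k(D;\mathbb X)=\mathbb P_k(D)\otimes\mathbb X$. $(\cdot,\cdot)_D$ is the $L^2$ inner product on $D$ (product of point values if $D$ is a point). $\Delta_\ell(T)$ is the set of $\ell$-dimensional subsimplices of $T$. $\operatorname{div}$ acts row-wise on matrices. For $F\in\Delta_{d-1}(T)$, $\boldsymbol n=\boldsymbol n_{\partial T}|_F$ is the unit normal of $F$ outward to $T$, $\Pi_F=\boldsymbol I-\boldsymbol n\boldsymbol n^{\intercal}$, and $\operatorname{div}_F\boldsymbol v$ is the surface divergence of $\Pi_F\boldsymbol v$. For $e\in\Delta_{d-2}(T)$ with $e\subset\partial F$, $\boldsymbol n_{F,e}$ is the unit vector tangent to $F$, normal to $e$ and pointing outward from $F$. $\operatorname{tr}_2(\boldsymbol\tau)=\boldsymbol n^{\intercal}\operatorname{div}\boldsymbol\tau+\operatorname{div}_F(\boldsymbol\tau\boldsymbol n)$ on each $F$, and $\operatorname{tr}_e(\boldsymbol\tau)=\sum_{F\in\Delta_{d-1}(T),\,e\subset\partial F}\boldsymbol n_{F,e}^{\intercal}\boldsymbol\tau\,\boldsymbol n_{\partial T}|_F$ on $e$. $F_r$ is the $(d-1)$-dimensional face opposite to $\texttt{v}_r$, $\boldsymbol n_{F_r}$ its unit normal; $f_{0:r}$ is the $r$-dimensional simplex with vertices $\texttt{v}_0,\dots,\texttt{v}_r$.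 For a simplex $f$, $\Pi_f$ is the orthogonal projection onto the tangent space of $f$, and $\mathbb B_2^{\operatorname{div}}(f)$ is the space of quadratic polynomial tangential vector fields on $f$ whose normal component on $\partial f$ (normal taken within $f$) vanishes. The set (d) is empty for $d=2$. ''Unisolvent'' means: letting the test functions run through bases of the test spaces, the number of functionals equals $\dim\Sigma_{2^+}(T;\mathbb S)$, and $\boldsymbol\tau\in\Sigma_{2^+}(T;\mathbb S)$ vanishes if all functionals vanish on it. *)

(* Defs.v *)
From HB Require Import structures.
From mathcomp Require Import all_boot all_order all_algebra.
From mathcomp Require mpoly.

Set Implicit Arguments.
Unset Strict Implicit.
Unset Printing Implicit Defensive.

Import Order.TTheory GRing.Theory Num.Theory.
Local Open Scope ring_scope.

(* The notations of mpoly clash with those of mathcomp-analysis, so mpoly is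
   imported only inside this module, before mathcomp-analysis is loaded. *)
Module PolynomialFunctions.
Import mpoly.

(* msize is 1 + total degree, and 0 for the zero polynomial. *)
Definition poly_fun (R : comNzRingType) (d k : nat) (p : 'cV[R]_d -> R) : Prop :=
  exists2 P : {mpoly R[d]},
    (msize P <= k.+1)%N & forall x, p x = P.@[fun i => x i 0].

Definition homog_fun (R : comNzRingType) (d k : nat) (p : 'cV[R]_d -> R) : Prop :=
  exists2 P : {mpoly R[d]},
    P \is k.-homog & forall x, p x = P.@[fun i => x i 0].

End PolynomialFunctions.
Export PolynomialFunctions.

From mathcomp Require Import all_classical all_reals all_analysis.
Import numFieldNormedType.Exports.

Local Open Scope classical_set_scope.
Local Open Scope ring_scope.

Section Unisolvence.
Variables (R : realType) (V : lmodType R).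

Definition is_basis (S : set V) (n : nat) (b : 'I_n -> V) : Prop :=
  (forall c : 'I_n -> R, \sum_i c i *: b i = 0 -> forall i, c i = 0) /\
  S = range (fun c : 'I_n -> R => \sum_i c i *: b i).

Record dof_family := DofFamily {
  test_type : lmodType R;
  test_space : set test_type;
  pairing : V -> test_type -> R }.

End Unisolvence.

(* The test spaces are finite dimensional and, whatever bases b i (of sizes n i)
   of them are used to form the functionals, there are exactly dim S functionals
   and an element of S annihilated by all of them is zero. *)
Definition unisolvent (R : realType) (V : lmodType R) (S : set V)
    (I : finType) (D : I -> dof_family V) : Prop :=
  (forall i, exists n, exists b : 'I_n -> test_type (D i),
     is_basis (@test_space _ _ (D i)) b) /\
  (forall (n : I -> nat) (b : forall i, 'I_(n i) -> test_type (D i)),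
     (forall i, is_basis (@test_space _ _ (D i)) (b i)) ->
     (exists s : 'I_(\sum_i n i)%N -> V, is_basis S s) /\
     (forall tau, S tau ->
        (forall i (j : 'I_(n i)), pairing tau (b i j) = 0) -> tau = 0)).

Section Euclidean.
Variables (R : realType) (d : nat).
Implicit Types (x y n : 'cV[R]_d) (tau : 'cV[R]_d -> 'M[R]_d).

Definition dot x y : R := (x^T *m y) 0 0.

Definition partial (i : 'I_d) (g : 'cV[R]_d -> R) x : R :=
  'D_(delta_mx i 0) g x.

Definition row_div tau x : 'cV[R]_d :=
  \col_i \sum_j partial j (fun y => tau y i j) x.

Definition face_proj n : 'M[R]_d := 1%:M - n *m n^T.

(* On a hyperplane with unit normal n, the surface divergence of the tangential
   field w = Pi v is tr (Pi (grad w)), with Pi = face_proj n. *)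
Definition surface_div n (v : 'cV[R]_d -> 'cV[R]_d) x : R :=
  \sum_i \sum_j face_proj n i j * partial i (fun y => (face_proj n *m v y) j 0) x.

(* Polynomials on D: functions that agree with a polynomial on D and are
   extended by 0 outside D, so that only the values on D matter. *)
Definition poly_on (k : nat) (D : set 'cV[R]_d) : set ('cV[R]_d -> R) :=
  [set patch (fun=> 0) D p | p in [set p | poly_fun k p]].

(* Polynomials on the simplex T itself, which has nonempty interior, are
   identified with polynomial functions on the whole space. *)
Definition sym_poly (k : nat) : set ('cV[R]_d -> 'M[R]_d) :=
  [set tau | (forall x, (tau x)^T = tau x) /\
             forall i j, poly_fun k (fun x => tau x i j)].

Definition Sigma2plus : set ('cV[R]_d -> 'M[R]_d) :=
  [set tau | exists tau0 p, [/\ sym_poly 2 tau0, homog_fun 1 p &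
     tau = fun x => tau0 x + p x *: (x *m x^T)]].

(* Iterated integral of g (x + \sum_k t_k e_k), where E = [:: e_0; e_1; ...],
   over the simplex given by t_k >= 0 and \sum_k t_k <= s. *)
Fixpoint param_integral (g : 'cV[R]_d -> R) (E : seq 'cV[R]_d) (s : R) x : R :=
  if E is e :: E' then
    \int[lebesgue_measure]_(t in `[0, s]) param_integral g E' (s - t) (x + t *: e)
  else g x.

Definition gram_det (E : seq 'cV[R]_d) : R :=
  \det (\matrix_(i < size E, j < size E) dot E`_i E`_j).

End Euclidean.

(* Subsimplices of the simplex with vertices v 0, ..., v d are given by their
   sets of vertex indices. *)
Definition subsimplex (d l : nat) : finType :=
  {f : {set 'I_d.+1} | #|f| == l.+1}.

Section Simplex.
Variables (R : realType) (d : nat) (v : 'I_d.+1 -> 'cV[R]_d).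
Implicit Types (f g e F : {set 'I_d.+1}).

Definition affinely_independent : Prop :=
  forall c : 'I_d.+1 -> R,
    \sum_i c i = 0 -> \sum_i c i *: v i = 0 -> forall i, c i = 0.

Definition points f : set 'cV[R]_d :=
  [set x | exists c : 'I_d.+1 -> R,
     [/\ forall i, 0 <= c i, \sum_(i in f) c i = 1
       & x = \sum_(i in f) c i *: v i]].

Definition tangent f : set 'cV[R]_d :=
  [set x | exists c : 'I_d.+1 -> R,
     \sum_(i in f) c i = 0 /\ x = \sum_(i in f) c i *: v i].

Definition tangent_proj f (x : 'cV[R]_d) : 'cV[R]_d :=
  xget 0 [set y | tangent f y /\ forall t, tangent f t -> dot (x - y) t = 0].

Definition facet g f : bool := (g \subset f) && (#|g|.+1 == #|f|).

(* For a facet g of f: the unit vector tangent to f, normal to g and pointing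
   outward from f. *)
Definition outward_normal f g : 'cV[R]_d :=
  xget 0 [set n | [/\ tangent f n, dot n n = 1,
    forall t, tangent g t -> dot n t = 0 &
    forall i j, i \in f :\: g -> j \in g -> dot n (v i - v j) < 0]].

Definition normal F : 'cV[R]_d := outward_normal [set: 'I_d.+1]%SET F.

(* Surface integral over f through the affine parametrization of f whose base
   point is the first vertex of f; it is the point value if f is a vertex. *)
Definition integral_on f (h : 'cV[R]_d -> R) : R :=
  let vs := [seq v i | i <- enum f] in
  let x0 := head 0 vs in
  let E := [seq x - x0 | x <- behead vs] in
  Num.sqrt (gram_det E) * param_integral h E 1 x0.

Section Traces.
Variable tau : 'cV[R]_d -> 'M[R]_d.

Definition normal_normal F x : R := ((normal F)^T *m tau x *m normal F) 0 0.

Definition tr2 F x : R :=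
  dot (normal F) (row_div tau x) +
  surface_div (normal F) (fun y => tau y *m normal F) x.

(* A subsimplex e lies in the boundary of F iff its vertex set is a proper
   subset of that of F. *)
Definition tr_e e x : R :=
  \sum_(F : subsimplex d d.-1 | e \proper val F)
    ((outward_normal (val F) e)^T *m tau x *m normal (val F)) 0 0.

End Traces.

Definition B2div f : set ('cV[R]_d -> 'cV[R]_d) :=
  [set q : 'cV[R]_d -> 'cV[R]_d | [/\ forall i, poly_on 2 (points f) (fun x => q x i 0),
     forall x, tangent f (q x) &
     forall g, facet g f ->
       forall x, points g x -> dot (outward_normal f g) (q x) = 0]].

Definition trace_e_dof e : dof_family ('cV[R]_d -> 'M[R]_d) :=
  DofFamily (poly_on 2 (points e))
    (fun tau q => integral_on e (fun x => tr_e tau e x * q x)).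

Definition normal_normal_dof F : dof_family ('cV[R]_d -> 'M[R]_d) :=
  DofFamily (poly_on 2 (points F))
    (fun tau q => integral_on F (fun x => normal_normal tau F x * q x)).

Definition tr2_dof F : dof_family ('cV[R]_d -> 'M[R]_d) :=
  DofFamily (poly_on 1 (points F))
    (fun tau q => integral_on F (fun x => tr2 tau F x * q x)).

Definition opp_face (r : 'I_d.+1) : {set 'I_d.+1} := (~: [set r])%SET.

Definition initial_simplex (l : nat) : {set 'I_d.+1} :=
  [set i | (nat_of_ord i <= l)%N]%SET.

Definition tangential_normal_dof (r : 'I_d.+1) :
    dof_family ('cV[R]_d -> 'M[R]_d) :=
  let f := initial_simplex (r - 2) in
  DofFamily (B2div f)
    (fun tau q => integral_on f
       (fun x => dot (tangent_proj f (tau x *m normal (opp_face r))) (q x))).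

Definition interior_dof : dof_family ('cV[R]_d -> 'M[R]_d) :=
  DofFamily
    [set q | @sym_poly R d 1 q /\ forall x, (x^T *m q x *m x) 0 0 = 0]
    (fun tau q => integral_on [set: 'I_d.+1]%SET (fun x => \tr ((tau x)^T *m q x))).

End Simplex.

Definition dof_index (d : nat) : finType :=
  (subsimplex d d.-2 + (subsimplex d d.-1 + (subsimplex d d.-1 +
    ({r : 'I_d.+1 | (3 <= r)%N} + unit))))%type.

Definition dofs (R : realType) (d : nat) (v : 'I_d.+1 -> 'cV[R]_d)
    (k : dof_index d) : dof_family ('cV[R]_d -> 'M[R]_d) :=
  match k with
  | inl e => trace_e_dof v (val e)
  | inr (inl F) => normal_normal_dof v (val F)
  | inr (inr (inl F)) => tr2_dof v (val F)
  | inr (inr (inr (inl r))) => tangential_normal_dof v (val r)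
  | inr (inr (inr (inr tt))) => interior_dof v
  end.

(* Main.v *)
Require Import Defs.
From mathcomp Require Import all_boot all_order all_algebra.
From mathcomp Require mpoly.
From mathcomp Require Import ring lra zify.

Set Implicit Arguments.
Unset Strict Implicit.
Unset Printing Implicit Defensive.

Import Order.TTheory GRing.Theory Num.Theory.
Local Open Scope ring_scope.

(** Write [tau = \sum_(a, b) lam_a lam_b A_ab + p x x^T] with barycentric
    coordinates [lam_a] and [p] linear, and contract with the gradients [gl_j] of
    [lam_j]: up to a multiple of [p], the coefficient of [lam_a lam_b] in
    [gl_j . tau gl_k] is a number [g a b j k].  The sets (a) and (b) force
    [g a b j k = 0] when [a], [b] avoid [j], [k], and (c) gives the relation
    [2 \sum_k g a k j k - g a j j j = (d + 2) lam_j(0) p_a] for [a != j].  Together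
    with the known row sums of [g] these relations determine enough to conclude,
    by linear algebra replacing Green's identity, that [p = 0] and
    [\sum_(a, b) g a b j k = 0].  Testing (e) with
    [2 (u . x) (v w^T + w v^T) - (v . x) (u w^T + w u^T) - (w . x) (u v^T + v u^T)]
    for gradients [u], [v], [w] then shows that the moments [\sum_l g a l j k]
    vanish, which leaves an alternating tensor [g a b a c] with zero row sums; (d)
    annihilates it.  Integrals are needed only through the positivity of the
    integral of a square and Dirichlet's formula for cubic monomials.  The number of
    functionals is found from explicit bases of the test spaces. *)

(** * Linear relations between barycentric coefficients *)

(** Once the traces in (a)-(c) vanish, Green's identity reads (tau, hess w)_T = (div div tau, w)_T.
    For linear [w] it makes div div tau, a linear function with homogeneous part
    [(d + 1) (d + 2) p], orthogonal to all linear functions, whence [p = 0]. Quadratic [w] gives the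
    vanishing totals, and [w = lam_a lam_b lam_c] gives zero cyclic sums of the moments. The
    relations below reproduce these three cases one coefficient at a time, so no integration by
    parts over faces of different dimensions is needed: a face only enters through the integral of a
    square over that face. The role of (d) can be seen from a count: alternating 3-tensors on
    [d + 1] indices with zero row sums form a space of dimension 'C(d, 3), the sum over [r] of 'C(r
    - 1, 2), which is the number of edges of all the simplices f_{0:r-2} and hence the number of
    functionals in (d). *)

Lemma sum_supp1 (V : nmodType) (I : finType) (a : I) (f : I -> V) :
  (forall k, k != a -> f k = 0) -> \sum_k f k = f a.
Proof. by move=> f0; rewrite (bigD1 a) //= big1 ?addr0. Qed.

Lemma sum_supp2 (V : nmodType) (I : finType) (a b : I) (f : I -> V) :
  a != b -> (forall k, k != a -> k != b -> f k = 0) -> \sum_k f k = f a + f b.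
Proof.
move=> ab f0; rewrite (bigD1 a) //= (bigD1 b) 1?eq_sym //= big1 ?addr0 //.
by move=> k /andP[ka kb]; apply: f0.
Qed.

Section CoefficientRelations.
Variables (F : realFieldType) (n : nat).
Local Notation I := 'I_n.
Variables (g : I -> I -> I -> I -> F) (s p : I -> F).
Hypothesis gC : forall a b j k, g a b j k = g b a j k.
Hypothesis gT : forall a b j k, g a b j k = g a b k j.
Hypothesis g0 : forall a b j k,
  a != j -> a != k -> b != j -> b != k -> g a b j k = 0.
Hypothesis grow : forall a b j, \sum_k g a b j k = s j * (p a + p b) / 2.
Hypothesis gtr2 : forall a j, a != j ->
  2 * (\sum_k g a k j k) - g a j j j = n.+1%:R * s j * p a.
Hypothesis s1 : \sum_a s a = 1.
Hypothesis sp0 : \sum_a s a * p a = 0.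

Let P := \sum_a p a.

Let sumsp a b : \sum_k s k * (p a + p b) / 2 = (p a + p b) / 2.
Proof. by rewrite -!mulr_suml s1 mul1r. Qed.

Let sumsk a : \sum_k s k * (p a + p k) / 2 = p a / 2.
Proof.
rewrite -mulr_suml; under eq_bigr do rewrite mulrDr.
by rewrite big_split /= sp0 -mulr_suml s1 mul1r addr0.
Qed.

Let sumc (c : F) : \sum_(k < n) c = n%:R * c.
Proof. by rewrite sumr_const card_ord mulr_natl. Qed.

(** By [g0], row [j] of the matrix [g a a] is supported in column [a]. *)
Lemma g_vertex_offdiag a j : j != a -> g a a j a = s j * p a.
Proof.
move=> ja; have := grow a a j; rewrite (sum_supp1 (a := a)).
  by move=> ->; field.
by move=> k ka; rewrite g0 // 1?eq_sym.
Qed.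

Lemma g_vertex_diag a : g a a a a = (2 * s a - 1) * p a.
Proof.
have := sum_supp1 (a := a) (f := fun k => g a a a k - s k * p a).
rewrite big_split /= grow sumrN -mulr_suml s1 => H.
have -> : g a a a a = s a * p a + (g a a a a - s a * p a) by ring.
rewrite -H; first by field.
by move=> k ka; rewrite gT g_vertex_offdiag // subrr.
Qed.

(** Rows [a] and [b] of the matrix [g a b] are added. In a column [k] outside [{a, b}] the two
    entries make up all of row [k], by symmetry and [g0], so their sum is known and only the
    two-by-two block remains. *)
Lemma g_edge a b : a != b ->
  g a b a a + 2 * g a b a b + g a b b b = (p a + p b) * (s a + s b - 1 / 2).
Proof.
move=> ab.
have := @sum_supp2 _ _ a b (fun k => g a b a k + g a b b k - s k * (p a + p b) / 2) ab.
rewrite !big_split /= !grow sumrN sumsp => H.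
have := gT a b b a.
suff: forall k, k != a -> k != b -> g a b a k + g a b b k - s k * (p a + p b) / 2 = 0.
  by move=> /H{}H; lra.
move=> k ka kb; rewrite -grow (@sum_supp2 _ _ a b) //.
  by rewrite (gT _ _ k a) (gT _ _ k b) subrr.
by move=> l la lb; apply: g0; rewrite eq_sym.
Qed.

Let X a j := \sum_k g a k j a.

(** For [k] outside [{a, j}], row [j] of [g a k] has only the entries [g a k j k] and [g a k j a];
    summing over [k] exchanges [X a j] for the sum in [gtr2]. The factor [n + 1] there is what makes
    the terms in [p a] cancel. *)
Lemma g_edge_row a j : a != j ->
  2 * X a j = g a j j j + 2 * g a j a j + s j * (P - p j).
Proof.
move=> aj.
have := @sum_supp2 _ _ a j (fun k => g a k j k + g a k j a - s j * (p a + p k) / 2) aj.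
rewrite !big_split /= sumrN -mulr_suml -mulr_sumr big_split /= sumc -/(X a j) -/P.
rewrite g_vertex_offdiag 1?eq_sym // (gT a j j a) => H.
have := gtr2 aj.
suff: forall k, k != a -> k != j -> g a k j k + g a k j a - s j * (p a + p k) / 2 = 0.
  by move=> /H{}H; lra.
move=> k ka kj; rewrite -grow (@sum_supp2 _ _ a k) 1?eq_sym //.
  by rewrite addrC subrr.
by move=> l la lb; apply: g0; rewrite // eq_sym.
Qed.

Let S a j := \sum_k \sum_l g k l a j.

(** Only index pairs meeting [{a, j}] contribute, so inclusion-exclusion reduces the sum to [X a j],
    [X j a] and a few entries. After [g_edge_row] the unknown entries combine into the left side of
    [g_edge]. *)
Lemma g_total_offdiag a j : a != j -> S a j = - (p a + p j) / 2 + P * (s a + s j).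
Proof.
move=> aj; have ja : j != a by rewrite eq_sym.
have := @sum_supp2 _ _ a j (fun k => \sum_l g k l a j - g k a a j - g k j a j) aj.
rewrite !big_split /= !sumrN -/(S a j).
have -> : \sum_k g k a a j = X a j by apply: eq_bigr => k _; rewrite gC gT.
have -> : \sum_k g k j a j = X j a by apply: eq_bigr => k _; rewrite gC.
have -> : \sum_k g a k a j = X a j by apply: eq_bigr => k _; rewrite gT.
rewrite -/(X j a) => H.
have := g_edge aj; have := g_edge_row aj; have := g_edge_row ja.
have := g_vertex_offdiag ja; have := g_vertex_offdiag aj.
rewrite !(gC j a) -!(gT _ _ a j).
suff: forall k, k != a -> k != j -> \sum_l g k l a j - g k a a j - g k j a j = 0.
  by move=> /H{}H; rewrite (gC j a) in H; lra.
move=> k ka kj; rewrite (@sum_supp2 _ _ a j) //; first by rewrite addrAC addrK subrr.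
by move=> l la lj; apply: g0.
Qed.

Let W a := \sum_k g a k a a.

Lemma g_total_diag a : S a a = 2 * W a - g a a a a.
Proof.
have := @sum_supp1 _ _ a (fun k => \sum_l g k l a a - g k a a a).
rewrite !big_split /= !sumrN -/(S a a) -/(W a).
have -> : \sum_k g k a a a = W a by apply: eq_bigr => k _; rewrite gC.
move=> H.
suff: forall k, k != a -> \sum_l g k l a a - g k a a a = 0 by move=> /H{}H; lra.
move=> k ka; rewrite (@sum_supp1 _ _ a) ?subrr // => l la; exact: g0.
Qed.

Lemma g_total_row a : \sum_j S a j = s a * n%:R * P.
Proof.
rewrite /S exchange_big /=; under eq_bigr do rewrite exchange_big /=.
under eq_bigr do under eq_bigr do rewrite grow.
under eq_bigr do rewrite -mulr_suml -mulr_sumr big_split /= sumc -/P.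
by rewrite -mulr_suml -mulr_sumr big_split /= -mulr_sumr sumc -/P; field.
Qed.

(** Each of [gtr2], [g_edge] and [g_total_offdiag] is summed over its second index, with a
    correction for the excluded term at [a]. Together with [g_total_diag] the three sums eliminate
    [U], [V], [W a] and [S a a]. *)
Lemma cubic_part_mean a : n%:R * p a = P.
Proof.
set V := \sum_j g a j j j; set U := \sum_j g a j a j.
have E1 : p a - V - n.+1%:R * p a = 2 * U - g a a a a - n.+1%:R * s a * p a.
  have := @sum_supp1 _ _ a
    (fun j => 2 * (\sum_k g a k j k) - g a j j j - n.+1%:R * s j * p a).
  rewrite !big_split /= !sumrN -!mulr_sumr -mulr_suml -mulr_sumr s1 -/V -/U.
  rewrite exchange_big /=.
  have -> : \sum_j \sum_i g a j i j = p a / 2.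
    by rewrite -sumsk; apply: eq_bigr => k _; rewrite -grow; apply: eq_bigr => i _.
  suff H : forall k, k != a -> 2 * (\sum_l g a l k l) - g a k k k - n.+1%:R * s k * p a = 0.
    by move=> /(_ H) {}H; lra.
  by move=> k ka; rewrite gtr2 ?subrr // eq_sym.
have E2 : W a + 2 * U + V - (n%:R * p a * s a + p a - n%:R * p a / 2 + P * s a - P / 2)
    = 4 * g a a a a - 2 * p a * (2 * s a - 1 / 2).
  have := @sum_supp1 _ _ a (fun b =>
    g a b a a + 2 * g a b a b + g a b b b - (p a + p b) * (s a + s b - 1 / 2)).
  rewrite !big_split /= !sumrN -!mulr_sumr -/(W a) -/U -/V.
  have -> : \sum_b (p a + p b) * (s a + s b - 1 / 2) =
      n%:R * p a * s a + p a - n%:R * p a / 2 + P * s a - P / 2.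
    under eq_bigr do rewrite mulrDl !mulrDr addrA.
    rewrite !big_split /= !sumc -!mulr_suml -!mulr_sumr s1 -/P.
    have -> : \sum_i p i * s i = 0 by under eq_bigr do rewrite mulrC.
    by field.
  suff H : forall b, b != a ->
      g a b a a + 2 * g a b a b + g a b b b - (p a + p b) * (s a + s b - 1 / 2) = 0.
    by move=> /(_ H) ->; field.
  by move=> b ba; rewrite g_edge ?subrr // eq_sym.
have E3 : S a a = s a * n%:R * P - (- (n%:R * p a + P) / 2 + P * (n%:R * s a + 1))
    + (- p a + P * (2 * s a)).
  have := @sum_supp1 _ _ a (fun j => S a j + (p a + p j) / 2 - P * (s a + s j)).
  rewrite !big_split /= sumrN g_total_row -mulr_suml -mulr_sumr !big_split /= !sumc s1 -/P.
  suff H : forall j, j != a -> S a j + (p a + p j) / 2 - P * (s a + s j) = 0.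
    by move=> /(_ H) {}H; lra.
  by move=> j ja; rewrite g_total_offdiag 1?eq_sym //; field.
have := g_total_diag a; have := g_vertex_diag a; rewrite -natr1 in E1; lra.
Qed.

Hypothesis n_gt0 : (0 < n)%N.

(** By [cubic_part_mean] the values [p a] are all equal, and their mean with weights [s] is zero. *)
Lemma cubic_part_eq0 a : p a = 0.
Proof.
have n0 : n%:R != 0 :> F by rewrite pnatr_eq0 -lt0n.
have P0 : P = 0.
  have : n%:R * (\sum_a s a * p a) = P.
    rewrite mulr_sumr; under eq_bigr do rewrite mulrCA cubic_part_mean.
    by rewrite -mulr_suml s1 mul1r.
  by rewrite sp0 mulr0.
by apply: (mulfI n0); rewrite cubic_part_mean P0 mulr0.
Qed.

Lemma total_eq0 a j : \sum_k \sum_l g k l a j = 0.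
Proof.
have p0 := cubic_part_eq0.
have P0 : P = 0 by rewrite /P big1.
rewrite -/(S a j); case: (eqVneq a j) => [<-|aj]; last by rewrite g_total_offdiag // !p0 P0; ring.
have := g_total_row a; rewrite P0 mulr0 (bigD1 a) //= big1 ?addr0 // => k ka.
by rewrite g_total_offdiag 1?eq_sym // !p0 P0; ring.
Qed.

End CoefficientRelations.

(** * No cubic part: moments and the alternating tensor *)

Section QuadraticCase.
Variables (F : realFieldType) (n : nat).
Local Notation I := 'I_n.
Variables (g : I -> I -> I -> I -> F) (s : I -> F).
Hypothesis gC : forall a b j k, g a b j k = g b a j k.
Hypothesis gT : forall a b j k, g a b j k = g a b k j.
Hypothesis g0 : forall a b j k,
  a != j -> a != k -> b != j -> b != k -> g a b j k = 0.
Hypothesis grow : forall a b j, \sum_k g a b j k = 0.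
Hypothesis gtr2 : forall a j, a != j -> 2 * (\sum_k g a k j k) - g a j j j = 0.
Hypothesis s1 : \sum_a s a = 1.
Hypothesis n_gt0 : (0 < n)%N.

(** Takes the place of [p] when the relations for general [p] are applied. *)
Let zr (_ : I) : F := 0.

Let grow' a b j : \sum_k g a b j k = s j * (zr a + zr b) / 2.
Proof. by rewrite grow addr0 mulr0 mul0r. Qed.

Let gtr2' a j : a != j -> 2 * (\sum_k g a k j k) - g a j j j = n.+1%:R * s j * zr a.
Proof. by move=> /gtr2 ->; rewrite mulr0. Qed.

Let sp0 : \sum_a s a * zr a = 0.
Proof. by rewrite big1 // => i _; rewrite mulr0. Qed.

(** Up to a common factor, the integral of [lam a] against [gl b . tau gl c]; see
    [moment_integral]. *)
Definition moment a b c := \sum_l g a l b c.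
Local Notation T := moment.

Lemma momentC a b c : T a b c = T a c b.
Proof. by apply: eq_bigr => l _; rewrite gT. Qed.

Lemma g_vertex a j k : g a a j k = 0.
Proof.
have [->|ja] := eqVneq j a; last first.
  have [->|ka] := eqVneq k a; last by rewrite g0 // eq_sym.
  by rewrite (g_vertex_offdiag g0 grow') // mulr0.
have [->|ka] := eqVneq k a.
  by rewrite (g_vertex_diag gT g0 grow' s1) mulr0.
by rewrite gT (g_vertex_offdiag g0 grow') // mulr0.
Qed.

Lemma g_edge0 a b : a != b -> g a b a a + 2 * g a b a b + g a b b b = 0.
Proof. by move=> ab; rewrite (g_edge gT g0 grow' s1 ab) addr0 mul0r. Qed.

(** Coinciding indices reduce to the diagonal and edge relations. For distinct ones each moment is a
    difference of two entries, arranged so that the cyclic sum telescopes. *)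
Lemma moment_cyclic a b c : T a b c + T b c a + T c a b = 0.
Proof.
have Taaa x : T x x x = 0.
  have := g_total_diag gC gT g0 x; rewrite g_vertex.
  have -> : \sum_k \sum_l g k l x x = 0.
    exact: (total_eq0 gC gT g0 grow' gtr2' s1 sp0).
  by rewrite -/(T x x x); lra.
have Taab x y : x != y -> 2 * T x x y + T y x x = 0.
  move=> xy; have := g_edge_row gT g0 grow' gtr2' xy.
  have -> : \sum_a zr a = 0 by apply: big1.
  rewrite subr0 mulr0 addr0; have := g_edge0 xy.
  have -> : T y x x = g x y x x.
    rewrite /T (sum_supp1 (a := x)) 1?gC // => l lx; apply: g0 => //.
    - by rewrite eq_sym.
    - by rewrite eq_sym.
  have <- : T x x y = \sum_k g x k y x by apply: eq_bigr => k _; rewrite gT.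
  by lra.
(* Only [l = y] and [l = z] contribute; the zero row [y] of [g x z] moves the second term to the
   entry [g z x x y]. *)
have Tabc x y z : x != y -> x != z -> y != z -> T x y z = g x y y z - g z x x y.
  move=> xy xz yz; rewrite /T (@sum_supp2 _ _ y z) //.
    congr (_ + _); have := grow x z y.
    rewrite (@sum_supp2 _ _ x z) //; first by rewrite (gC x z) (gT z x y x); lra.
    by move=> l lx lz; apply: g0; rewrite // eq_sym.
  by move=> l ly lz; apply: g0.
have [<-|ab] := eqVneq a b.
  have [<-|ac] := eqVneq a c; first by rewrite Taaa !addr0.
  by rewrite (momentC a c a) -(Taab _ _ ac); ring.
have [<-|ac] := eqVneq a c.
  by rewrite (momentC a b a) -(Taab _ _ ab); ring.
have [<-|bc] := eqVneq b c.
  by rewrite (momentC b a b) -[RHS](Taab b a) 1?eq_sym //; ring.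
have e x y z : x != y -> x != z -> y != z -> g x y x z = - g x y y z.
  move=> xy xz yz; have := grow x y z; rewrite (@sum_supp2 _ _ x y) //.
    by rewrite (gT _ _ z x) (gT _ _ z y); lra.
  by move=> l lx ly; apply: g0; rewrite // eq_sym.
rewrite !Tabc // 1?eq_sym //.
rewrite (gT b c c a) (gT c a a b) (gT a b b c).
have := e a b c ab ac bc.
have := e b c a bc; rewrite eq_sym ab eq_sym ac => /(_ isT isT).
have := e c a b; rewrite eq_sym ac eq_sym bc ab => /(_ isT isT isT).
rewrite (gT a b c b) (gT b c a c) (gT c a b a).
by rewrite ?(gT _ _ b a) ?(gT _ _ c a) ?(gT _ _ c b); lra.
Qed.

Hypothesis moment_orth : forall a b c, 2 * T a b c = T b a c + T c a b.

(** By the symmetry in the last two arguments, the two relations add up to [3 T a b c = 0]. *)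
Lemma moment_eq0 a b c : T a b c = 0.
Proof.
have := moment_cyclic a b c; have := moment_orth a b c.
rewrite (momentC b c a); lra.
Qed.

Lemma g_diag a j : a != j -> g a j j j = 0.
Proof.
move=> aj; rewrite -(moment_eq0 a j j) /T (sum_supp1 (a := j)) //.
by move=> l lj; rewrite g0.
Qed.

Lemma g_offdiag a b : a != b -> g a b a b = 0.
Proof.
move=> ab; have := g_edge0 ab; rewrite g_diag //.
by rewrite (gC a b a a) g_diag 1?eq_sym //; lra.
Qed.

(* The remaining coefficients form an alternating tensor. *)
Let C a b c := g a b a c.

(** The zero row [c] of [g a b] has entries only in columns [a] and [b]. *)
Lemma alt12 a b c : c != a -> c != b -> C b a c = - C a b c.
Proof.
move=> ca cb; rewrite /C; have [->|ab] := eqVneq a b.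
  by rewrite g_vertex oppr0.
have := grow a b c; rewrite (@sum_supp2 _ _ a b) //.
  by rewrite (gT a b c a) (gT a b c b) (gC b a); lra.
by move=> l la lb; apply: g0; rewrite // eq_sym.
Qed.

(** The vanishing moment [T b a c] has only the two terms with [l = a] and [l = c]. *)
Lemma alt13 a b c : a != b -> a != c -> b != c -> C c b a = - C a b c.
Proof.
move=> ab ac bc; have := moment_eq0 b a c.
rewrite /T (@sum_supp2 _ _ a c) //; last by move=> l la lc; apply: g0; rewrite // eq_sym.
by rewrite /C (gC b a) (gC b c) (gT c b a c); lra.
Qed.

Lemma alt_row_sum a b : \sum_(c | (c != a) && (c != b)) C a b c = 0.
Proof.
have [->|ab] := eqVneq a b; first by rewrite big1 // => i _; rewrite /C g_vertex.
have := grow a b a; rewrite (bigD1 a) //= (bigD1 b) 1?eq_sym //=.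
by rewrite g_offdiag // (gC a b a a) g_diag 1?eq_sym // !add0r.
Qed.

Hypothesis tangential_eq0 : forall (i l r : I), (3 <= r)%N ->
  (i <= r - 2)%N -> (l <= r - 2)%N -> i != l -> C i l r = 0.

(** The hypothesis from (d) covers a sorted triple unless its two largest indices are adjacent. If
    [k = j + 1], the zero row sum for [i], [k] expresses [C i j k] by the entries [C i k c] with [c]
    different from [j]. Those with [c > k] vanish by induction from the largest top index downwards;
    those with [c < j] have, once sorted, a gap below [k]. *)
Lemma alt_sorted_eq0 (i j k : I) : (i < j)%N -> (j < k)%N -> C i j k = 0.
Proof.
have low (x y z : I) : (x < y)%N -> (y.+1 < z)%N -> C x y z = 0.
  move=> xy yz; apply: tangential_eq0; last by rewrite neq_ltn xy.
  - by case: (val z) yz => [|[|[|]]] //; case: (val y) xy.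
  - by rewrite leq_subRL; lia.
  - by rewrite leq_subRL; lia.
have [m] := ubnP (n - k); elim: m i j k => // m IH i j k km ij jk.
have [jk1|kj1] := ltnP j.+1 k; first exact: low.
have ekj : k = j.+1 :> nat by apply/eqP; rewrite eqn_leq kj1 jk.
have ik := ltn_trans ij jk.
have := alt_row_sum i k; rewrite (bigD1 j) /=; last by rewrite !neq_ltn ij jk orbT.
rewrite big1 ?addr0 => [|c /andP[/andP[ci ck] cj]].
  have -> : C i k j = - C i j k; last by lra.
  have h1 : C k j i = - C i j k by apply: alt13; rewrite neq_ltn ?ij ?ik ?jk.
  have h2 : C j k i = - C k j i by apply: alt12; rewrite neq_ltn ?ij ?ik.
  have h3 : C i k j = - C j k i by apply: alt13; rewrite neq_ltn ?ij ?ik ?jk ?orbT.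
  by rewrite h3 h2 h1 opprK.
have [kc|] := ltnP k c; first by apply: (IH); [have := ltn_ord c; lia| |].
have ck' : (c != k :> nat) by []; have cj' : (c != j :> nat) by [].
have ci' : (c != i :> nat) by [].
move=> lck; have lcj : (c < j)%N by lia.
have [ic|] := ltnP i c.
  have h1 : C k c i = - C i c k by apply: alt13; apply/negP => /eqP /(congr1 val) /=; lia.
  have h2 : C c k i = - C k c i by apply: alt12; apply/negP => /eqP /(congr1 val) /=; lia.
  have h3 : C i k c = - C c k i by apply: alt13; apply/negP => /eqP /(congr1 val) /=; lia.
  by rewrite h3 h2 h1 low ?oppr0 //; lia.
move=> lci'; have lci : (c < i)%N by lia.
have h3 : C k i c = - C c i k by apply: alt13; apply/negP => /eqP /(congr1 val) /=; lia.
have h1 : C i k c = - C k i c by apply: alt12; apply/negP => /eqP /(congr1 val) /=; lia.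
by rewrite h1 h3 low ?oppr0 //; lia.
Qed.

Lemma alt_eq0 a b c : a != b -> a != c -> b != c -> C a b c = 0.
Proof.
have base (i j k : I) : (i < j)%N -> (j < k)%N ->
    [/\ C i j k = 0, C j i k = 0, C k j i = 0 & [/\ C j k i = 0, C k i j = 0 & C i k j = 0]].
  move=> ij jk; have ik := ltn_trans ij jk; have h0 := alt_sorted_eq0 ij jk.
  have h1 : C j i k = 0 by rewrite alt12 ?h0 ?oppr0 // neq_ltn ?ik ?jk ?orbT.
  have h2 : C k j i = 0 by rewrite alt13 ?h0 ?oppr0 // neq_ltn ?ij ?ik ?jk.
  have h3 : C k i j = 0 by rewrite alt13 ?h1 ?oppr0 // neq_ltn ?ij ?ik ?jk ?orbT.
  have h4 : C j k i = 0 by rewrite alt12 ?h2 ?oppr0 // neq_ltn ?ij ?ik ?jk ?orbT.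
  have h5 : C i k j = 0 by rewrite alt12 ?h3 ?oppr0 // neq_ltn ?ij ?ik ?jk ?orbT.
  by split.
rewrite !neq_ltn => /orP[]ab /orP[]ac /orP[]bc;
  try (by have := ltn_trans ab (ltn_trans bc ac); rewrite ltnn);
  try (by have := ltn_trans ac (ltn_trans bc ab); rewrite ltnn);
  try (by have [h1 h2 h3 [h4 h5 h6]] := base _ _ _ ab bc);
  try (by have [h1 h2 h3 [h4 h5 h6]] := base _ _ _ ac bc);
  try (by have [h1 h2 h3 [h4 h5 h6]] := base _ _ _ ab ac);
  try (by have [h1 h2 h3 [h4 h5 h6]] := base _ _ _ bc ab);
  try (by have [h1 h2 h3 [h4 h5 h6]] := base _ _ _ bc ac);
  by have [h1 h2 h3 [h4 h5 h6]] := base _ _ _ ac ab.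
Qed.

Lemma coefficients_eq0 a b j k : g a b j k = 0.
Proof.
have [->|ab] := eqVneq a b; first exact: g_vertex.
have row_a x y c : x != y -> g x y x c = 0.
  move=> xy; have [->|cx] := eqVneq c x.
    by rewrite gC g_diag // eq_sym.
  have [->|cy] := eqVneq c y; first exact: g_offdiag.
  by apply: alt_eq0; rewrite // eq_sym.
have [<-|ja] := eqVneq a j; first exact: row_a.
have [<-|jb] := eqVneq b j; first by rewrite gC row_a // eq_sym.
have [<-|ka] := eqVneq a k; first by rewrite gT row_a.
have [<-|kb] := eqVneq b k; first by rewrite gT gC row_a // eq_sym.
exact: g0.
Qed.

End QuadraticCase.

(** * Polynomial functions *)

Module PolynomialFunctionTheory.
Import mpoly.

Section Theory.
Variables (R : idomainType) (d : nat).
Implicit Types (p q : 'cV[R]_d -> R).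

Lemma poly_fun_cst k (c : R) : poly_fun k (fun _ : 'cV[R]_d => c).
Proof.
exists c%:MP => [|x]; last by rewrite mevalC.
by rewrite msizeC; case: (c == 0).
Qed.

Lemma poly_funD k p q : poly_fun k p -> poly_fun k q -> poly_fun k (fun x => p x + q x).
Proof.
move=> [P Pk pE] [Q Qk qE]; exists (P + Q) => [|x]; last by rewrite mevalD pE qE.
by rewrite (leq_trans (msizeD_le _ _)) // geq_max Pk Qk.
Qed.

Lemma poly_funZ k (c : R) p : poly_fun k p -> poly_fun k (fun x => c * p x).
Proof.
move=> [P Pk pE]; exists (c *: P) => [|x]; last by rewrite mevalZ pE.
exact: leq_trans (msizeZ_le _ _) Pk.
Qed.

Lemma poly_fun_sum k (I : Type) (r : seq I) (P : pred I) (p : I -> 'cV[R]_d -> R) :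
  (forall i, P i -> poly_fun k (p i)) -> poly_fun k (fun x => \sum_(i <- r | P i) p i x).
Proof.
move=> pk; elim: r => [|i r [Q Qk QE]].
  by have [Q Qk QE] := poly_fun_cst k 0; exists Q => // x; rewrite big_nil -QE.
case Pi: (P i); last by exists Q => // x; rewrite big_cons Pi.
have [Q' Q'k Q'E] := poly_funD (pk i Pi) (ex_intro2 _ _ Q Qk QE).
by exists Q' => // x; rewrite big_cons Pi -Q'E.
Qed.

Lemma poly_fun_coord i : poly_fun 1 (fun x : 'cV[R]_d => x i 0).
Proof. by exists 'X_i => [|x]; rewrite ?mevalXU // msizeX mdeg1. Qed.

Lemma poly_funM k l p q : poly_fun k p -> poly_fun l q ->
  poly_fun (k + l) (fun x => p x * q x).
Proof.
move=> [P Pk pE] [Q Ql qE]; exists (P * Q) => [|x]; last by rewrite mevalM pE qE.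
have [->|P0] := eqVneq P 0; first by rewrite mul0r msize0.
have [->|Q0] := eqVneq Q 0; first by rewrite mulr0 msize0.
rewrite msizeM // -subn1 leq_subLR; apply: leq_trans (leq_add Pk Ql) _.
by rewrite addSn addnS add1n.
Qed.

Lemma poly_fun_ext k p q : (forall x, p x = q x) -> poly_fun k p -> poly_fun k q.
Proof. by move=> pq [P Pk pE]; exists P => // x; rewrite -pq. Qed.

(** [poly_fun] hides a formal polynomial; this principle lets the later sections argue on functions
    alone. The degree is only a bound, hence the premise that raises it. *)
Lemma poly_fun_ind (Q : nat -> ('cV[R]_d -> R) -> Prop) :
    (forall k f g, (forall x, f x = g x) -> Q k f -> Q k g) ->
    (forall k f g, Q k f -> Q k g -> Q k (fun x => f x + g x)) ->
    (forall k c f, Q k f -> Q k (fun x => c * f x)) ->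
    (forall k f, Q k f -> Q k.+1 f) ->
    Q 0 (fun=> 1) ->
    (forall k i f, Q k f -> Q k.+1 (fun x => x i 0 * f x)) ->
  forall k p, poly_fun k p -> Q k p.
Proof.
move=> Qext Qadd Qscale Qwiden Q1 Qcoord k p [P Pk pE].
have Qcst l (c : R) : Q l (fun=> c).
  apply: (Qext l (fun=> c * 1)) => [x|]; first by rewrite mulr1.
  by apply: Qscale; elim: l => // l; apply: Qwiden.
have Qmon l (m : 'X_{1..d}) : (mdeg m <= l)%N -> Q l (fun x => \prod_i x i 0 ^+ m i).
  elim: l m => [|l IH] m ml.
    move: ml; rewrite leqn0 mdeg_eq0 => /eqP ->.
    by apply: Qext (Qcst 0%N 1) => x; rewrite big1 // => i _; rewrite mnm0E.
  have [i mi|m0] := pickP (fun i => m i != 0%N); last first.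
    apply: Qext (Qcst l.+1 1) => x; rewrite big1 // => i _.
    by have /negbFE/eqP -> := m0 i.
  have mE : m = (U_(i) + (m - U_(i)))%MM.
    apply/mnmP => j; rewrite !mnmE; case: (eqVneq i j) => [<-|_].
      by rewrite subnKC // lt0n.
    by rewrite add0n subn0.
  have ml' : (mdeg (m - U_(i))%MM <= l)%N by move: ml; rewrite {1}mE mdegD mdeg1 add1n.
  apply: Qext (Qcoord _ i _ (IH _ ml')) => x.
  transitivity (\prod_j (x j 0 ^+ U_(i)%MM j * x j 0 ^+ (m - U_(i))%MM j)); last first.
    by apply: eq_bigr => j _; rewrite -exprD -mnmDE -mE.
  rewrite big_split /=; congr (_ * _).
  rewrite (bigD1 i) //= mnm1E eqxx expr1 big1 ?mulr1 // => j ji.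
  by rewrite mnm1E eq_sym (negPf ji) expr0.
have {}Pk m : m \in msupp P -> (mdeg m <= k)%N.
  by move=> mP; rewrite -ltnS; apply: leq_trans (msize_mdeg_lt mP) Pk.
apply: (Qext k (fun x => \sum_(m <- msupp P) P@_m * \prod_i x i 0 ^+ m i)) => [x|].
  by rewrite pE mevalE.
elim: (msupp P) Pk => [|m r IH] mk.
  by apply: Qext (Qcst k 0) => x; rewrite big_nil.
apply: (Qext k (fun x => P@_m * \prod_i x i 0 ^+ m i +
                  \sum_(m <- r) P@_m * \prod_i x i 0 ^+ m i)) => [x|].
  by rewrite big_cons.
apply: Qadd; last by apply: IH => m' m'r; apply: mk; rewrite inE m'r orbT.
by apply: Qscale; apply: Qmon; apply: mk; rewrite inE eqxx.
Qed.

Lemma homog_fun1P p :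
  homog_fun 1 p <-> exists c : 'I_d -> R, forall x, p x = \sum_i c i * x i 0.
Proof.
split=> [[P Ph pE]|[c pE]]; last first.
  exists (\sum_i c i *: 'X_i) => [|x].
    by apply: rpred_sum => i _; apply: rpredZ; rewrite dhomogX /= mdeg1.
  by rewrite pE raddf_sum; apply: eq_bigr => i _; rewrite /= mevalZ mevalXU.
move/dhomogP: Ph => Ph.
have : forall r : seq 'X_{1..d}, {in r, forall m, mdeg m = 1%N} ->
    exists c : 'I_d -> R, forall x : 'cV[R]_d,
      \sum_(m <- r) P@_m * \prod_i x i 0 ^+ m i = \sum_i c i * x i 0.
  elim=> [_|m r IH mr].
    by exists (fun=> 0) => x; rewrite big_nil big1 // => i _; rewrite mul0r.
  have [m' m'r|c cE] := IH; first by apply: mr; rewrite inE m'r orbT.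
  have /mdeg1P[i /eqP mE] : mdeg m == 1%N by rewrite mr // inE eqxx.
  exists (fun j => P@_m * (i == j)%:R + c j) => x; rewrite big_cons cE.
  under [in RHS]eq_bigr do rewrite mulrDl; rewrite big_split /=; congr (_ + _).
  rewrite [in RHS](bigD1 i) //= eqxx mulr1 [in RHS]big1 ?addr0; last first.
    by move=> j /negPf ji; rewrite eq_sym ji mulr0 mul0r.
  congr (_ * _); rewrite mE (bigD1 i) //= mnm1E eqxx expr1 big1 ?mulr1 // => j ji.
  by rewrite mnm1E eq_sym (negPf ji).
move=> /(_ (msupp P) Ph)[c cE]; exists c => x; by rewrite pE mevalE cE.
Qed.

End Theory.
End PolynomialFunctionTheory.
Export PolynomialFunctionTheory.

From mathcomp Require Import all_classical all_reals all_analysis.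
Import Order.TTheory GRing.Theory Num.Theory numFieldNormedType.Exports.

Local Open Scope classical_set_scope.
Local Open Scope ring_scope.

(** * Bases of subspaces *)

Section Bases.
Variables (R : realType) (V : lmodType R).
Implicit Types (S : set V).

Definition linear_subspace S := S 0 /\ forall a x y, S x -> S y -> S (a *: x + y).

Definition linear_on S (phi : V -> R) :=
  forall a x y, S x -> S y -> phi (a *: x + y) = a * phi x + phi y.

Lemma subspaceZ S a x : linear_subspace S -> S x -> S (a *: x).
Proof. by move=> [S0 Slin] Sx; have := Slin a _ _ Sx S0; rewrite addr0. Qed.

Lemma subspaceD S x y : linear_subspace S -> S x -> S y -> S (x + y).
Proof. by move=> [_ Slin] Sx Sy; have := Slin 1 _ _ Sx Sy; rewrite scale1r. Qed.

Lemma subspace_sum S (I : Type) (r : seq I) (P : pred I) (x : I -> V) :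
  linear_subspace S -> (forall i, P i -> S (x i)) -> S (\sum_(i <- r | P i) x i).
Proof.
move=> Ssub Sx; elim/big_rec: _ => [|i y Pi Sy]; first by case: Ssub.
by apply: subspaceD => //; exact: Sx.
Qed.

Lemma linear_on0 S phi : linear_subspace S -> linear_on S phi -> phi 0 = 0.
Proof.
by move=> [S0 _] /(_ (-1) _ _ S0 S0); rewrite scaler0 addr0 mulN1r addNr.
Qed.

Lemma linear_on_sum S phi (I : Type) (r : seq I) (c : I -> R) (x : I -> V) :
  linear_subspace S -> linear_on S phi -> (forall i, S (x i)) ->
  phi (\sum_(i <- r) c i *: x i) = \sum_(i <- r) c i * phi (x i).
Proof.
move=> Ssub Slin Sx; elim: r => [|i r IH]; first by rewrite !big_nil (linear_on0 Ssub).
rewrite !big_cons Slin // ?IH //; apply: subspace_sum => // j _.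
exact: subspaceZ.
Qed.

Lemma basis_mem S n (b : 'I_n -> V) i : is_basis S b -> S (b i).
Proof.
move=> [_ ->]; exists (fun j => (j == i)%:R) => //=.
by rewrite (bigD1 i) //= eqxx scale1r big1 ?addr0 // => j /negPf ->; rewrite scale0r.
Qed.

(** [unisolvent] fixes arbitrary bases. Vanishing on such a basis is extended here to the whole test
    space, in which a convenient test function can then be chosen. *)
Lemma basis_ext0 S n (b : 'I_n -> V) phi x :
  linear_subspace S -> linear_on S phi -> is_basis S b ->
  (forall i, phi (b i) = 0) -> S x -> phi x = 0.
Proof.
move=> Ssub philin bS phib0 Sx.
have : range (fun c : 'I_n -> R => \sum_i c i *: b i) x by case: bS => _ <-.
move=> [c _ <-]; rewrite (linear_on_sum _ _ Ssub philin) => [|i]; last exact: basis_mem bS.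
by rewrite big1 // => i _; rewrite phib0 mulr0.
Qed.

(** The matrices expressing each family in the other multiply to the identity. *)
Lemma basis_size_le S m n (b : 'I_m -> V) (b' : 'I_n -> V) :
  is_basis S b -> is_basis S b' -> (m <= n)%N.
Proof.
move=> bS b'S.
have /choice[A bA] i : exists a : 'I_n -> R, b i = \sum_j a j *: b' j.
  have := basis_mem i bS; case: (b'S) => _ -> [a _ <-]; by exists a.
have /choice[B bB] i : exists a : 'I_m -> R, b' i = \sum_j a j *: b j.
  have := basis_mem i b'S; case: (bS) => _ -> [a _ <-]; by exists a.
apply: (@mulmx1_min _ _ _ (\matrix_(i, j) A i j) (\matrix_(i, j) B i j)).
apply/matrixP => i k; apply/eqP; rewrite -subr_eq0; apply/eqP.
have [bfree _] := bS.
pose c k := (\matrix_(i, j) A i j *m \matrix_(i, j) B i j) i k - (1%:M : 'M[R]_m) i k.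
apply: (bfree c); rewrite /c.
under eq_bigr do rewrite scalerBl; rewrite sumrB.
have -> : \sum_j (1%:M : 'M[R]_m) i j *: b j = b i.
  rewrite (bigD1 i) //= mxE eqxx scale1r big1 ?addr0 // => j ji.
  by rewrite mxE eq_sym (negPf ji) scale0r.
rewrite (bA i); under [X in _ - X]eq_bigr do rewrite bB scaler_sumr.
rewrite exchange_big /=; apply/eqP; rewrite subr_eq0; apply/eqP.
apply: eq_bigr => l _; rewrite mxE scaler_suml.
by apply: eq_bigr => q _; rewrite !mxE scalerA.
Qed.

Lemma basis_size S m n (b : 'I_m -> V) (b' : 'I_n -> V) :
  is_basis S b -> is_basis S b' -> m = n.
Proof.
by move=> h h'; apply/eqP; rewrite eqn_leq (basis_size_le h h') (basis_size_le h' h).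
Qed.

(** The tool for computing dimensions. Biorthogonality gives independence and injectivity of the
    functionals gives generation; the diagonal values need only be nonzero, so no functional has to
    be normalised. *)
Lemma dual_basis (J : finType) S (b : J -> V) (phi : J -> V -> R) :
  linear_subspace S -> (forall j, S (b j)) -> (forall j, linear_on S (phi j)) ->
  (forall i j, i != j -> phi i (b j) = 0) -> (forall j, phi j (b j) != 0) ->
  (forall x, S x -> (forall j, phi j x = 0) -> x = 0) ->
  exists b' : 'I_#|J| -> V, is_basis S b'.
Proof.
move=> Ssub Sb philin phib0 phib phi_inj.
have sumE (c : 'I_#|J| -> R) :
    \sum_i c i *: b (enum_val i) = \sum_j c (enum_rank j) *: b j.
  rewrite (reindex enum_rank) /=; last by apply: onW_bij; exact: enum_rank_bij.
  by apply: eq_bigr => j _; rewrite enum_rankK.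
have Ssum (c : J -> R) : S (\sum_j c j *: b j).
  by apply: subspace_sum => // j _; apply: subspaceZ.
have phisum (c : J -> R) i : phi i (\sum_j c j *: b j) = c i * phi i (b i).
  rewrite (linear_on_sum _ _ Ssub) // (bigD1 i) //= big1 ?addr0 // => j ji.
  by rewrite phib0 ?mulr0 // eq_sym.
exists (fun i => b (enum_val i)); split=> [c|].
  rewrite sumE => c0 i; have := phisum (fun j => c (enum_rank j)) (enum_val i).
  rewrite c0 (linear_on0 Ssub) // enum_valK => /esym /eqP.
  by rewrite mulf_eq0 (negPf (phib _)) orbF => /eqP.
apply/seteqP; split=> [x Sx|x [c _ <-]]; last by rewrite sumE.
pose c j := phi j x / phi j (b j).
exists (fun i => c (enum_val i)) => //; rewrite sumE.
under eq_bigr do rewrite enum_rankK.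
apply/esym/eqP; rewrite -subr_eq0; apply/eqP; apply: phi_inj.
  by rewrite -scaleN1r addrC; case: Ssub => _; apply.
move=> i; rewrite -scaleN1r addrC philin // phisum /c divfK ?phib //.
by rewrite mulN1r addNr.
Qed.

Lemma basis_sum S1 S2 m n (b1 : 'I_m -> V) (b2 : 'I_n -> V) :
  is_basis S1 b1 -> is_basis S2 b2 ->
  (forall x y, S1 x -> S2 y -> x + y = 0 -> x = 0) ->
  exists b : 'I_(m + n) -> V,
    is_basis [set z | exists x y, [/\ S1 x, S2 y & z = x + y]] b.
Proof.
move=> [f1 ->] [f2 ->] S12.
exists (fun i => match fintype.split i with inl j => b1 j | inr j => b2 j end).
have sumE (c : 'I_(m + n) -> R) :
  \sum_i c i *: match fintype.split i with inl j => b1 j | inr j => b2 j end =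
  \sum_i c (lshift n i) *: b1 i + \sum_i c (rshift m i) *: b2 i.
  rewrite big_split_ord /=; congr (_ + _); apply: eq_bigr => i _.
    by rewrite (unsplitK (inl i)).
  by rewrite (unsplitK (inr i)).
split=> [c|].
  rewrite sumE => c0.
  have h1 := S12 _ _ (ex_intro2 _ _ (fun i => c (lshift n i)) I erefl)
                 (ex_intro2 _ _ (fun i => c (rshift m i)) I erefl) c0.
  move: c0; rewrite h1 add0r => h2 i; rewrite -(splitK i).
  by case: (fintype.split i) => j; [exact: (f1 _ h1) | exact: (f2 _ h2)].
apply/seteqP; split=> [z [x [y [[c _ <-] [c' _ <-] ->]]]|z [c _ <-]].
  exists (fun i => match fintype.split i with inl j => c j | inr j => c' j end) => //.
  rewrite sumE; congr (_ + _); apply: eq_bigr => i _.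
    by rewrite (unsplitK (inl i)).
  by rewrite (unsplitK (inr i)).
exists (\sum_i c (lshift n i) *: b1 i), (\sum_i c (rshift m i) *: b2 i).
by split; [exists (fun i => c (lshift n i)) | exists (fun i => c (rshift m i)) |
           rewrite sumE].
Qed.

End Bases.

(** * Barycentric coordinates *)

Section Dot.
Variables (R : realType) (d : nat).
Implicit Types (x y z : 'cV[R]_d) (A : 'M[R]_d).

Lemma dotE x y : dot x y = \sum_i x i 0 * y i 0.
Proof. by rewrite /dot mxE; apply: eq_bigr => i _; rewrite mxE. Qed.

Lemma dotC x y : dot x y = dot y x.
Proof. by rewrite !dotE; apply: eq_bigr => i _; rewrite mulrC. Qed.

Lemma dotDl x y z : dot (x + y) z = dot x z + dot y z.
Proof. by rewrite /dot linearD mulmxDl mxE. Qed.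

Lemma dotDr x y z : dot z (x + y) = dot z x + dot z y.
Proof. by rewrite /dot mulmxDr mxE. Qed.

Lemma dotZl c x y : dot (c *: x) y = c * dot x y.
Proof. by rewrite /dot linearZ -scalemxAl mxE. Qed.

Lemma dotZr c x y : dot x (c *: y) = c * dot x y.
Proof. by rewrite /dot -scalemxAr mxE. Qed.

Lemma dotNl x y : dot (- x) y = - dot x y.
Proof. by rewrite -scaleN1r dotZl mulN1r. Qed.

Lemma dotNr x y : dot x (- y) = - dot x y.
Proof. by rewrite -scaleN1r dotZr mulN1r. Qed.

Lemma dotBl x y z : dot (x - y) z = dot x z - dot y z.
Proof. by rewrite dotDl dotNl. Qed.

Lemma dotBr x y z : dot z (x - y) = dot z x - dot z y.
Proof. by rewrite dotDr dotNr. Qed.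

Lemma dot0l x : dot 0 x = 0.
Proof. by rewrite -(scale0r x) dotZl mul0r. Qed.

Lemma dot0r x : dot x 0 = 0.
Proof. by rewrite dotC dot0l. Qed.

Lemma dot_suml (I : Type) (r : seq I) (P : pred I) (F : I -> 'cV[R]_d) y :
  dot (\sum_(i <- r | P i) F i) y = \sum_(i <- r | P i) dot (F i) y.
Proof. by rewrite (big_morph (fun x => dot x y) (fun a b => dotDl a b y) (dot0l y)). Qed.

Lemma dot_sumr (I : Type) (r : seq I) (P : pred I) (F : I -> 'cV[R]_d) y :
  dot y (\sum_(i <- r | P i) F i) = \sum_(i <- r | P i) dot y (F i).
Proof. by rewrite (big_morph (dot y) (fun a b => dotDr a b y) (dot0r y)). Qed.

Lemma dot_ge0 x : 0 <= dot x x.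
Proof. by rewrite dotE; apply: sumr_ge0 => i _; rewrite -expr2 sqr_ge0. Qed.

Lemma dot_eq0 x : (dot x x == 0) = (x == 0).
Proof.
apply/eqP/eqP => [|->]; last exact: dot0l.
rewrite dotE => /eqP; rewrite psumr_eq0 => [/allP h|i _]; last by rewrite -expr2 sqr_ge0.
apply/colP => i; rewrite mxE; have := h i; rewrite mem_index_enum -expr2 sqrf_eq0.
by move=> /(_ isT)/eqP.
Qed.

Lemma dot_gt0 x : (0 < dot x x) = (x != 0).
Proof. by rewrite lt0r dot_ge0 dot_eq0 andbT. Qed.

Lemma dot_mul A x y : (x^T *m A *m y) 0 0 = dot x (A *m y).
Proof. by rewrite /dot mulmxA. Qed.

Lemma dot_mulC A x y : A^T = A -> dot x (A *m y) = dot y (A *m x).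
Proof.
move=> AT; transitivity ((x^T *m (A *m y))^T 0 0); first by rewrite mxE.
by rewrite !trmx_mul trmxK AT dot_mul.
Qed.

Lemma dot_ext x y : (forall z, dot x z = dot y z) -> x = y.
Proof.
by move=> xy; apply/eqP; rewrite -subr_eq0 -dot_eq0 dotBl xy subrr.
Qed.

End Dot.

Section Barycentric.
Variables (R : realType) (d : nat) (v : 'I_d.+1 -> 'cV[R]_d).
Local Notation I := 'I_d.+1.

(** Row [i] is the vertex [v i] in homogeneous coordinates. Column [i] of the inverse holds the
    constant term and the gradient of the barycentric coordinate of [v i]. *)
Definition vertex_mx : 'M[R]_(1 + d) :=
  \matrix_(i < 1 + d) row_mx (1%:M : 'M[R]_1) (v i)^T.

Definition lam (i : I) (x : 'cV[R]_d) : R :=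
  (row_mx (1%:M : 'M[R]_1) x^T *m invmx vertex_mx) 0 i.

Definition gl (i : I) : 'cV[R]_d := \col_k invmx vertex_mx (rshift 1 k) i.

Lemma lamE i x : lam i x = lam i 0 + dot (gl i) x.
Proof.
rewrite /lam !mxE !big_split_ord /= !big_ord1 !row_mxEl; congr (_ + _).
  rewrite -[LHS]addr0; congr (_ + _); apply/esym/big1 => k _.
  by rewrite row_mxEr !mxE mul0r.
by rewrite dotE; apply: eq_bigr => k _; rewrite row_mxEr !mxE mulrC.
Qed.

Lemma lamD i x y : lam i (x + y) = lam i x + dot (gl i) y.
Proof. by rewrite lamE dotDr addrA -lamE. Qed.

Hypothesis hv : affinely_independent v.

Lemma vertex_mx_unit : vertex_mx \in unitmx.
Proof.
rewrite -row_free_unit; apply: inj_row_free => u; rewrite /vertex_mx => u0.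
have h : forall j, \sum_(i < 1 + d) u 0 i * row_mx (1%:M : 'M[R]_1) (v i)^T 0 j = 0.
  move=> j; transitivity ((u *m vertex_mx) 0 j); last by rewrite u0 mxE.
  by rewrite [RHS]mxE; apply: eq_bigr => i _; rewrite [in RHS]mxE.
apply/rowP => i; rewrite mxE; move: i; refine (@hv (fun i => u 0 i) _ _).
  rewrite -[RHS](h (lshift d 0)); apply: eq_bigr => i _.
  by rewrite row_mxEl mxE eqxx mulr1.
apply/colP => k; rewrite summxE mxE -[RHS](h (rshift 1 k)); apply: eq_bigr => i _.
by rewrite row_mxEr !mxE.
Qed.

Lemma lam_sums x :
  row_mx (1%:M : 'M[R]_1) x^T = row_mx (\sum_i lam i x)%:M (\sum_i lam i x *: v i)^T.
Proof.
rewrite -[LHS](mulmxKV vertex_mx_unit).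
apply/rowP => j; rewrite mxE -[j](splitK) /unsplit; case: (fintype.split j) => k.
  rewrite row_mxEl [RHS]mxE; have -> : k = 0 by apply: val_inj; case: k => [[]].
  rewrite eqxx mulr1n; apply: eq_bigr => i _.
  by rewrite -/(lam i x) [X in _ * X]mxE row_mxEl [X in _ * X]mxE eqxx mulr1.
rewrite row_mxEr [RHS]mxE summxE; apply: eq_bigr => i _.
by rewrite -/(lam i x) [X in _ * X]mxE row_mxEr !mxE.
Qed.

Lemma sum_lam x : \sum_i lam i x = 1.
Proof.
have := congr1 (fun M : 'rV[R]_(1 + d) => M 0 (lshift d 0)) (lam_sums x).
by rewrite /= !row_mxEl !mxE eqxx !mulr1n => <-.
Qed.

Lemma sum_lam_vertex x : \sum_i lam i x *: v i = x.
Proof.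
apply/colP => k; have := congr1 (fun M : 'rV[R]_(1 + d) => M 0 (rshift 1 k)) (lam_sums x).
by rewrite /= !row_mxEr !mxE => <-.
Qed.

Lemma lam_comb (c : I -> R) i : \sum_j c j = 1 -> lam i (\sum_j c j *: v j) = c i.
Proof.
move=> c1; apply/eqP; rewrite -subr_eq0; apply/eqP.
set x := \sum_j _; move: i; refine (@hv (fun i => lam i x - c i) _ _).
  by rewrite sumrB sum_lam c1 subrr.
under eq_bigr do rewrite scalerBl.
by rewrite sumrB sum_lam_vertex subrr.
Qed.

Lemma lam_vertex i j : lam i (v j) = (i == j)%:R.
Proof.
rewrite -(@lam_comb (fun k => (k == j)%:R)).
  congr lam; rewrite (bigD1 j) //= eqxx scale1r big1 ?addr0 // => k /negPf ->.
  by rewrite scale0r.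
by rewrite (bigD1 j) //= eqxx big1 ?addr0 // => k /negPf ->.
Qed.

Lemma gl_vertexB i j k : dot (gl i) (v j - v k) = (i == j)%:R - (i == k)%:R.
Proof.
by have := lamD i (v k) (v j - v k); rewrite addrC subrK !lam_vertex => ->; ring.
Qed.

Lemma gl_vertex i j : dot (gl i) (v j) = (i == j)%:R - lam i 0.
Proof. by rewrite -lam_vertex lamE; ring. Qed.

Lemma sum_gl : \sum_i gl i = 0.
Proof.
apply: dot_ext => x; rewrite dot0l dot_suml.
have := sum_lam x; under eq_bigr do rewrite lamE.
by rewrite big_split /= sum_lam => /(canRL (addKr _)) ->; rewrite addNr.
Qed.

Lemma sum_gl_dot x : \sum_i dot (gl i) x = 0.
Proof. by rewrite -dot_suml sum_gl dot0l. Qed.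

Lemma gl_expand x : \sum_i dot (gl i) x *: v i = x.
Proof.
have := sum_lam_vertex x; under eq_bigr do rewrite lamE scalerDl.
by rewrite big_split /= sum_lam_vertex add0r.
Qed.

(** The transpose of [gl_expand]: both say that the sum of the matrices [v i *m (gl i)^T] is the
    identity. *)
Lemma gl_span y : y = \sum_i dot y (v i) *: gl i.
Proof.
apply: dot_ext => x; rewrite -[in LHS](gl_expand x) dot_sumr dot_suml.
by apply: eq_bigr => i _; rewrite dotZr dotZl mulrC.
Qed.

Lemma gl_mx_eq0 (A : 'M[R]_d) : (forall j k, dot (gl j) (A *m gl k) = 0) -> A = 0.
Proof.
move=> A0.
suff Ay x y : dot x (A *m y) = 0.
  apply/matrixP => i j; have := Ay (delta_mx i 0) (delta_mx j 0).
  rewrite /dot mulmxA trmx_delta -rowE -colE !mxE => ->.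
  by [].
rewrite (gl_span x) (gl_span y) dot_suml big1 // => j _.
rewrite mulmx_sumr dot_sumr big1 // => k _.
by rewrite -scalemxAr dotZl dotZr A0 !mulr0.
Qed.

Lemma gl_vec_eq0 (x : 'cV[R]_d) : (forall j, dot (gl j) x = 0) -> x = 0.
Proof. by move=> x0; rewrite -(gl_expand x) big1 // => i _; rewrite x0 scale0r. Qed.

Implicit Types (f : {set I}).

Lemma pointsP f x : points v f x <->
  (forall i, 0 <= lam i x) /\ (forall i, i \notin f -> lam i x = 0).
Proof.
split=> [[c [c0 c1 ->]]|[l0 lf]].
  pose c' i := if i \in f then c i else 0.
  have -> : \sum_(i in f) c i *: v i = \sum_i c' i *: v i.
    rewrite big_mkcond; apply: eq_bigr => i _; rewrite /c'.
    by case: (i \in f); rewrite // scale0r.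
  have c'1 : \sum_i c' i = 1 by rewrite -c1 [RHS]big_mkcond.
  by split=> i; rewrite lam_comb // /c'; [case: (i \in f) | move/negPf ->].
exists (fun i => lam i x); split=> //.
  by rewrite -(sum_lam x) [RHS](bigID [in f]) /= [X in _ + X]big1 ?addr0.
rewrite -[LHS](sum_lam_vertex x) (bigID [in f]) /= [X in _ + X]big1 ?addr0 // => i.
by move=> /lf ->; rewrite scale0r.
Qed.

Lemma tangentP f x : tangent v f x <-> forall i, i \notin f -> dot (gl i) x = 0.
Proof.
split=> [[c [c0 ->]] i iF|xf].
  rewrite dot_sumr; under eq_bigr => j jf.
    rewrite dotZr gl_vertex; have /negPf -> : i != j by apply: contraNneq iF => ->.
    rewrite sub0r; over.
  by rewrite -mulr_suml c0 mul0r.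
exists (fun i => dot (gl i) x); split.
  transitivity (\sum_i dot (gl i) x); last exact: sum_gl_dot.
  by rewrite [RHS](bigID [in f]) /= [X in _ + X]big1 ?addr0.
rewrite -[LHS](gl_expand x) (bigID [in f]) /= [X in _ + X]big1 ?addr0 // => i.
by move=> /xf ->; rewrite scale0r.
Qed.

Lemma points_vertex f i : i \in f -> points v f (v i).
Proof.
move=> iF; apply/pointsP; split=> j; rewrite lam_vertex ?ler0n // => jF.
by case: eqVneq jF => // ->; rewrite iF.
Qed.

Definition midpoint i j : 'cV[R]_d := 2^-1 *: (v i + v j).

Lemma lam_midpoint k i j : lam k (midpoint i j) = ((k == i)%:R + (k == j)%:R) / 2.
Proof.
rewrite /midpoint scalerDr lamE dotDr !dotZr !gl_vertex.
by field.
Qed.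

Lemma points_midpoint f i j : i \in f -> j \in f -> points v f (midpoint i j).
Proof.
move=> iF jF; apply/pointsP; split=> k; rewrite lam_midpoint.
  by rewrite divr_ge0 ?addr_ge0 ?ler0n.
move=> kF; case: eqVneq kF => [->|_]; first by rewrite iF.
by case: eqVneq => [->|_]; rewrite ?jF // addr0 mul0r.
Qed.

End Barycentric.

(** * Gram determinants *)

Lemma posdef_det_gt0 (R : realFieldType) n (G : 'M[R]_n) : G^T = G ->
  (forall u : 'rV[R]_n, u != 0 -> 0 < (u *m G *m u^T) 0 0) -> 0 < \det G.
Proof.
elim: n G => [|n IH] G GT Gpos; first by rewrite det_mx00.
(* Induction through the Schur complement of the upper left entry. *)
pose G' : 'M[R]_(1 + n) := G.
have GE : G' = block_mx (ulsubmx G') (ursubmx G') (dlsubmx G') (drsubmx G').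
  by rewrite submxK.
set a := ulsubmx G' in GE; set b := ursubmx G' in GE.
set c := dlsubmx G' in GE; set D := drsubmx G' in GE.
have G'T : G'^T = G' := GT.
have cE : c = b^T by rewrite /b trmx_ursub G'T.
have DT : D^T = D by rewrite /D trmx_drsub G'T.
have aE : a = (a 0 0)%:M by apply: mx11_scalar.
have form (u0 : 'rV[R]_1) (u1 : 'rV[R]_n) :
    row_mx u0 u1 *m G' *m (row_mx u0 u1)^T =
    (u0 *m a + u1 *m c) *m u0^T + (u0 *m b + u1 *m D) *m u1^T.
  by rewrite GE mul_row_block tr_row_mx mul_row_col.
have a0 : 0 < a 0 0.
  have := Gpos (row_mx (1%:M : 'M[R]_1) 0).
  rewrite form !mul0mx !addr0 trmx0 mulmx0 addr0 mul1mx trmx1 mulmx1.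
  apply; apply/eqP => /(congr1 (fun M : 'rV[R]_(1 + n) => M 0 (lshift n 0))).
  by rewrite /= row_mxEl !mxE eqxx => /eqP; rewrite oner_eq0.
have fact : G' = block_mx 1%:M 0 ((a 0 0)^-1 *: c) 1%:M *m
                 block_mx a b 0 (D - (a 0 0)^-1 *: (c *m b)).
  rewrite mulmx_block !mul1mx !mul0mx !addr0 -!scalemxAl [in LHS]GE.
  congr block_mx; last by rewrite addrC subrK.
  by rewrite [X in c *m X]aE mul_mx_scalar scalerA mulVf ?scale1r // gt_eqF.
have -> : \det G = \det G' by [].
rewrite fact det_mulmx det_lblock det_ublock !det1 !mul1r det_mx11.
apply: mulr_gt0 => //; apply: IH => [|u u0].
  by rewrite linearB linearZ /= trmx_mul DT cE trmxK.
pose u' := - ((a 0 0)^-1 *: (u *m c)).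
have : row_mx u' u != 0.
  by apply: contraNneq u0 => /(congr1 rsubmx); rewrite row_mxKr linear0 => ->.
move=> /Gpos; rewrite form.
have -> : u' *m a + u *m c = 0.
  by rewrite /u' mulNmx -scalemxAl [X in u *m c *m X]aE mul_mx_scalar scalerA
    mulVf ?gt_eqF // scale1r addNr.
rewrite mul0mx add0r /u' mulNmx -scalemxAl.
by rewrite mulmxBr -scalemxAr mulmxA addrC.
Qed.

(** Positivity ensures that the factor [Num.sqrt (gram_det E)] in [integral_on] can be cancelled. *)
Lemma gram_det_gt0 (R : realType) (d : nat) (E : seq 'cV[R]_d) :
  (forall c : 'I_(size E) -> R, \sum_i c i *: E`_i = 0 -> forall i, c i = 0) ->
  0 < gram_det E.
Proof.
move=> free; apply: posdef_det_gt0 => [|u u0].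
  by apply/matrixP => i j; rewrite !mxE dotC.
have -> : (u *m (\matrix_(i, j) dot E`_i E`_j) *m u^T) 0 0 =
    dot (\sum_i u 0 i *: E`_i) (\sum_i u 0 i *: E`_i).
  rewrite mxE dot_sumr; apply: eq_bigr => j _; rewrite dotZr mulrC !mxE; congr (_ * _).
  by rewrite dot_suml; apply: eq_bigr => i _; rewrite dotZl !mxE.
rewrite dot_gt0; apply: contraNneq u0 => /free u0.
by apply/eqP/rowP => i; rewrite mxE u0.
Qed.

(** * Integrals over simplices *)

Section PolynomialIntegral.
Variable R : realType.
Implicit Types (P Q : {poly R}) (a b s t : R).

Lemma integral_deriv P a b : a <= b ->
  \int[lebesgue_measure]_(t in `[a, b]) (P^`()).[t] = P.[b] - P.[a].
Proof.
rewrite le_eqVlt => /predU1P[<-|ab]; first by rewrite set_itv1 Rintegral_set1 subrr.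
rewrite /Rintegral (@continuous_FTC2 _ _ (horner P)) //.
- by apply: continuous_subspaceT => x; exact: continuous_horner.
- split.
  + by move=> x _; exact: derivable_horner.
  + by apply: cvg_at_right_filter; exact: continuous_horner.
  + by apply: cvg_at_left_filter; exact: continuous_horner.
- by move=> x _; rewrite -derivE.
Qed.

Lemma primitive_exists Q : exists P, P^`() = Q.
Proof.
exists (\poly_(i < (size Q).+1) (if i is j.+1 then Q`_j / j.+1%:R else 0)).
apply/polyP => i; rewrite coef_deriv coef_poly ltnS.
case: ltnP => iQ; last by rewrite mul0rn nth_default.
by rewrite -(mulr_natr (Q`_i / _)) divfK ?pnatr_eq0.
Qed.

(** A primitive of [Q] is nondecreasing on [[0, s]] with equal end values, so it is constant on the
    interval and hence a constant polynomial. *)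
Lemma integral_poly_eq0 Q s : 0 < s -> (forall t, 0 <= t <= s -> 0 <= Q.[t]) ->
  \int[lebesgue_measure]_(t in `[0, s]) Q.[t] = 0 -> Q = 0.
Proof.
move=> s0; have [P <-] := primitive_exists Q.
move=> P'ge0; rewrite integral_deriv ?ltW // => /eqP; rewrite subr_eq0 => /eqP Ps.
have Pcst t : 0 <= t <= s -> P.[t] = P.[0].
  move=> /andP[t0 ts]; apply/eqP; rewrite eq_le; apply/andP; split.
    rewrite -Ps -subr_ge0 -integral_deriv //; apply: Rintegral_ge0 => x /=.
    by rewrite in_itv /= => /andP[tx xs]; apply: P'ge0; rewrite (le_trans t0) ?tx.
  rewrite -subr_ge0 -integral_deriv //; apply: Rintegral_ge0 => x /=.
  by rewrite in_itv /= => /andP[x0 xt]; apply: P'ge0; rewrite x0 (le_trans xt).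
suff -> : P = (P.[0])%:P by rewrite derivC.
apply/eqP; rewrite -subr_eq0; set D := P - _.
apply/negPn/negP => D0.
(* These are [size D] distinct points of [[0, s]], one more than the roots that [D] could have. *)
pose r := [seq s / i.+1%:R | i <- iota 0 (size D)].
have := max_poly_roots D0 (rs := r); rewrite size_map size_iota ltnn.
suff rD : all (root D) r.
  move=> /(_ rD); rewrite map_inj_uniq ?iota_uniq; first by move=> /(_ isT).
  move=> i j /= /(mulfI (lt0r_neq0 s0)) /invr_inj /eqP.
  by rewrite eqr_nat eqSS => /eqP.
apply/allP => _ /mapP[i _ ->]; rewrite /root /D hornerD hornerN hornerC subr_eq0.
apply/eqP/Pcst; apply/andP; split; first by rewrite divr_ge0 ?ler0n // ltW.
by rewrite ler_pdivrMr ?ltr0n // ler_peMr ?(ltW s0) ?ler1n.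
Qed.

(** Euler's beta integral, phrased with a primitive so that [integral_deriv] evaluates it.
    Integration by parts lowers [a] and raises [b], which is why [b] stays general in the
    induction. *)
Lemma beta_primitive (s : R) (a b : nat) : exists P : {poly R},
  P^`() = 'X ^+ a * (s%:P - 'X) ^+ b /\
  P.[s] - P.[0] = (a`! * b`!)%:R / (a + b).+1`!%:R * s ^+ (a + b).+1.
Proof.
have dX (k : nat) : ((s%:P - 'X) ^+ k.+1)^`() = - (k.+1%:R)%:P * (s%:P - 'X) ^+ k.
  rewrite deriv_exp derivB derivC derivX sub0r /= mulN1r mulNrn -(mulr_natl (_ ^+ k)).
  by rewrite polyC_natr mulNr.
have f0 (k : nat) : k`!%:R != 0 :> R by rewrite pnatr_eq0 -lt0n fact_gt0.
elim: a b => [|a IH] b.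
  exists (- (b.+1%:R^-1)%:P * (s%:P - 'X) ^+ b.+1); split.
    rewrite mulNr derivN derivM derivC mul0r add0r dX expr0 mul1r mulNr mulrN opprK.
    by rewrite mulrA -polyCM mulVf ?mul1r // pnatr_eq0.
  rewrite !hornerE !(subrr, subr0) expr0n /= mulr0 sub0r.
  rewrite ?add0n ?fact0 ?mul1n. by rewrite mulNr opprK factS natrM invfM mulrCA divff ?f0 // mulr1.
have [P [P' Ps]] := IH b.+1.
(* The product rule for the subtracted product, solved for the term with exponents [a.+1] and
   [b]. *)
exists ((b.+1%:R^-1)%:P * ((a.+1%:R)%:P * P - 'X ^+ a.+1 * (s%:P - 'X) ^+ b.+1)); split.
  rewrite derivM derivC mul0r add0r derivB derivM derivC mul0r add0r P' derivM dX.
  rewrite derivXn /= -(mulr_natl ('X^a)) polyC_natr.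
  have cP : (b.+1%:R^-1)%:P * (b.+1%:R)%:P = 1 :> {poly R}.
    by rewrite -polyCM mulVf ?pnatr_eq0.
  transitivity ((b.+1%:R^-1)%:P * (b.+1%:R)%:P * ('X^(a.+1) * (s%:P - 'X) ^+ b)).
    by ring.
  by rewrite cP mul1r.
have z0 k : 0 ^+ k.+1 = 0 :> R by rewrite expr0n.
set Q := _ * _; have -> : Q.[s] - Q.[0] = b.+1%:R^-1 * (a.+1%:R * (P.[s] - P.[0])).
  rewrite /Q !(hornerM, hornerD, hornerN, hornerC, horner_exp, hornerX).
  by rewrite subrr !z0 mulr0 mul0r !subr0 -!mulrBr.
rewrite Ps addSnnS (natrM _ a`! _) (natrM _ a.+1`! _) (factS a) (factS b).
rewrite (natrM _ a.+1 _) (natrM _ b.+1 _).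
have b0 : b.+1%:R != 0 :> R by rewrite pnatr_eq0.
have := f0 (a + b.+1).+1; move: ((a + b.+1).+1`!%:R) (s ^+ _) => N S.
by move: b.+1%:R b0 a.+1%:R => c c0 e N0; field; rewrite N0 c0.
Qed.

End PolynomialIntegral.

(** * Iterated integrals: Dirichlet's formula and positivity *)

Section SimplexIntegral.
Variables (R : realType) (d : nat) (v : 'I_d.+1 -> 'cV[R]_d).
Hypothesis hv : affinely_independent v.
Local Notation I := 'I_d.+1.
Local Notation lam := (lam v).
Local Notation edges i0 J := [seq v i - v i0 | i <- J].

Lemma lam_shift i x t e i0 :
  lam i (x + t *: (v e - v i0)) = lam i x + t * ((i == e)%:R - (i == i0)%:R).
Proof. by rewrite lamD dotZr gl_vertexB. Qed.

(* The points y = x + \sum_k t_k (v k - v i0), k \in J, with t_k >= 0 and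
   0 <= lam i0 y, for x with lam k x = 0, k \in J. *)
Definition region (i0 : I) (J : seq I) x y :=
  [/\ forall i, i \notin i0 :: J -> lam i y = lam i x,
      forall i, i \in J -> 0 <= lam i y & 0 <= lam i0 y].

Section Slice.
Variables (i0 e : I) (J : seq I) (x : 'cV[R]_d) (t : R).
Hypothesis i0eis : uniq [:: i0, e & J].
Hypothesis x0 : forall i, i \in e :: J -> lam i x = 0.
Let y := x + t *: (v e - v i0).

Let i0e : i0 != e.
Proof. by move: i0eis; rewrite /= inE negb_or => /andP[/andP[]]. Qed.

Lemma slice_uniq : uniq (i0 :: J).
Proof. by move: i0eis; rewrite /= inE negb_or => /and3P[/andP[_ ->] _ ->]. Qed.

Lemma slice_e : e \notin i0 :: J.
Proof.
by move: i0eis; rewrite /= !inE !negb_or eq_sym => /and3P[/andP[-> _] -> _].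
Qed.

Lemma slice_i0 : lam i0 y = lam i0 x - t.
Proof. by rewrite lam_shift (negPf i0e) eqxx /=; ring. Qed.

Lemma slice_lam_e : lam e y = t.
Proof. by rewrite lam_shift x0 ?mem_head // eqxx eq_sym (negPf i0e) /=; ring. Qed.

Lemma slice_other i : i != e -> i != i0 -> lam i y = lam i x.
Proof. by move=> /negPf ie /negPf ii0; rewrite lam_shift ie ii0 /=; ring. Qed.

Lemma slice_is i : i \in J -> lam i y = 0.
Proof.
move=> iis; rewrite slice_other ?x0 ?inE ?iis ?orbT //.
  by apply: contraTneq iis => ->; have := slice_e; rewrite inE negb_or => /andP[].
by apply: contraTneq iis => ->; have := slice_uniq => /= /andP[].
Qed.

(** Moving along [v e - v i0] only shifts the weight [t] from [i0] to [e]. *)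
Lemma slice_region z : 0 <= t -> region i0 J y z -> region i0 (e :: J) x z.
Proof.
move=> t0 [zo zi z0]; split=> // i.
  rewrite !inE !negb_or => /and3P[ii0 ie iis].
  by rewrite zo ?inE ?negb_or ?ii0 ?iis // slice_other.
rewrite inE => /predU1P[->|/zi//].
by rewrite zo ?slice_e // slice_lam_e.
Qed.

End Slice.

Lemma region_refl i0 J x :
  (forall i, i \in J -> lam i x = 0) -> 0 <= lam i0 x -> region i0 J x x.
Proof. by move=> x0 ?; split=> // i /x0 ->. Qed.

(** The hypotheses are the invariant of the recursion, shared by the lemmas that follow: coordinates
    still to be integrated vanish at [x], and [lam i0 x] is the size [s] of the remaining
    simplex. *)
Lemma param_integral_ext (g g' : 'cV[R]_d -> R) i0 J s x :
  uniq (i0 :: J) -> (forall i, i \in J -> lam i x = 0) -> lam i0 x = s -> 0 <= s ->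
  (forall y, region i0 J x y -> g y = g' y) ->
  param_integral g (edges i0 J) s x = param_integral g' (edges i0 J) s x.
Proof.
elim: J s x => [|e J IH] s x us x0 xs s0 gg'.
  by apply: gg'; apply: region_refl; rewrite // xs.
apply: eq_Rintegral => t; rewrite inE /= in_itv /= => /andP[t0 ts].
apply: IH.
- exact: slice_uniq us.
- by move=> i; apply: slice_is.
- by rewrite (slice_i0 _ _ us) xs.
- by rewrite subr_ge0.
by move=> y hy; apply: gg'; apply: slice_region hy.
Qed.

Lemma param_integral_ge0 (g : 'cV[R]_d -> R) i0 J s x :
  uniq (i0 :: J) -> (forall i, i \in J -> lam i x = 0) -> lam i0 x = s -> 0 <= s ->
  (forall y, region i0 J x y -> 0 <= g y) ->
  0 <= param_integral g (edges i0 J) s x.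
Proof.
elim: J s x => [|e J IH] s x us x0 xs s0 g0.
  by apply: g0; apply: region_refl; rewrite // xs.
apply: Rintegral_ge0 => t; rewrite /= in_itv /= => /andP[t0 ts].
apply: IH.
- exact: slice_uniq us.
- by move=> i; apply: slice_is.
- by rewrite (slice_i0 _ _ us) xs.
- by rewrite subr_ge0.
by move=> y hy; apply: g0; apply: slice_region hy.
Qed.

Local Notation mon m x := (\prod_i lam i x ^+ m i).

(** Integrands are explicit lists of monomials, so every inner integral has a closed form that is
    polynomial in the outer variable. *)
Definition lam_poly (L : seq (R * (I -> nat))) (x : 'cV[R]_d) : R :=
  \sum_(cm <- L) cm.1 * mon cm.2 x.

(** The exponent of the size in Dirichlet's formula; [J] includes the base vertex, and each of the
    other vertices accounts for one integration. *)
Definition dirichlet_deg (J : seq I) (m : I -> nat) : nat :=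
  (\sum_(i <- J) m i + (size J).-1)%N.

Definition dirichlet (J : seq I) (m : I -> nat) : R :=
  (\prod_(i <- J) (m i)`!)%:R / (dirichlet_deg J m)`!%:R.

Definition slice_poly L i0 e J s x : {poly R} :=
  \sum_(cm <- L) (cm.1 * (\prod_(i | i \notin [:: i0, e & J]) lam i x ^+ cm.2 i) *
    dirichlet (i0 :: J) cm.2) *:
    ('X ^+ (cm.2 e) * (s%:P - 'X) ^+ (dirichlet_deg (i0 :: J) cm.2)).

(** Dirichlet's formula for the simplex of size [s] on [i0 :: J]; the remaining coordinates are
    constant there and come out as factors. *)
Definition param_value L i0 J s x : R :=
  \sum_(cm <- L) cm.1 * (\prod_(i | i \notin i0 :: J) lam i x ^+ cm.2 i) *
    dirichlet (i0 :: J) cm.2 * s ^+ (dirichlet_deg (i0 :: J) cm.2).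

Lemma slice_polyE L i0 e J s x t :
  uniq [:: i0, e & J] -> (forall i, i \in e :: J -> lam i x = 0) ->
  param_value L i0 J (s - t) (x + t *: (v e - v i0)) = (slice_poly L i0 e J s x).[t].
Proof.
move=> us x0; rewrite /slice_poly horner_sum; apply: eq_bigr => -[c m] _ /=.
rewrite hornerZ hornerM !horner_exp hornerD hornerN hornerC hornerX.
rewrite (bigD1 e) /=; last exact: (slice_e us).
rewrite (slice_lam_e _ us) //.
rewrite (eq_bigl (fun i => i \notin [:: i0, e & J])); last first.
  by move=> i; rewrite !inE !negb_or -andbA [(i \notin J) && _]andbC.
rewrite (eq_bigr (fun i => lam i x ^+ m i)); first by ring.
by move=> i; rewrite !inE !negb_or => /and3P[ii0 ie _]; rewrite (slice_other x t).
Qed.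

(** Each edge costs one beta integral, that of a power of [lam e] against a power of the remaining
    size [s - t]. *)
Lemma param_integral_lam_poly L i0 J s x :
  uniq (i0 :: J) -> (forall i, i \in J -> lam i x = 0) -> lam i0 x = s -> 0 <= s ->
  param_integral (lam_poly L) (edges i0 J) s x = param_value L i0 J s x.
Proof.
elim: J s x => [|e J IH] s x us x0 xs s0.
  apply: eq_bigr => -[c m] _ /=; rewrite (bigD1 i0) //= xs.
  rewrite /dirichlet /dirichlet_deg !big_seq1 addn0 divff ?pnatr_eq0 -?lt0n ?fact_gt0 //.
  rewrite mulr1 -mulrA; congr (_ * _); rewrite mulrC; congr (_ * _).
  by apply: eq_bigl => i; rewrite inE.
transitivity (\int[lebesgue_measure]_(t in `[0, s]) (slice_poly L i0 e J s x).[t]).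
  apply: eq_Rintegral => t; rewrite inE /= in_itv /= => /andP[t0 ts].
  rewrite -slice_polyE //; apply: IH.
  - exact: slice_uniq us.
  - by move=> i; apply: slice_is.
  - by rewrite (slice_i0 _ _ us) xs.
  - by rewrite subr_ge0.
(* Choosing all the beta primitives simultaneously provides a primitive [Q] of the whole slice
   polynomial. *)
have [P PE] := choice (fun ab : nat * nat => beta_primitive s ab.1 ab.2).
pose N (cm : R * (I -> nat)) := dirichlet_deg (i0 :: J) cm.2.
pose Q := \sum_(cm <- L) (cm.1 * (\prod_(i | i \notin [:: i0, e & J]) lam i x ^+ cm.2 i) *
    dirichlet (i0 :: J) cm.2) *: P (cm.2 e, N cm).
have -> : slice_poly L i0 e J s x = Q^`().
  rewrite raddf_sum; apply: eq_bigr => cm _; rewrite /= derivZ.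
  by have [-> _] := PE (cm.2 e, N cm).
rewrite integral_deriv // !horner_sum -sumrB; apply: eq_bigr => -[c m] _.
rewrite !hornerZ -mulrBr; have [_ ->] := PE (m e, N (c, m)).
rewrite /N /dirichlet /=; set n := dirichlet_deg (i0 :: J) m.
have -> : dirichlet_deg [:: i0, e & J] m = (m e + n).+1.
  by rewrite /n /dirichlet_deg !big_cons /=; lia.
have : n`!%:R != 0 :> R by rewrite pnatr_eq0 -lt0n fact_gt0.
have : ((m e + n).+1)`!%:R != 0 :> R by rewrite pnatr_eq0 -lt0n fact_gt0.
rewrite !big_cons; move: (n`!) (((m e + n).+1)`!) => f1 f2 f20 f10.
by rewrite !natrM; field; rewrite f20 f10.
Qed.

(** The slice integrals form a nonnegative polynomial in [t] with zero integral, hence the zero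
    polynomial: every slice integral vanishes, not merely almost every one. The condition
    [0 < lam i0 y] excludes the slice [t = s], whose remaining simplex has size zero, so that the
    induction does not apply to it. *)
Lemma param_integral_eq0 L i0 J s x :
  uniq (i0 :: J) -> (forall i, i \in J -> lam i x = 0) -> lam i0 x = s -> 0 < s ->
  (forall y, region i0 J x y -> 0 <= lam_poly L y) ->
  param_integral (lam_poly L) (edges i0 J) s x = 0 ->
  forall y, region i0 J x y -> 0 < lam i0 y -> lam_poly L y = 0.
Proof.
elim: J s x => [|e J IH] s x us x0 xs s0 g0 int0 y [yo yi y0] y_gt0.
  (* With no edge left, all coordinates except [lam i0] agree, and the last one agrees because the
     coordinates sum to one. *)
  suff -> : y = x by [].
  apply/eqP; rewrite -subr_eq0; apply/eqP; apply: (gl_vec_eq0 hv) => j.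
  have le i : dot (gl v i) (y - x) = lam i y - lam i x by rewrite dotBr !(lamE v i y, lamE v i x); ring.
  have [->|ji] := eqVneq j i0; last by rewrite le yo ?inE // subrr.
  have := sum_gl_dot hv (y - x); rewrite (bigD1 i0) //= big1 ?addr0 // => i ii0.
  by rewrite le yo ?inE // subrr.
have slice t : 0 <= t <= s ->
    param_integral (lam_poly L) (edges i0 J) (s - t) (x + t *: (v e - v i0)) =
    (slice_poly L i0 e J s x).[t].
  move=> /andP[t0 ts]; rewrite param_integral_lam_poly ?slice_polyE //.
  - exact: slice_uniq us.
  - by move=> i; apply: slice_is.
  - by rewrite (slice_i0 _ _ us) xs.
  - by rewrite subr_ge0.
have poly0 : slice_poly L i0 e J s x = 0.
  apply: (integral_poly_eq0 s0) => [t ts|].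
    have /andP[t0 tls] := ts.
    rewrite -slice //; apply: param_integral_ge0.
    - exact: slice_uniq us.
    - by move=> i; apply: slice_is.
    - by rewrite (slice_i0 _ _ us) xs.
    - by rewrite subr_ge0.
    by move=> z zr; apply: g0; apply: slice_region zr.
  transitivity (param_integral (lam_poly L) (edges i0 (e :: J)) s x); last exact: int0.
  by apply: eq_Rintegral => t; rewrite inE /= in_itv /= => ts; rewrite -slice.
have t0 : 0 <= lam e y by apply: yi; rewrite mem_head.
have sumE z : (forall i, i \notin [:: i0, e & J] -> lam i z = lam i x) ->
    \sum_(i <- [:: i0, e & J]) lam i z = s.
  move=> zo.
  have h : \sum_(i <- [:: i0, e & J]) (lam i z - lam i x) = 0.
    rewrite big_uniq //=; transitivity (\sum_i (lam i z - lam i x)); last first.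
      by rewrite sumrB !sum_lam // subrr.
    by rewrite [RHS](bigID [in [:: i0, e & J]]) /= [X in _ + X]big1 ?addr0 // => i /zo ->; rewrite subrr.
  move: h; rewrite sumrB => /eqP; rewrite subr_eq0 => /eqP ->.
  by rewrite big_cons xs big_seq big1 ?addr0.
(* The coordinates of [y] on [i0], [e] and [J] sum to [s], and [lam i0 y] is positive. *)
have ts : lam e y < s.
  have : 0 <= \sum_(i <- J) lam i y.
    by rewrite big_seq; apply: sumr_ge0 => i iis; apply: yi; rewrite inE iis orbT.
  by have := sumE _ yo; rewrite !big_cons; lra.
apply: (IH (s - lam e y) (x + lam e y *: (v e - v i0))).
- exact: slice_uniq us.
- by move=> i; apply: slice_is.
- by rewrite (slice_i0 _ _ us) xs.
- by rewrite subr_gt0.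
- by move=> z zr; apply: g0; apply: slice_region zr.
- by rewrite slice ?poly0 ?horner0 // t0 ltW.
- split=> // i; last by move=> iis; apply: yi; rewrite inE iis orbT.
  rewrite inE negb_or => /andP[ii0 iis].
  have [->|ie] := eqVneq i e; first by rewrite (slice_lam_e _ us).
  by rewrite slice_other // yo // !inE !negb_or ii0 ie iis.
- exact: y_gt0.
Qed.

End SimplexIntegral.

(** * Integrals over subsimplices *)

Section IntegralOn.
Variables (R : realType) (d : nat) (v : 'I_d.+1 -> 'cV[R]_d).
Hypothesis hv : affinely_independent v.
Local Notation I := 'I_d.+1.
Local Notation lam := (lam v).
Local Notation edges i0 J := [seq v i - v i0 | i <- J].
Implicit Types (f : {set I}) (g h : 'cV[R]_d -> R).

Definition lam_poly_on f h := exists L, forall x, points v f x -> h x = lam_poly v L x.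

Lemma lam_poly_on_ext f g h :
  (forall x, points v f x -> g x = h x) -> lam_poly_on f g -> lam_poly_on f h.
Proof. by move=> gh [L gL]; exists L => x fx; rewrite -gh // gL. Qed.

Lemma lam_poly_on_cst f c : lam_poly_on f (fun=> c).
Proof.
exists [:: (c, fun=> 0%N)] => x _; rewrite /lam_poly big_seq1 /= big1 ?mulr1 //.
Qed.

Lemma lam_poly_on_lam f i : lam_poly_on f (lam i).
Proof.
exists [:: (1, fun j => (j == i : nat))] => x _; rewrite /lam_poly big_seq1 /=.
rewrite (bigD1 i) //= eqxx expr1 mul1r big1 ?mulr1 // => j /negPf ->.
by rewrite expr0.
Qed.

Lemma lam_poly_onD f g h :
  lam_poly_on f g -> lam_poly_on f h -> lam_poly_on f (fun x => g x + h x).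
Proof.
move=> [L gL] [L' hL]; exists (L ++ L') => x fx.
by rewrite /lam_poly big_cat /= gL ?hL.
Qed.

Lemma lam_poly_onM f g h :
  lam_poly_on f g -> lam_poly_on f h -> lam_poly_on f (fun x => g x * h x).
Proof.
move=> [L gL] [L' hL].
exists [seq (a.1 * b.1, fun i => (a.2 i + b.2 i)%N) | a <- L, b <- L'] => x fx.
rewrite gL ?hL // /lam_poly big_allpairs_dep /= mulr_suml; apply: eq_bigr => a _.
rewrite mulr_sumr; apply: eq_bigr => b _.
under [in RHS]eq_bigr do rewrite exprD.
by rewrite big_split /=; ring.
Qed.

Lemma lam_poly_onZ f c h : lam_poly_on f h -> lam_poly_on f (fun x => c * h x).
Proof. by apply: lam_poly_onM; apply: lam_poly_on_cst. Qed.

Lemma lam_poly_on_sum f (K : Type) (r : seq K) (P : pred K) (h : K -> 'cV[R]_d -> R) :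
  (forall k, P k -> lam_poly_on f (h k)) ->
  lam_poly_on f (fun x => \sum_(k <- r | P k) h k x).
Proof.
move=> hP; elim: r => [|k r IH].
  by apply: lam_poly_on_ext (lam_poly_on_cst f 0) => x _; rewrite big_nil.
case Pk: (P k).
  by apply: lam_poly_on_ext (lam_poly_onD (hP k Pk) IH) => x _; rewrite big_cons Pk.
by apply: lam_poly_on_ext IH => x _; rewrite big_cons Pk.
Qed.

Section Nonempty.
Variables (f : {set I}) (i0 : I) (J : seq I).
Hypothesis fE : enum f = i0 :: J.

Lemma enum_cons_uniq : uniq (i0 :: J).
Proof. by rewrite -fE enum_uniq. Qed.

Lemma mem_enum_cons i : (i \in i0 :: J) = (i \in f).
Proof. by rewrite -fE mem_enum. Qed.

Lemma integral_onE h : integral_on v f h =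
  Num.sqrt (gram_det (edges i0 J)) * param_integral h (edges i0 J) 1 (v i0).
Proof. by rewrite /integral_on fE /= -map_comp. Qed.

Lemma base_vertex i : i \in J -> lam i (v i0) = 0.
Proof.
move=> iJ; rewrite lam_vertex //; case: eqVneq iJ => // ->.
by have := enum_cons_uniq => /= /andP[/negPf ->].
Qed.

Lemma region_points y : region v i0 J (v i0) y <-> points v f y.
Proof.
split=> [[yo yi y0]|/(pointsP hv)[y0 yf]]; last first.
  split=> // i iJ; rewrite yf -?mem_enum_cons //.
  by rewrite lam_vertex //; case: eqVneq iJ => // ->; rewrite mem_head.
have yf i : i \notin f -> lam i y = 0.
  rewrite -mem_enum_cons => iJ; rewrite yo // lam_vertex //.
  by case: eqVneq iJ => // ->; rewrite mem_head.
apply/(pointsP hv); split=> // i; have [|/yf -> //] := boolP (i \in f).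
by rewrite -mem_enum_cons inE => /predU1P[->|/yi].
Qed.

Lemma gram_det_edges_gt0 : 0 < gram_det (edges i0 J).
Proof.
apply: gram_det_gt0 => c c0 k.
have kJ : (k < size J)%N by case: k => k /=; rewrite size_map.
have := congr1 (fun y => dot (gl v (nth i0 J k)) y) c0; rewrite /= dot0r dot_sumr.
rewrite (bigD1 k) //= big1 ?addr0 => [|l lk].
  rewrite dotZr (nth_map i0) // gl_vertexB // eqxx.
  have -> : (nth i0 J k == i0) = false.
    apply/negbTE/negP => /eqP ki; have := enum_cons_uniq => /= /andP[/negP[]].
    by rewrite -{1}ki mem_nth.
  by rewrite subr0 mulr1.
have lJ : (l < size J)%N by case: l {lk} => l /=; rewrite size_map.
rewrite dotZr (nth_map i0) // gl_vertexB // nth_uniq //; last first.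
  by have := enum_cons_uniq => /= /andP[].
have -> : (k == l :> nat) = false by apply/negbTE; rewrite eq_sym.
have -> : (nth i0 J k == i0) = false.
  apply/negbTE/negP => /eqP ki; have := enum_cons_uniq => /= /andP[/negP[]].
  by rewrite -{1}ki mem_nth.
by rewrite subrr mulr0.
Qed.

Lemma integral_on_ext g h : (forall x, points v f x -> g x = h x) ->
  integral_on v f g = integral_on v f h.
Proof.
move=> gh; rewrite !integral_onE; congr (_ * _).
apply: (param_integral_ext hv) => //.
- exact: enum_cons_uniq.
- exact: base_vertex.
- by rewrite lam_vertex // eqxx.
- by move=> y /region_points; apply: gh.
Qed.

Lemma integral_on_lam_poly L : integral_on v f (lam_poly v L) =
  Num.sqrt (gram_det (edges i0 J)) * param_value v L i0 J 1 (v i0).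
Proof.
rewrite integral_onE param_integral_lam_poly //.
- exact: enum_cons_uniq.
- exact: base_vertex.
- by rewrite lam_vertex // eqxx.
Qed.

End Nonempty.

Lemma enum_cons f : f != finset.set0 -> exists i0 J, enum f = i0 :: J.
Proof.
move=> /set0Pn[i iF]; case: (enum f) (mem_enum f i); first by rewrite iF.
by move=> i0 J _; exists i0, J.
Qed.

Lemma integral_on_congr f g h : f != finset.set0 ->
  (forall x, points v f x -> g x = h x) -> integral_on v f g = integral_on v f h.
Proof. by move=> /enum_cons[i0 [J fE]]; apply: (integral_on_ext fE). Qed.

(** Linearity is read off from the closed form [param_value], not from the nested Lebesgue
    integrals. *)
Lemma integral_onD f a g h : f != finset.set0 -> lam_poly_on f g -> lam_poly_on f h ->
  integral_on v f (fun x => a * g x + h x) = a * integral_on v f g + integral_on v f h.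
Proof.
move=> f0 [L gL] [L' hL]; have [i0 [J fE]] := enum_cons f0.
pose aL := [seq (a * cm.1, cm.2) | cm <- L].
have aE x : points v f x -> a * g x + h x = lam_poly v (aL ++ L') x.
  move=> fx; rewrite /lam_poly big_cat big_map gL // hL // mulr_sumr.
  by congr (_ + _); apply: eq_bigr => cm _; rewrite mulrA.
rewrite (integral_on_congr f0 aE) (integral_on_congr f0 gL) (integral_on_congr f0 hL).
rewrite !(integral_on_lam_poly fE) /param_value big_cat big_map /= mulrDr.
congr (_ + _); rewrite mulrCA; congr (_ * _); rewrite mulr_sumr.
by apply: eq_bigr => cm _; rewrite !mulrA.
Qed.

Lemma integral_on0 f : f != finset.set0 -> integral_on v f (fun=> 0) = 0.
Proof.
move=> f0; have := integral_onD (-1) f0 (lam_poly_on_cst f 0) (lam_poly_on_cst f 0).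
rewrite (@integral_on_congr f _ (fun=> 0)) // => [->|x _]; last by rewrite mulr0 addr0.
by rewrite mulN1r addNr.
Qed.

Lemma integral_on_sum f (K : Type) (r : seq K) (c : K -> R) (h : K -> 'cV[R]_d -> R) :
  f != finset.set0 -> (forall k, lam_poly_on f (h k)) ->
  integral_on v f (fun x => \sum_(k <- r) c k * h k x) =
  \sum_(k <- r) c k * integral_on v f (h k).
Proof.
move=> f0 hP; elim: r => [|k r IH].
  rewrite big_nil -[RHS](integral_on0 f0); apply: integral_on_congr => // x _.
  by rewrite big_nil.
rewrite big_cons -IH -integral_onD //.
  by apply: integral_on_congr => // x _; rewrite big_cons.
by apply: lam_poly_on_sum => i _; apply: lam_poly_onZ.
Qed.

(** Here [i0] is the base vertex of the parametrization; the facet opposite to it is the exception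
    left by [param_integral_eq0]. *)
Lemma integral_on_eq0 f h : f != finset.set0 -> lam_poly_on f h ->
  (forall x, points v f x -> 0 <= h x) -> integral_on v f h = 0 ->
  exists2 i0, i0 \in f & forall x, points v f x -> 0 < lam i0 x -> h x = 0.
Proof.
move=> f0 [L hL] h0; have [i0 [J fE]] := enum_cons f0.
rewrite (integral_on_congr f0 hL) (integral_onE fE) => /eqP.
rewrite mulf_eq0 sqrtr_eq0 leNgt (gram_det_edges_gt0 fE) /= => /eqP int0.
exists i0 => [|x fx x0]; first by rewrite -(mem_enum_cons fE) mem_head.
rewrite hL //; move: x0; have /(region_points fE) := fx; move: x {fx}.
apply: (param_integral_eq0 hv _ _ _ _ _ int0) => //.
- exact: enum_cons_uniq fE.
- exact: base_vertex fE.
- by rewrite lam_vertex // eqxx.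
- by move=> y /(region_points fE) fy; rewrite -hL // h0.
Qed.

Definition quad (c : I -> I -> R) (w : I -> R) := \sum_a \sum_b c a b * w a * w b.

Definition quad_on f h := exists c, forall x, points v f x -> h x = quad c (lam ^~ x).

Lemma quad_comb c (w z : I -> R) (p q : R) :
  quad c (fun a => p * w a + q * z a) = p ^+ 2 * quad c w +
    p * q * (\sum_a \sum_b c a b * (w a * z b + z a * w b)) + q ^+ 2 * quad c z.
Proof.
rewrite /quad !mulr_sumr -!big_split /=; apply: eq_bigr => a _.
by rewrite !mulr_sumr -!big_split /=; apply: eq_bigr => b _; ring.
Qed.

Lemma quad_on_lam_poly f h : quad_on f h -> lam_poly_on f h.
Proof.
move=> [c hc]; apply: (@lam_poly_on_ext f (fun x => quad c (lam ^~ x))).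
  by move=> x /hc.
apply: lam_poly_on_sum => a _; apply: lam_poly_on_sum => b _.
by apply/lam_poly_onM/lam_poly_on_lam/lam_poly_onM/lam_poly_on_lam/lam_poly_on_cst.
Qed.

(* A quadratic polynomial vanishing off a facet vanishes everywhere: restrict it
   to the segment from a point of that facet to the opposite vertex. *)
Lemma quad_on_eq0 f h i0 : i0 \in f -> quad_on f h ->
  (forall x, points v f x -> 0 < lam i0 x -> h x = 0) ->
  forall x, points v f x -> h x = 0.
Proof.
move=> i0f [c hc] h0 x fx.
pose y t := (1 - t) *: x + t *: v i0.
have lamy t a : lam a (y t) = (1 - t) * lam a x + t * (a == i0)%:R.
  rewrite -(lam_vertex hv) /y lamE dotDr !dotZr !(lamE v a x, lamE v a (v i0)).
  by ring.
have fy t : 0 < t -> t <= 1 -> points v f (y t) /\ 0 < lam i0 (y t).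
  move=> t0 t1; have /(pointsP hv)[x0 xf] := fx; split; last first.
    by rewrite lamy eqxx mulr1 ltr_wpDl // mulr_ge0 // subr_ge0.
  apply/(pointsP hv); split=> a; rewrite lamy.
    by rewrite addr_ge0 // mulr_ge0 ?subr_ge0 ?ler0n // ltW.
  move=> af; rewrite xf // mulr0 add0r; case: eqVneq af => [->|_ _].
    by rewrite i0f.
  by rewrite mulr0.
have q0 t : 0 < t -> t <= 1 -> quad c (fun a => (1 - t) * lam a x + t * (a == i0)%:R) = 0.
  move=> t0 t1; have [fyt lt] := fy t t0 t1; rewrite -(h0 _ fyt lt) hc //.
  by congr quad; apply: funext => a; rewrite lamy.
(* On the segment [h] is a quadratic polynomial in [t]; its zeros at 1, 1/2 and 1/3 force its value
   at [t = 0], which is [h x]. *)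
have h1 := q0 1 ltr01 (lexx 1).
have h2 : _ := q0 (1 / 2) _ _; have h3 := q0 (1 / 3) _ _.
rewrite hc // -/(quad _ _); move: h1 h2 h3; rewrite !quad_comb.
set A := quad c _; set B := \sum_a _; set C := quad c _.
move=> h1 /(_ ltac:(lra) ltac:(lra)) h2 /(_ ltac:(lra) ltac:(lra)) h3.
by lra.
Qed.

(** The sum over [k] serves the components of a vector field; scalar functions are the case
    [n = 1]. *)
Lemma integral_sqr_eq0 (n : nat) f (h : 'I_n -> 'cV[R]_d -> R) : f != finset.set0 ->
  (forall k, quad_on f (h k)) ->
  integral_on v f (fun x => \sum_k h k x * h k x) = 0 ->
  forall k x, points v f x -> h k x = 0.
Proof.
move=> f0 hq int0 k.
have lp : lam_poly_on f (fun x => \sum_k h k x * h k x).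
  by apply: lam_poly_on_sum => i _; apply: lam_poly_onM; apply: quad_on_lam_poly.
have sq_ge0 x : points v f x -> 0 <= \sum_k h k x * h k x.
  by move=> _; apply: sumr_ge0 => i _; rewrite -expr2 sqr_ge0.
have [i0 i0f hz] := integral_on_eq0 f0 lp sq_ge0 int0.
apply: (quad_on_eq0 i0f) => // x fx x0; apply/eqP; rewrite -sqrf_eq0 expr2.
have /eqP := hz x fx x0; rewrite psumr_eq0 => [/allP/(_ k)|i _].
  by rewrite mem_index_enum => /(_ isT).
by rewrite -expr2 sqr_ge0.
Qed.

(** The product of the factorials of the multiplicities in the triple, that is 1, 2 or 6: the
    numerator in Dirichlet's formula. *)
Definition cubic_weight (a b c : I) : R := (1 + (a == b)%:R) * (1 + (a == c)%:R + (b == c)%:R).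

Lemma integral_cubic : exists2 K : R, K != 0 & forall a b c,
  integral_on v [set: I]%SET (fun x => lam a x * lam b x * lam c x) =
  K * cubic_weight a b c.
Proof.
have T0 : [set: I]%SET != finset.set0 by apply/set0Pn; exists ord0; rewrite inE.
have [i0 [J fE]] := enum_cons T0.
exists (Num.sqrt (gram_det (edges i0 J)) / (3 + d)`!%:R) => [|a b c].
  rewrite mulf_neq0 ?invr_neq0 ?pnatr_eq0 -?lt0n ?fact_gt0 //.
  by rewrite sqrtr_eq0 -ltNge (gram_det_edges_gt0 fE).
pose m i := ((i == a) + (i == b) + (i == c))%N.
have -> : (fun x => lam a x * lam b x * lam c x) = lam_poly v [:: (1, m)].
  apply: funext => x; rewrite /lam_poly big_seq1 mul1r.
  under eq_bigr do rewrite !exprD; rewrite !big_split /=.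
  have E i : \prod_j lam j x ^+ (j == i) = lam i x.
    rewrite (bigD1 i) //= eqxx expr1 big1 ?mulr1 // => j /negPf ->.
    by rewrite expr0.
  by rewrite !E.
rewrite (integral_on_lam_poly fE) /param_value big_seq1 /= expr1n mulr1 mul1r.
rewrite big1 ?mul1r; last by move=> i; rewrite (mem_enum_cons fE) inE.
rewrite -mulrA; congr (_ * _); rewrite mulrC /dirichlet /dirichlet_deg.
have u := enum_cons_uniq fE.
have sz : size (i0 :: J) = d.+1.
  by rewrite -fE -cardE cardsT card_ord.
have -> : (\sum_(i <- i0 :: J) m i)%N = 3.
  rewrite big_uniq //= (eq_bigl xpredT) => [|i]; last by rewrite (mem_enum_cons fE) inE.
  have E i : (\sum_j (j == i : nat))%N = 1.
    by rewrite (bigD1 i) //= eqxx big1 // => j /negPf ->.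
  by rewrite /m !big_split /= !E.
rewrite sz; congr (_ / _).
rewrite big_uniq //= (eq_bigl xpredT) => [|i]; last by rewrite (mem_enum_cons fE) inE.
rewrite /cubic_weight (bigD1 a) //= /m eqxx.
have [<-|ab] := eqVneq a b.
  have [<-|ac] := eqVneq a c.
    rewrite big1 => [|i /negPf ->] //; rewrite muln1 (_ : _`! = 6) //=; ring.
  have [ac' ca'] : (a == c) = false /\ (c == a) = false by rewrite [c == a]eq_sym (negPf ac).
  rewrite (bigD1 c) /= ?ca' // big1 => [|i /andP[/negPf -> /negPf ->]] //.
  by rewrite !(eqxx, ca', ac') (_ : muln _ _ = 2%N) //=; ring.
have [ab' ba'] : (a == b) = false /\ (b == a) = false by rewrite [b == a]eq_sym (negPf ab).
rewrite (bigD1 b) /= ?ba' //.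
have [<-|ac] := eqVneq a c.
  rewrite big1 => [|i /andP[/negPf -> /negPf ->]] //.
  by rewrite !(eqxx, ba', ab') (_ : muln _ _ = 2%N) //=; ring.
have [ac' ca'] : (a == c) = false /\ (c == a) = false by rewrite [c == a]eq_sym (negPf ac).
have [<-|bc] := eqVneq b c.
  rewrite big1 => [|i /andP[/negPf -> /negPf ->]] //.
  by rewrite !(eqxx, ba', ab') (_ : muln _ _ = 2%N) //=; ring.
have [bc' cb'] : (b == c) = false /\ (c == b) = false by rewrite [c == b]eq_sym (negPf bc).
rewrite (bigD1 c) /= ?ca' ?cb' //.
rewrite big1 => [|i /andP[/andP[/negPf -> /negPf ->] /negPf ->]] //.
by rewrite !(eqxx, ba', ab', ca', ac', bc', cb') (_ : muln _ _ = 1%N) //=; ring.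
Qed.

End IntegralOn.

(** * Tangential projections and normals *)

Section Normals.
Variables (R : realType) (d : nat) (v : 'I_d.+1 -> 'cV[R]_d).
Hypothesis hv : affinely_independent v.
Local Notation I := 'I_d.+1.
Local Notation lam := (lam v).
Local Notation gl := (gl v).
Implicit Types (f g : {set I}).

Lemma tangent_subspace f : linear_subspace (tangent v f).
Proof.
split=> [|a x y /(tangentP hv) xf /(tangentP hv) yf].
  by apply/(tangentP hv) => i _; rewrite dot0r.
by apply/(tangentP hv) => i iF; rewrite dotDr dotZr xf // yf // mulr0 addr0.
Qed.

(** [tangent_proj] is defined by choice, so existence must be supplied. This is Gram-Schmidt, one
    spanning vector at a time, with no independence assumed. *)
Lemma orthogonal_projection_exists (E : seq 'cV[R]_d) x :
  exists c : 'I_(size E) -> R, let y := \sum_i c i *: E`_i in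
    forall i : 'I_(size E), dot (x - y) E`_i = 0.
Proof.
elim: E x => [|e E IH] x; first by exists (fun=> 0) => y [].
have [c cP] := IH x; have [c' c'P] := IH e.
set y := \sum_i _ in cP; set w := \sum_i _ in c'P.
(* [u] is the part of [e] orthogonal to [E]. If [u = 0], the quotient [k] has denominator zero, but
   it then multiplies the zero vector. *)
pose u := e - w; pose k := dot (x - y) u / dot u u.
have wE z : (forall i : 'I_(size E), dot z E`_i = 0) -> dot z w = 0.
  by move=> zE; rewrite dot_sumr big1 // => i _; rewrite dotZr zE mulr0.
exists (fun i => if unlift ord0 i is Some j then c j - k * c' j else k) => z.
have {z}-> : z = y + k *: u.
  rewrite /z big_ord_recl unlift_none /= addrC.
  under eq_bigr do rewrite liftK scalerBl -scalerA; rewrite sumrB -scaler_sumr.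
  by rewrite -/y -/w /u scalerBr addrA addrAC.
have zE (i : 'I_(size E)) : dot (x - (y + k *: u)) E`_i = 0.
  by rewrite opprD addrA dotBl cP dotZl c'P mulr0 subr0.
case=> -[|i] /= iE; last by have := zE (Ordinal (iE : (i < size E)%N)).
rewrite -[e](subrK w) dotDr (wE _ zE) addr0 -/u opprD addrA dotBl dotZl /k.
have [->|u0] := eqVneq u 0; first by rewrite !dot0r mulr0 subr0.
by rewrite divfK ?subrr // dot_eq0.
Qed.

Lemma tangent_projP f x : tangent v f (tangent_proj v f x) /\
  forall t, tangent v f t -> dot (x - tangent_proj v f x) t = 0.
Proof.
rewrite /tangent_proj; set P := [set y | _].
suff : exists y, P y by move=> [y Py]; exact: (xgetI 0 Py).
have [f0|[i0 i0f]] := set_0Vmem f.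
  exists 0; split=> [|t /(tangentP hv) tf]; first by case: (tangent_subspace f).
  rewrite (_ : t = 0) ?dot0r //; apply: (gl_vec_eq0 hv) => j.
  by rewrite tf // f0 inE.
pose E := [seq v i - v i0 | i <- enum f].
have [c cP] := orthogonal_projection_exists E x.
exists (\sum_i c i *: E`_i); split=> [|t /(tangentP hv) tf].
  apply: subspace_sum => [|i _]; first exact: tangent_subspace.
  apply: subspaceZ; first exact: tangent_subspace.
  have : E`_i \in E by rewrite mem_nth.
  move=> /mapP[j]; rewrite mem_enum => jf ->; apply/(tangentP hv) => k kf.
  rewrite gl_vertexB //; case: eqVneq kf => [->|_]; first by rewrite jf.
  by case: eqVneq => [->|_]; rewrite ?i0f // subrr.
have -> : t = \sum_(i in f) dot (gl i) t *: (v i - v i0).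
  under eq_bigr do rewrite scalerBr; rewrite sumrB -scaler_suml.
  have -> : \sum_(i in f) dot (gl i) t = 0.
    transitivity (\sum_i dot (gl i) t); last exact: (sum_gl_dot hv).
    by rewrite [RHS](bigID [in f]) /= [X in _ + X]big1 ?addr0.
  rewrite scale0r subr0 -[LHS](gl_expand hv t).
  rewrite [LHS](bigID [in f]) /= [X in _ + X]big1 ?addr0 // => i iF.
  by rewrite tf // scale0r.
rewrite dot_sumr big1 // => i iF; rewrite dotZr.
have iE : (index i (enum f) < size E)%N by rewrite size_map index_mem mem_enum.
have := cP (Ordinal iE); rewrite /= (nth_map i0) ?index_mem ?mem_enum //.
by rewrite nth_index ?mem_enum // => ->; rewrite mulr0.
Qed.

Lemma dot_tangent_proj f x t : tangent v f t -> dot (tangent_proj v f x) t = dot x t.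
Proof.
move=> tf; have [_ /(_ t tf)] := tangent_projP f x.
by rewrite dotBl => /eqP; rewrite subr_eq0 => /eqP.
Qed.

(** The normalised projection of [- gl i] shows that the chosen normal exists. Whatever was chosen,
    on the tangent space of [f] it acts as a negative multiple of [gl i], whose factor is left
    implicit. *)
Lemma outward_normalP f i j : i \in f -> j \in f -> i != j ->
  let n := outward_normal v f (f :\ i)%SET in
  [/\ tangent v f n, dot n n = 1 &
    exists2 k, 0 < k & forall t, tangent v f t -> dot n t = - k * dot (gl i) t].
Proof.
move=> iF jF ij; rewrite /outward_normal; set P := [set n | _].
have sub t : tangent v (f :\ i)%SET t -> tangent v f t /\ dot (gl i) t = 0.
  move=> /(tangentP hv) tf; split; last by rewrite tf // !inE eqxx.
  by apply/(tangentP hv) => k kf; rewrite tf // inE negb_and kf orbT.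
have edge a b : a \in f -> b \in f -> tangent v f (v a - v b).
  move=> aF bF; apply/(tangentP hv) => k kf; rewrite gl_vertexB //.
  case: eqVneq kf => [->|_]; first by rewrite aF.
  by case: eqVneq => [->|_]; rewrite ?bF // subrr.
pose w := tangent_proj v f (- gl i).
have [wf _] := tangent_projP f (- gl i).
have wt t : tangent v f t -> dot w t = - dot (gl i) t.
  by move=> tf; rewrite dot_tangent_proj // dotNl.
have w0 : 0 < dot w w.
  rewrite dot_gt0; apply/eqP => w0; have := wt _ (edge i j iF jF).
  rewrite w0 dot0l gl_vertexB // eqxx (negPf ij) => /eqP.
  by rewrite subr0 eq_sym oppr_eq0 oner_eq0.
have s0 : 0 < Num.sqrt (dot w w) by rewrite sqrtr_gt0.
have : exists n, P n.
  exists ((Num.sqrt (dot w w))^-1 *: w); split.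
  - by apply: subspaceZ => //; apply: tangent_subspace.
  - rewrite dotZl dotZr mulrA -invfM -expr2 sqr_sqrtr ?mulVf ?gt_eqF //.
    exact: ltW.
  - by move=> t /sub[tf ti]; rewrite dotZl (wt _ tf) ti oppr0 mulr0.
  - move=> a b; rewrite !inE => /andP[]; rewrite negb_and negbK => /orP[/eqP ->|/negPf ->//].
    move=> _ /andP[bi bF]; rewrite dotZl (wt _ (edge _ _ iF bF)).
    rewrite gl_vertexB // eqxx eq_sym (negPf bi) subr0 mulrN1 oppr_lt0 invr_gt0.
    exact: s0.
move=> [n0 Pn0]; have [nf n1 ng nl] := xgetI 0 Pn0.
move: (xget 0 P) nf n1 ng nl => n nf n1 ng nl; split=> //.
have nij : dot n (v i - v j) < 0.
  by apply: nl; rewrite !inE ?eqxx ?iF // eq_sym ij.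
exists (- dot n (v i - v j)); first by rewrite oppr_gt0.
move=> t tf; rewrite opprK.
(* Subtracting a multiple of [v i - v j] makes [t] tangent to the facet, so [n] is determined by its
   value on this one edge. *)
have : tangent v (f :\ i)%SET (t - dot (gl i) t *: (v i - v j)).
  apply/(tangentP hv) => k; rewrite !inE negb_and negbK dotBr dotZr gl_vertexB //.
  move=> /orP[/eqP ->|kf]; first by rewrite eqxx (negPf ij) /=; ring.
  have /(tangentP hv)/(_ _ kf) -> := tf; case: eqVneq kf => [->|_]; first by rewrite iF.
  by case: eqVneq => [->|_]; rewrite ?jF // subrr mulr0 subr0.
by move=> /ng; rewrite (dotBr t) dotZr => /eqP; rewrite subr_eq0 => /eqP ->; rewrite mulrC.
Qed.

Lemma facetP g f : facet g f -> exists2 i, i \in f & g = (f :\ i)%SET.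
Proof.
move=> /andP[gf /eqP cf].
have /card_gt0P[i] : (0 < #|f :\: g|)%N.
  by rewrite cardsD (finset.setIidPr gf) -cf subSnn.
rewrite !inE => /andP[ig iF]; exists i => //.
apply/eqP; rewrite eqEcard; apply/andP; split.
  apply/fintype.subsetP => j jg; rewrite !inE (fintype.subsetP gf) // andbT.
  by apply: contraNneq ig => <-.
by have := cardsD1 i f; rewrite iF -cf add1n => -[->].
Qed.

Lemma face_normalP i : (0 < d)%N -> exists2 k, 0 < k &
  normal v (opp_face i) = - k *: gl i /\ k ^+ 2 * dot (gl i) (gl i) = 1.
Proof.
move=> d0.
have [j ij] : exists j, i != j.
  have [->|i0] := eqVneq i ord0; last by exists ord0.
  by exists ord_max; rewrite -val_eqE /= eq_sym -lt0n.
have := @outward_normalP [set: I]%SET i j; rewrite !inE => /(_ isT isT ij).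
have -> : ([set: I] :\ i)%SET = opp_face i.
  by apply/setP => k; rewrite !inE andbT.
rewrite -/(normal v (opp_face i)) /= => -[_ n1 [k k0 nt]]; exists k => //.
have nE : normal v (opp_face i) = - k *: gl i.
  apply: dot_ext => z; rewrite dotZl nt //.
  by apply/(tangentP hv) => l; rewrite inE.
split=> //; rewrite -n1 nE dotZl dotZr; ring.
Qed.

End Normals.

(** * Polynomials in barycentric coordinates *)

Section Forms.
Variables (R : realType) (d : nat) (v : 'I_d.+1 -> 'cV[R]_d).
Hypothesis hv : affinely_independent v.
Local Notation I := 'I_d.+1.
Local Notation lam := (lam v).
Local Notation gl := (gl v).
Implicit Types (f g : {set I}) (h p : 'cV[R]_d -> R).

(** Forms of degree exactly [k] in the barycentric coordinates. Since these sum to one, such forms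
    include all polynomials of lower degree. *)
Fixpoint lam_form k h : Prop :=
  if k is k'.+1 then exists g : I -> 'cV[R]_d -> R,
    (forall a, lam_form k' (g a)) /\ forall x, h x = \sum_a lam a x * g a x
  else exists c, forall x, h x = c.

Lemma poly_fun_lam_form k h : poly_fun k h -> lam_form k h.
Proof.
have widen k' p : lam_form k' p -> lam_form k'.+1 p.
  move=> pk; exists (fun=> p); split=> // x.
  by rewrite -mulr_suml (sum_lam hv) mul1r.
move: k h; apply: poly_fun_ind => //.
- by case=> [|k] p q pq /= [g gP]; exists g; [|case: gP => ? gE; split=> //] => x; rewrite -pq.
- elim=> [|k IH] p q /= [g gP] [g' g'P].
    by exists (g + g') => x; rewrite gP g'P.
  case: gP => gk pE; case: g'P => g'k qE.
  exists (fun a x => g a x + g' a x); split=> [a|x]; first exact: IH.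
  by rewrite pE qE -big_split; apply: eq_bigr => a _; rewrite mulrDr.
- elim=> [|k IH] c p /= [g gP]; first by exists (c * g) => x; rewrite gP.
  case: gP => gk pE; exists (fun a x => c * g a x); split=> [a|x]; first exact: IH.
  by rewrite pE mulr_sumr; apply: eq_bigr => a _; rewrite mulrCA.
- by exists 1.
have scale k c p : lam_form k p -> lam_form k (fun x => c * p x).
  elim: k p => [|k IH] p /= [g gP]; first by exists (c * g) => x; rewrite gP.
  case: gP => gk pE; exists (fun a x => c * g a x); split=> [a|x]; first exact: IH.
  by rewrite pE mulr_sumr; apply: eq_bigr => a _; rewrite mulrCA.
move=> k i p pk; exists (fun a x => v a i 0 * p x); split=> [a|x]; first exact: scale.
have -> : x i 0 = \sum_a lam a x * v a i 0.
  rewrite -[in LHS](sum_lam_vertex hv x) summxE.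
  by apply: eq_bigr => a _; rewrite mxE.
by rewrite mulr_suml; apply: eq_bigr => a _; rewrite mulrA.
Qed.

Lemma poly_fun1_lam h : poly_fun 1 h -> exists c, forall x, h x = \sum_a c a * lam a x.
Proof.
move=> /poly_fun_lam_form[g [/choice[c cE] hE]]; exists c => x.
by rewrite hE; apply: eq_bigr => a _; rewrite cE mulrC.
Qed.

Lemma poly_fun2_quad h : poly_fun 2 h -> exists c, forall x, h x = quad c (lam ^~ x).
Proof.
move=> /poly_fun_lam_form[g [gP hE]].
have /choice[c cE] a : exists c, forall x, g a x = \sum_b c b * lam b x.
  have [g' [/choice[c cE] gE]] := gP a; exists c => x.
  by rewrite gE; apply: eq_bigr => b _; rewrite cE mulrC.
exists c => x; rewrite hE; apply: eq_bigr => a _.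
by rewrite cE mulr_sumr; apply: eq_bigr => b _; ring.
Qed.

Lemma poly_fun_lam a : poly_fun 1 (lam a).
Proof.
apply: (poly_fun_ext (p := fun x => lam a 0 + \sum_i gl a i 0 * x i 0)) => [x|].
  by rewrite [RHS]lamE dotE.
apply: poly_funD; first exact: poly_fun_cst.
by apply: poly_fun_sum => i _; apply: poly_funZ; apply: poly_fun_coord.
Qed.

Lemma poly_fun_lam2 a b : poly_fun 2 (fun x => lam a x * lam b x).
Proof. by apply: (@poly_funM _ _ 1 1); apply: poly_fun_lam. Qed.

Lemma poly_fun_quad (c : I -> I -> R) : poly_fun 2 (fun x => quad c (lam ^~ x)).
Proof.
apply: poly_fun_sum => a _; apply: poly_fun_sum => b _.
apply: (poly_fun_ext (p := fun x => c a b * (lam a x * lam b x))) => [x|].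
  by rewrite mulrA.
by apply: poly_funZ; apply: poly_fun_lam2.
Qed.

Lemma poly_fun_linear (c : I -> R) : poly_fun 1 (fun x => \sum_a c a * lam a x).
Proof. by apply: poly_fun_sum => a _; apply: poly_funZ; apply: poly_fun_lam. Qed.

Lemma quad_sym (c : I -> I -> R) w : quad c w = \sum_a \sum_b (c a b + c b a) / 2 * w a * w b.
Proof.
have e : quad c w = \sum_a \sum_b c b a * w a * w b.
  rewrite /quad exchange_big; apply: eq_bigr => a _; apply: eq_bigr => b _; ring.
have -> : quad c w = (quad c w + quad c w) / 2 by field.
rewrite [X in (X + _) / 2]e /quad -big_split mulr_suml /=; apply: eq_bigr => a _.
by rewrite -big_split mulr_suml /=; apply: eq_bigr => b _; field.
Qed.

Lemma quad_vertex (c : I -> I -> R) a : quad c (fun b => lam b (v a)) = c a a.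
Proof.
rewrite /quad (bigD1 a) //= (bigD1 a) //= !lam_vertex // eqxx !mulr1.
rewrite big1 ?addr0 => [|b /negPf ba]; last by rewrite lam_vertex // ba mulr0.
rewrite big1 ?addr0 // => b /negPf ba; rewrite big1 // => e _.
by rewrite (lam_vertex hv b) ba mulr0 mul0r.
Qed.

Lemma quad_midpoint (c : I -> I -> R) a b :
  quad c (fun k => lam k (midpoint v a b)) = (c a a + c a b + c b a + c b b) / 4.
Proof.
pose w (i j : I) : R := (j == i)%:R.
have -> : (fun k => lam k (midpoint v a b)) = (fun k => 2^-1 * w a k + 2^-1 * w b k).
  by apply: funext => k; rewrite lam_midpoint // /w; field.
rewrite quad_comb.
have dd (F : I -> I -> R) i j : \sum_k \sum_l F k l * (w i k * w j l) = F i j.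
  rewrite (bigD1 i) //= (bigD1 j) //= /w !eqxx !mulr1 big1 ?addr0 => [|l /negPf ->]; last by rewrite !mulr0.
  rewrite big1 ?addr0 // => k /negPf ->; rewrite big1 // => l _.
  by rewrite mul0r mulr0.
have dq i : quad c (w i) = c i i.
  by rewrite -[RHS]dd; apply: eq_bigr => k _; apply: eq_bigr => l _; rewrite mulrA.
rewrite !dq; set X := \sum_a0 _.
have -> : X = c a b + c b a.
  rewrite -(dd c a b) -(dd c b a) -big_split; apply: eq_bigr => k _.
  by rewrite -big_split; apply: eq_bigr => l _ /=; ring.
by field.
Qed.

Lemma quad_eq0 (c : I -> I -> R) f (w : I -> R) :
  (forall a, a \in f -> c a a = 0) ->
  (forall a b, a \in f -> b \in f -> (a < b)%N -> c a b + c b a = 0) ->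
  (forall a, a \notin f -> w a = 0) -> quad c w = 0.
Proof.
move=> c1 c2 wf; rewrite quad_sym big1 // => a _; rewrite big1 // => b _.
have [af|/wf ->] := boolP (a \in f); last by rewrite mulr0 mul0r.
have [bf|/wf ->] := boolP (b \in f); last by rewrite mulr0.
suff -> : c a b + c b a = 0 by rewrite !mul0r.
have [ab|ba|/val_inj ab] := ltngtP a b; first exact: c2.
  by rewrite addrC c2.
by rewrite ab c1 // addr0.
Qed.

(* On quadratic forms this is the coefficient of the monomial [lam a * lam b]. *)
Definition nodal a b p : R :=
  if a == b then p (v a) else 4 * p (midpoint v a b) - p (v a) - p (v b).

Lemma nodal_quad c a b : nodal a b (fun x => quad c (lam ^~ x)) =
  if a == b then c a a else c a b + c b a.
Proof.
rewrite /nodal; case: eqVneq => _; first exact: quad_vertex.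
by rewrite !quad_vertex quad_midpoint; field.
Qed.

Lemma nodal_lam2 (i j k l : I) : (i <= j)%N -> (k <= l)%N ->
  nodal i j (fun x => lam k x * lam l x) = ((i == k) && (j == l))%:R.
Proof.
move=> ij kl; have -> : (fun x => lam k x * lam l x) =
    (fun x => quad (fun a b => ((a == k) && (b == l))%:R) (lam ^~ x)).
  apply: funext => x; rewrite /quad (bigD1 k) //= (bigD1 l) //= !eqxx mul1r.
  rewrite big1 ?addr0 => [|b /negPf ->]; last by rewrite andbF !mul0r.
  rewrite big1 ?addr0 // => a /negPf ->; rewrite big1 // => b _.
  by rewrite !mul0r.
rewrite nodal_quad; have [<-|ne] := eqVneq i j => //.
case: (eqVneq j k) => [jk|_]; last by rewrite addr0.
case: (eqVneq i l) => [il|_]; last by rewrite addr0.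
by exfalso; move: ne; rewrite -val_eqE /= jk il in ij kl *; lia.
Qed.

Lemma nodal_ext f a b p q : a \in f -> b \in f ->
  (forall x, points v f x -> p x = q x) -> nodal a b p = nodal a b q.
Proof.
move=> af bf pq; by rewrite /nodal !pq //; do ?[exact: points_vertex | exact: points_midpoint].
Qed.

Lemma nodal_linear a b c p q :
  nodal a b (fun x => c * p x + q x) = c * nodal a b p + nodal a b q.
Proof. by rewrite /nodal; case: ifP => _; ring. Qed.

Lemma quad_on_nodalP f h : quad_on v f h ->
  (forall a b, a \in f -> b \in f -> (a <= b)%N -> nodal a b h = 0) ->
  forall x, points v f x -> h x = 0.
Proof.
move=> [c hc] h0 x fx; rewrite hc //; have /(pointsP hv)[_ xf] := fx.
have c0 a b : a \in f -> b \in f -> (a <= b)%N ->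
    (if a == b then c a a else c a b + c b a) = 0.
  by move=> af bf ab; rewrite -nodal_quad -(h0 _ _ af bf ab); apply/esym/(nodal_ext af bf).
apply: (quad_eq0 _ _ xf) => [a af|a b af bf ab].
  by have := c0 a a af af (leqnn a); rewrite eqxx.
by have := c0 a b af bf (ltnW ab); rewrite -val_eqE /= ltn_eqF.
Qed.

Lemma quad_on_zeroP f h : quad_on v f h ->
  (forall a, a \in f -> h (v a) = 0) ->
  (forall a b, a \in f -> b \in f -> (a < b)%N -> h (midpoint v a b) = 0) ->
  forall x, points v f x -> h x = 0.
Proof.
move=> hq h1 h2; apply: (quad_on_nodalP hq) => a b af bf ab; rewrite /nodal.
case: eqVneq => [_|ne]; first exact: h1.
rewrite h1 // (h1 b) // h2 //; first by rewrite mulr0 !subr0.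
by rewrite ltn_neqAle ab andbT val_eqE.
Qed.

Lemma poly_fun1_affine p : poly_fun 1 p -> exists w, forall x, p x = p 0 + dot w x.
Proof.
move=> /poly_fun1_lam[c cE]; exists (\sum_a c a *: gl a) => x.
rewrite !cE dot_suml -big_split; apply: eq_bigr => a _.
by rewrite dotZl lamE mulrDr.
Qed.

Lemma poly_on_subspace k (D : set 'cV[R]_d) : linear_subspace (poly_on k D).
Proof.
split=> [|a x y [p pk <-] [q qk <-]].
  exists (fun=> 0); first exact: poly_fun_cst.
  by apply: funext => x; rewrite /patch; case: ifP.
exists (fun x => a * p x + q x); first by apply: poly_funD => //; apply: poly_funZ.
apply: funext => z; rewrite /patch.
transitivity (a * (if z \in D then p z else 0) + (if z \in D then q z else 0)) => //.
by case: ifP => _; rewrite ?mulr0 ?addr0.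
Qed.

Lemma poly_on_in (D : set 'cV[R]_d) k h p : (forall x, D x -> h x = p x) ->
  (forall x, ~ D x -> h x = 0) -> poly_fun k p -> poly_on k D h.
Proof.
move=> h1 h2 pk; exists p => //; apply: funext => x; rewrite /patch.
by case: ifPn => [|/negP]; rewrite inE => Dx; [rewrite h1 | rewrite h2].
Qed.

Lemma poly_onP (D : set 'cV[R]_d) k h : poly_on k D h <->
  (forall x, ~ D x -> h x = 0) /\ exists2 p, poly_fun k p & forall x, D x -> h x = p x.
Proof.
split=> [[p pk <-]|[h0 [p pk hp]]]; last exact: poly_on_in pk.
split=> [x Dx|]; first by rewrite patchN // notin_setE.
by exists p => // x Dx; rewrite patchT // inE.
Qed.

Lemma poly_on2_quad_on f h : poly_on 2 (points v f) h -> quad_on v f h.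
Proof.
move=> /poly_onP[_ [p /poly_fun2_quad[c pc] hp]]; exists c => x fx.
by rewrite hp.
Qed.

Lemma poly_on1_quad_on f h : poly_on 1 (points v f) h -> quad_on v f h.
Proof.
move=> /poly_onP[_ [p /poly_fun1_lam[c pc] hp]].
exists (fun a b => c a) => x fx; rewrite hp // pc; apply: eq_bigr => a _.
by rewrite -mulr_sumr (sum_lam hv) mulr1.
Qed.

End Forms.

(** * Bases of the test spaces *)

Section Pairs.
Variables (n : nat) (f : {set 'I_n}).

(** The edges of [f], which index a basis of [B2div]; [le_pairs] indexes the quadratic monomials
    instead. *)
Definition lt_pairs : finType :=
  {ab : 'I_n * 'I_n | [&& (ab.1 < ab.2)%N, ab.1 \in f & ab.2 \in f]}.

Definition le_pairs : finType :=
  {ab : 'I_n * 'I_n | [&& (ab.1 <= ab.2)%N, ab.1 \in f & ab.2 \in f]}.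

Let card_rel (r : rel 'I_n) :
  #|[pred ab : 'I_n * 'I_n | [&& r ab.1 ab.2, ab.1 \in f & ab.2 \in f]]| =
  (\sum_(a in f) \sum_(b in f) r a b)%N.
Proof.
rewrite -sum1_card pair_big /= big_mkcond [RHS]big_mkcond /=.
by apply: eq_bigr => -[a b] _ /=; rewrite inE /=; case: (r a b); case: ifP.
Qed.

Lemma card_lt_pairs : (#|lt_pairs| * 2 + #|f| = #|f| * #|f|)%N.
Proof.
rewrite card_sig (card_rel (fun a b => a < b)%N) muln2 -addnn.
rewrite {2}exchange_big /= -[X in (_ + X)%N]sum1_card -!big_split /=.
rewrite -[X in _ = (X * _)%N]sum1_card big_distrl /=; apply: eq_bigr => a af.
rewrite mul1n -sum1_card (bigD1 a af) [in RHS](bigD1 a af) /=.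
rewrite [X in (_ + X + _)%N](bigD1 a af) /= !ltnn !add0n addnC; congr (_ + _)%N.
rewrite -big_split /=; apply: eq_bigr => b /andP[_ ba].
by rewrite -val_eqE /= in ba; case: ltngtP ba.
Qed.

Lemma card_le_pairs : #|le_pairs| = (#|lt_pairs| + #|f|)%N.
Proof.
rewrite !card_sig (card_rel (fun a b => a < b)%N) (card_rel (fun a b => a <= b)%N).
rewrite -[X in (_ + X)%N]sum1_card -big_split /=; apply: eq_bigr => a af.
rewrite (bigD1 a af) [in RHS](bigD1 a af) /= leqnn ltnn add0n addnC; congr (_ + _)%N.
by apply: eq_bigr => b /andP[_ ba]; rewrite leq_eqVlt val_eqE eq_sym (negPf ba).
Qed.

End Pairs.

Section TestSpaces.
Variables (R : realType) (d : nat) (v : 'I_d.+1 -> 'cV[R]_d).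
Hypothesis hv : affinely_independent v.
Local Notation I := 'I_d.+1.
Local Notation lam := (lam v).
Local Notation gl := (gl v).
Local Notation mid := (midpoint v).
Variable f : {set I}.

Let on_f (T : lmodType R) (p : 'cV[R]_d -> T) : 'cV[R]_d -> T :=
  fun x => if x \in points v f then p x else 0.

Let on_fE (T : lmodType R) (p : 'cV[R]_d -> T) x : points v f x -> on_f p x = p x.
Proof. by move=> fx; rewrite /on_f ifT // inE. Qed.

Let on_f_poly k p : poly_fun k p -> poly_on k (points v f) (on_f p).
Proof.
move=> pk; apply: poly_on_in pk => x fx; first exact: on_fE.
by rewrite /on_f ifN // notin_setE.
Qed.

Lemma poly_on1_basis : exists b : 'I_#|f| -> 'cV[R]_d -> R,
  is_basis (poly_on 1 (points v f)) b.
Proof.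
suff : exists b : 'I_#|{: {a : I | a \in f}}| -> 'cV[R]_d -> R,
    is_basis (poly_on 1 (points v f)) b by rewrite card_sig.
apply: (dual_basis (b := fun a : {a : I | a \in f} => on_f (lam (val a)))
                   (phi := fun a p => p (v (val a)))).
- exact: poly_on_subspace.
- by move=> a; apply: on_f_poly; apply: poly_fun_lam.
- by [].
- move=> a b ab; rewrite on_fE ?lam_vertex //; last exact: points_vertex (valP a).
  by rewrite eq_sym val_eqE (negPf ab).
- move=> a; rewrite on_fE ?lam_vertex ?eqxx ?oner_eq0 //.
  exact: points_vertex (valP a).
move=> p /poly_onP[p0 [q /(poly_fun1_lam hv)[c qc] pq]] pv; apply: funext => x.
have [fx|/p0 //] := pselect (points v f x).
rewrite pq // qc big1 // => a _; have /(pointsP hv)[_ xf] := fx.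
have [af|/xf ->] := boolP (a \in f); last by rewrite mulr0.
have := pv (exist _ a af); rewrite /= pq ?qc; last exact: points_vertex.
rewrite (bigD1 a) //= lam_vertex // eqxx mulr1 big1 ?addr0 => [->|b ba].
  by rewrite mul0r.
by rewrite lam_vertex // (negPf ba) mulr0.
Qed.

Lemma poly_on2_basis : exists b : 'I_#|le_pairs f| -> 'cV[R]_d -> R,
  is_basis (poly_on 2 (points v f)) b.
Proof.
pose b (ab : le_pairs f) : 'cV[R]_d -> R :=
  on_f (fun x => lam (val ab).1 x * lam (val ab).2 x).
pose phi (ab : le_pairs f) (p : 'cV[R]_d -> R) := nodal v (val ab).1 (val ab).2 p.
have phib i j : phi i (b j) = (i == j)%:R.
  case: i j => [[i j] ij] [[k l] kl]; rewrite /phi /b -val_eqE /= xpair_eqE.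
  have /and3P[/= lij iF jF] := ij; have /and3P[/= lkl kF lF] := kl.
  rewrite -(nodal_lam2 hv) //; apply: (nodal_ext hv iF jF) => x fx.
  by rewrite on_fE.
apply: (dual_basis (b := b) (phi := phi)).
- exact: poly_on_subspace.
- by move=> a; apply: on_f_poly; apply: poly_fun_lam2.
- by move=> ab c x y _ _; rewrite -nodal_linear.
- by move=> i j ij; rewrite phib (negPf ij).
- by move=> i; rewrite phib eqxx oner_eq0.
move=> p pS pv; apply: funext => x.
have [fx|] := pselect (points v f x); last by case/poly_onP: pS => p0 _ /p0.
apply: (quad_on_nodalP hv (poly_on2_quad_on hv pS)) fx => a a' af a'f aa'.
have aaP : [&& (a <= a')%N, a \in f & a' \in f] by rewrite aa' af.
exact: pv (exist _ (a, a') aaP).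
Qed.

Lemma B2div_subspace : linear_subspace (B2div v f).
Proof.
split=> [|a x y [x1 x2 x3] [y1 y2 y3]].
  split=> [i|x|g _ x _].
  - have [h _] := poly_on_subspace 2 (points v f); move: h; congr poly_on.
    by apply: funext => x; rewrite mxE.
  - by have [h _] := tangent_subspace hv f; exact: h.
  - exact: dot0r.
split=> [i|z|g gf z gz].
- have [_ h] := poly_on_subspace 2 (points v f); have := h a _ _ (x1 i) (y1 i).
  by congr poly_on; apply: funext => z; rewrite !mxE.
- by have [_ h] := tangent_subspace hv f; apply: h.
- have -> : (a *: x + y) z = a *: x z + y z by [].
  by rewrite dotDr dotZr x3 ?y3 // mulr0 addr0.
Qed.

Hypothesis f2 : (2 <= #|f|)%N.

Let other i : exists2 j, j \in f & i != j.
Proof.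
have : (0 < #|(f :\ i)%SET|)%N by have := cardsD1 i f; lia.
by move=> /card_gt0P[j]; rewrite !inE => /andP[ji jf]; exists j; rewrite // eq_sym.
Qed.

(** For vanishing the implicit positive factor does not matter, so the chosen unit normal may be
    replaced by a gradient. *)
Lemma normal_component g i q : g = (f :\ i)%SET -> i \in f -> tangent v f q ->
  dot (outward_normal v f g) q = 0 <-> dot (gl i) q = 0.
Proof.
move=> -> iF qf; have [j jf ij] := other i.
have [_ _ [k k0 ->]] := outward_normalP hv iF jf ij => //.
split=> [/eqP|->]; last by rewrite mulr0.
by rewrite mulf_eq0 oppr_eq0 gt_eqF //= => /eqP.
Qed.

Lemma facet_points i x : points v (f :\ i)%SET x -> points v f x /\ lam i x = 0.
Proof.
move=> /(pointsP hv)[x0 xf]; split; last by rewrite xf // !inE eqxx.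
by apply/(pointsP hv); split=> // k kf; rewrite xf // !inE negb_and kf orbT.
Qed.

Lemma B2divP q : B2div v f q -> forall i x, points v f x -> lam i x = 0 ->
  dot (gl i) (q x) = 0.
Proof.
move=> [_ q2 q3] i x fx xi; have [iF|iF] := boolP (i \in f); last first.
  by have /(tangentP hv) := q2 x; apply.
apply/(normal_component (erefl _) iF (q2 x)); apply: q3.
  by rewrite /facet subD1set [X in _ == X](cardsD1 i f) iF add1n eqxx.
have /(pointsP hv)[x0 xf] := fx; apply/(pointsP hv); split=> // k.
by rewrite !inE negb_and negbK => /orP[/eqP -> //|/xf].
Qed.

Lemma B2div_intro (p : 'cV[R]_d -> 'cV[R]_d) : (forall i, poly_fun 2 (fun x => p x i 0)) ->
  (forall x, points v f x -> tangent v f (p x)) ->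
  (forall i x, points v f x -> lam i x = 0 -> dot (gl i) (p x) = 0) ->
  B2div v f (on_f p).
Proof.
move=> p2 pt pn; split=> [i|x|g /facetP[i iF ->] x /facet_points[fx xi]].
- have := on_f_poly (p2 i); congr poly_on; apply: funext => x.
  by rewrite /on_f; case: ifP; rewrite ?mxE.
- rewrite /on_f; case: ifP => [|_]; first by rewrite inE => /pt.
  by case: (tangent_subspace hv f).
by rewrite on_fE // (normal_component (i := i)) //; [exact: pn | exact: pt].
Qed.

(** The basis consists of edge bubbles: [v a - v b] has a component along [gl i] only for [i = a] or
    [i = b], and there the factor [lam i] vanishes on the facet opposite to [v i]. The dual
    functional reads one component at the midpoint of the edge. *)
Lemma B2div_basis : exists b : 'I_#|lt_pairs f| -> 'cV[R]_d -> 'cV[R]_d,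
  is_basis (B2div v f) b.
Proof.
pose phi (ab : lt_pairs f) (p : 'cV[R]_d -> 'cV[R]_d) :=
  dot (gl (val ab).1) (p (mid (val ab).1 (val ab).2)).
pose b (ab : lt_pairs f) : 'cV[R]_d -> 'cV[R]_d :=
  on_f (fun x => (lam (val ab).1 x * lam (val ab).2 x) *: (v (val ab).1 - v (val ab).2)).
apply: (dual_basis (b := b) (phi := phi)).
- exact: B2div_subspace.
- move=> [[i j] ij]; rewrite /b /=; have /and3P[/= lij iF jF] := ij.
  have ne : i != j by rewrite -val_eqE /= ltn_eqF.
  apply: B2div_intro => [k|x _|k x fx xk].
  + apply: (poly_fun_ext (p := fun x => (v i - v j) k 0 * (lam i x * lam j x))) => [x|].
      by rewrite [in RHS]mxE mulrC.
    by apply: poly_funZ; apply: poly_fun_lam2.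
  + apply: subspaceZ; first exact: tangent_subspace.
    apply/(tangentP hv) => k kf; rewrite gl_vertexB //.
    case: eqVneq kf => [->|_]; first by rewrite iF.
    by case: eqVneq => [->|_]; rewrite ?jF // subrr.
  rewrite dotZr gl_vertexB //; case: eqVneq xk => [->->|_]; first by rewrite !mul0r.
  by case: eqVneq => [->->|_ _]; rewrite ?mulr0 ?mul0r // subrr mulr0.
- by move=> ab c x y _ _; rewrite /phi -dotZr -dotDr.
- move=> [[i j] ij] [[k l] kl]; rewrite /phi /b -val_eqE /= xpair_eqE => ne.
  have /and3P[/= lij iF jF] := ij; have /and3P[/= lkl kF lF] := kl.
  rewrite !on_fE; try exact: points_midpoint.
  rewrite dotZr !lam_midpoint // gl_vertexB //.
  move: ne lij lkl; rewrite ![_ == i]eq_sym ![_ == j]eq_sym -!val_eqE /= => ne lij lkl.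
  have [ik|ik] := eqVneq (i : nat) k; have [il|il] := eqVneq (i : nat) l;
  have [jk|jk] := eqVneq (j : nat) k; have [jl|jl] := eqVneq (j : nat) l => /=;
  try (by exfalso; lia);
  by rewrite !(addr0, mul0r, mulr0).
- move=> [[i j] ij]; rewrite /phi /b /=; have /and3P[/= lij iF jF] := ij.
  have ne : (i == j) = false by rewrite -val_eqE /= ltn_eqF.
  rewrite !on_fE; try exact: points_midpoint.
  rewrite dotZr !lam_midpoint // gl_vertexB // !eqxx [j == i]eq_sym ne /=.
  have -> : (1 + 0) / 2 * ((0 + 1) / 2) * (1 - 0) = 4^-1 :> R by field.
  by rewrite invr_eq0 pnatr_eq0.
move=> q qS qphi; apply: funext => x; have [q1 q2 q3] := qS.
have [fx|fx] := pselect (points v f x); last first.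
  by apply/colP => i; rewrite mxE; case/poly_onP: (q1 i) => ->.
apply: (gl_vec_eq0 hv) => k.
have ql : quad_on v f (fun x => dot (gl k) (q x)).
  have /choice[c cE] i := poly_on2_quad_on hv (q1 i).
  exists (fun a b => \sum_i gl k i 0 * c i a b) => z fz; rewrite dotE /quad.
  under eq_bigr do rewrite cE // /quad mulr_sumr.
  rewrite exchange_big /=; apply: eq_bigr => a _.
  under eq_bigr do rewrite mulr_sumr.
  rewrite exchange_big /=; apply: eq_bigr => e _.
  by rewrite !mulr_suml; apply: eq_bigr => i _; rewrite !mulrA.
(* At [v a] the components other than the one along [gl a] vanish by the boundary conditions, and
   all components sum to zero. *)
have qv a : a \in f -> forall k, dot (gl k) (q (v a)) = 0.
  move=> af; have fa := points_vertex hv af.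
  have qa l : l != a -> dot (gl l) (q (v a)) = 0.
    by move=> la; apply: (B2divP qS) => //; rewrite lam_vertex // (negPf la).
  move=> l; have [->|/qa //] := eqVneq l a.
  by have := sum_gl_dot hv (q (v a)); rewrite (bigD1 a) //= big1 ?addr0.
apply: (quad_on_zeroP hv ql) fx => [a af|a e af ef ae]; first exact: qv.
have fm := points_midpoint hv af ef.
(* At a midpoint only the components along [gl a] and [gl e] escape the boundary conditions; the
   first is the functional, and the zero sum settles the second. *)
have qm l : l != a -> l != e -> dot (gl l) (q (mid a e)) = 0.
  move=> la le; apply: (B2divP qS) => //.
  by rewrite lam_midpoint // (negPf la) (negPf le) addr0 mul0r.
have aeP : [&& (a < e)%N, a \in f & e \in f] by rewrite ae af.
have ea : e != a by rewrite -val_eqE /= gtn_eqF.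
have qa : dot (gl a) (q (mid a e)) = 0 := qphi (exist _ (a, e) aeP).
have [->//|ka] := eqVneq k a; have [->|ke] := eqVneq k e; last exact: qm.
have := sum_gl_dot hv (q (mid a e)); rewrite (bigD1 a) //= (bigD1 e) //= qa add0r.
by rewrite big1 ?addr0 // => l /andP[la le]; apply: qm.
Qed.

End TestSpaces.

(** * Matrix-valued polynomial spaces *)

Section MatrixSpaces.
Variables (R : realType) (d : nat) (v : 'I_d.+1 -> 'cV[R]_d).
Hypothesis hv : affinely_independent v.
Local Notation I := 'I_d.+1.
Local Notation lam := (lam v).
Local Notation gl := (gl v).
Local Notation ee i := (delta_mx i 0 : 'cV[R]_d).

Definition sym_delta (i j : 'I_d) : 'M[R]_d := delta_mx i j + delta_mx j i.

Lemma sym_deltaE i j k l :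
  sym_delta i j k l = ((k == i) && (l == j))%:R + ((k == j) && (l == i))%:R.
Proof. by rewrite !mxE. Qed.

Lemma tr_sym_delta i j : (sym_delta i j)^T = sym_delta i j.
Proof. by rewrite /sym_delta linearD /= !trmx_delta addrC. Qed.

Lemma dot_delta i (x : 'cV[R]_d) : dot (ee i) x = x i 0.
Proof.
rewrite dotE (bigD1 i) //= mxE !eqxx mul1r big1 ?addr0 // => j /negPf ji.
by rewrite mxE ji mul0r.
Qed.

Lemma form_sym_delta i j (x : 'cV[R]_d) :
  dot x (sym_delta i j *m x) = 2 * (x i 0 * x j 0).
Proof.
have delta k l : dot x (delta_mx k l *m x) = x k 0 * x l 0.
  have -> : delta_mx k l = (ee k) *m (ee l)^T :> 'M[R]_d.
    by rewrite trmx_delta mul_delta_mx.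
  rewrite -mulmxA dotE (bigD1 k) //= big1 ?addr0 => [|m /negPf mk].
    by rewrite mxE big_ord1 mxE !eqxx mul1r -/(dot _ _) dot_delta.
  by rewrite mxE big_ord1 mxE mk mul0r mulr0.
by rewrite mulmxDl dotDr !delta; ring.
Qed.

Lemma mx_form_eq0 (A : 'M[R]_d) : A^T = A -> (forall x, dot x (A *m x) = 0) -> A = 0.
Proof.
move=> AT A0; have Axy x y : dot x (A *m y) = 0.
  have := A0 (x + y); rewrite mulmxDr !dotDl !dotDr !A0 (dot_mulC y x AT).
  by lra.
by apply/(gl_mx_eq0 hv).
Qed.

Lemma mx_entry (A : 'M[R]_d) i j : dot (ee i) (A *m (ee j)) = A i j.
Proof.
by rewrite dot_delta -colE mxE.
Qed.

(** Semistandard tableaux of hook shape (2, 1), decreasing away from the corner entry [j]. The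
    fields of (e) are the hook component of the linear symmetric fields, complementary to the
    totally symmetric one. *)
Definition hook_index : finType :=
  {kij : 'I_d * 'I_d * 'I_d | (kij.1.1 < kij.2)%N && (kij.1.2 <= kij.2)%N}.

Definition cubic_free : set ('cV[R]_d -> 'M[R]_d) :=
  [set q | @sym_poly R d 1 q /\ forall x, (x^T *m q x *m x) 0 0 = 0].

Lemma sym_poly_subspace k : linear_subspace (@sym_poly R d k).
Proof.
split=> [|a x y [xT xk] [yT yk]].
  split=> [x|i j]; first exact: trmx0.
  by apply: (poly_fun_ext (p := fun=> 0)) => [x|]; [rewrite mxE | exact: poly_fun_cst].
have e z : (a *: x + y) z = a *: x z + y z by [].
split=> [z|i j]; first by rewrite e linearD linearZ /= xT yT.
apply: (poly_fun_ext (p := fun z => a * x z i j + y z i j)) => [z|].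
  by rewrite e !mxE.
by apply: poly_funD => //; apply: poly_funZ.
Qed.

Lemma cubic_free_subspace : linear_subspace cubic_free.
Proof.
have [s0 sl] := sym_poly_subspace 1.
split=> [|a x y [xs x0] [ys y0]]; first by split=> // x; rewrite mulmx0 mul0mx mxE.
split=> [|z]; first exact: sl.
have -> : (a *: x + y) z = a *: x z + y z by [].
by rewrite dot_mul mulmxDl -scalemxAl dotDr dotZr -!dot_mul x0 y0 mulr0 addr0.
Qed.

(** For affine [q], the coefficient of the coordinate [k] in the entry [i], [j]; the difference
    removes the constant part. *)
Definition coef (q : 'cV[R]_d -> 'M[R]_d) k i j : R := q (ee k) i j - q 0 i j.

(** Replacing [x] by [- x] separates the constant part of [q], a quadratic form, from its linear
    part, a cubic form. Polarizing the cubic form yields the cyclic relation. *)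
Lemma cubic_free_coef_eq0 q : cubic_free q ->
  (forall k i j, coef q k i j + coef q i j k + coef q j k i = 0) /\
  ((forall k i j, coef q k i j = 0) -> q = 0).
Proof.
move=> [[qT q1] qx].
pose L x := q x - q 0.
have LT x : (L x)^T = L x by rewrite /L linearB /= !qT.
have LD x y : L (x + y) = L x + L y.
  apply/matrixP => i j; have [w wE] := poly_fun1_affine hv (q1 i j).
  by rewrite !mxE wE (wE x) (wE y) dotDr; ring.
have LZ c x : L (c *: x) = c *: L x.
  apply/matrixP => i j; have [w wE] := poly_fun1_affine hv (q1 i j).
  by rewrite !mxE wE (wE x) dotZr; ring.
have qL x : q x = q 0 + L x by rewrite /L addrC subrK.
have LE x : L x = q x - q 0 by [].
clearbody L.
have h x : dot x (q 0 *m x) + dot x (L x *m x) = 0.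
  by rewrite -dotDr -mulmxDl -qL -dot_mul qx.
have h' x : dot x (q 0 *m x) - dot x (L x *m x) = 0.
  have := h (-1 *: x); rewrite LZ -!scalemxAl -!scalemxAr !dotZl !dotZr.
  by lra.
have q0 : q 0 = 0.
  by apply: mx_form_eq0 => [|x]; [exact: qT | have := h x; have := h' x; lra].
have T0 x : dot x (L x *m x) = 0 by have := h x; have := h' x; lra.
have coefE k i j : coef q k i j = dot (ee i) (L (ee k) *m (ee j)).
  by rewrite mx_entry /coef LE !mxE.
split=> [k i j|c0].
  rewrite !coefE; set x := (ee k); set y := (ee i); set z := (ee j).
  have := T0 (x + y + z); have := T0 (x + y); have := T0 (x + z); have := T0 (y + z).
  rewrite !LD !mulmxDl !mulmxDr !dotDl !dotDr !T0.
  rewrite !(dot_mulC y x (LT _)) !(dot_mulC z x (LT _)) !(dot_mulC z y (LT _)).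
  by lra.
apply: funext => x; rewrite qL q0 add0r.
have -> : x = \sum_k x k 0 *: (ee k).
  apply/colP => k; rewrite summxE (bigD1 k) //= !mxE !eqxx mulr1 big1 ?addr0 // => l /negPf lk.
  by rewrite !mxE eq_sym lk mulr0.
have LS (r : seq 'I_d) (c : 'I_d -> R) : L (\sum_(k <- r) c k *: (ee k)) = 0.
  elim: r => [|k r IH]; first by rewrite big_nil LE subrr.
  rewrite big_cons LD IH addr0 LZ; apply/matrixP => i j.
  by rewrite mxE -mx_entry -coefE c0 mulr0 mxE.
exact: LS.
Qed.

Lemma coef_sym q k i j : @sym_poly R d 1 q -> coef q k i j = coef q k j i.
Proof. by move=> [qT _]; rewrite /coef -[in LHS](qT (ee k)) -[in LHS](qT 0) !mxE. Qed.

Lemma cubic_free_basis : exists b : 'I_#|hook_index| -> 'cV[R]_d -> 'M[R]_d,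
  is_basis cubic_free b.
Proof.
pose b (kij : hook_index) : 'cV[R]_d -> 'M[R]_d := fun x =>
  let: (k, i, j) := val kij in x k 0 *: sym_delta i j - x j 0 *: sym_delta k i.
pose phi (kij : hook_index) q := let: (k, i, j) := val kij in coef q k i j.
apply: (dual_basis (b := b) (phi := phi)).
- exact: cubic_free_subspace.
- move=> [[[k i] j] kij]; rewrite /b /=; split=> [|x]; last first.
    rewrite dot_mul mulmxBl -!scalemxAl dotBr !dotZr !form_sym_delta; ring.
  split=> [x|m n]; first by rewrite linearB !linearZ /= !tr_sym_delta.
  apply: (poly_fun_ext (p := fun x =>
    sym_delta i j m n * x k 0 + (- sym_delta k i m n) * x j 0)) => [x|].
    by rewrite [in RHS]mxE [X in _ = X + _]mxE [X in _ = _ + X]mxE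
      [X in _ = _ - X]mxE; ring.
  by apply: poly_funD; apply: poly_funZ; apply: poly_fun_coord.
- move=> [[[k i] j] kij] a x y _ _; rewrite /phi /= /coef.
  have e z : (a *: x + y) z = a *: x z + y z by [].
  by rewrite !e !mxE; ring.
- move=> [[[k i] j] kij] [[[k' i'] j'] kij'] ne; rewrite /phi /b /= /coef.
  have /andP[/= kj ij] := kij; have /andP[/= kj' ij'] := kij'.
  move: ne; rewrite -val_eqE /= !xpair_eqE !mxE -!val_eqE /= => ne.
  have [e1|] := eqVneq (k' : nat) k; have [e2|] := eqVneq (j' : nat) k;
  have [e3|] := eqVneq (i : nat) i'; have [e4|] := eqVneq (j : nat) j';
  have [e5|] := eqVneq (i : nat) j'; have [e6|] := eqVneq (j : nat) i';
  have [e7|] := eqVneq (i : nat) k'; have [e8|] := eqVneq (j : nat) k' => /=;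
  move=> *; first [by exfalso; lia | by ring].
- move=> [[[k i] j] kij]; rewrite /phi /b /= /coef.
  have /andP[/= kj ij] := kij.
  rewrite !mxE !eqxx -!val_eqE /= (gtn_eqF kj) /=.
  rewrite mul1r !mul0r !subr0 -natrD pnatr_eq0.
  by rewrite -lt0n addn_gt0.
move=> q qS q0; have [qcyc qinj] := cubic_free_coef_eq0 qS; apply: qinj => k i j.
have [qs _] := qS.
(* With the symmetry in the last two indices, the functionals cover all coefficients whose first
   index is below the maximum of the others. If the first index is a maximum, the cyclic relation
   reduces to these, up to a factor 2 or 3 when indices coincide. *)
have low (k' i' j' : 'I_d) : (k' < j')%N -> (i' <= j')%N -> coef q k' i' j' = 0.
  move=> h1 h2; have kij : ((k', i', j').1.1 < (k', i', j').2)%N && ((k', i', j').1.2 <= (k', i', j').2)%N.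
    by rewrite /= h1.
  exact: q0 (exist _ (k', i', j') kij).
have low' (k' i' j' : 'I_d) : ((k' < i') || (k' < j'))%N -> coef q k' i' j' = 0.
  have [ij|ji] := leqP i' j'; move=> h; first by apply: low => //; lia.
  by rewrite coef_sym //; apply: low; lia.
have [|h] := boolP ((k < i) || (k < j))%N; first exact: low'.
have := qcyc k i j.
have [ik|ik] := ltnP i k.
  rewrite (low' i j k) ?ik ?orbT //.
  have [jk|jk] := ltnP j k; first by rewrite (low' j k i) ?jk // !addr0.
  have -> : j = k by apply: val_inj => /=; lia.
  by rewrite (coef_sym k k i qs); lra.
have -> : i = k by apply: val_inj => /=; lia.
have [jk|jk] := ltnP j k.
  by rewrite (low' j k k) ?jk // (coef_sym k j k qs); lra.
by have -> : j = k by [apply: val_inj => /=; lia]; lra.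
Qed.

Definition sym_poly2_index : finType :=
  (le_pairs [set: I]%SET * le_pairs [set: 'I_d]%SET)%type.

Lemma sym_poly2_basis : exists b : 'I_#|sym_poly2_index| -> 'cV[R]_d -> 'M[R]_d,
  is_basis (@sym_poly R d 2) b.
Proof.
pose b (t : sym_poly2_index) : 'cV[R]_d -> 'M[R]_d := fun x =>
  (lam (val t.1).1 x * lam (val t.1).2 x) *: sym_delta (val t.2).1 (val t.2).2.
pose phi (t : sym_poly2_index) (q : 'cV[R]_d -> 'M[R]_d) :=
  nodal v (val t.1).1 (val t.1).2 (fun x => q x (val t.2).1 (val t.2).2).
have phib s t : phi s (b t) = (s.1 == t.1)%:R *
    sym_delta (val t.2).1 (val t.2).2 (val s.2).1 (val s.2).2.
  case: s t => [[[i j] ij] s] [[[k l] kl] t]; rewrite /phi /b -val_eqE /= xpair_eqE.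
  have /and3P[/= lij iF jF] := ij; have /and3P[/= lkl kF lF] := kl.
  rewrite -(nodal_lam2 hv) //; set c := sym_delta _ _ _ _.
  have -> : (fun x => ((lam k x * lam l x) *: sym_delta (\val t).1 (\val t).2)
               (\val s).1 (\val s).2) = fun x => c * (lam k x * lam l x) + 0.
    by apply: funext => x; rewrite addr0 [LHS]mxE mulrC.
  rewrite nodal_linear mulrC; have -> : nodal v i j (fun=> 0) = 0; last by rewrite addr0.
  by rewrite /nodal; case: ifP => _ //; ring.
apply: (dual_basis (b := b) (phi := phi)).
- exact: sym_poly_subspace.
- move=> t; split=> [x|i j]; first by rewrite linearZ /= tr_sym_delta.
  apply: (poly_fun_ext (p := fun x => sym_delta (val t.2).1 (val t.2).2 i j *
     (lam (val t.1).1 x * lam (val t.1).2 x))) => [x|].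
    by rewrite [in RHS]mxE mulrC.
  by apply: poly_funZ; apply: poly_fun_lam2.
- move=> t c x y _ _; rewrite /phi -nodal_linear; congr nodal.
  by apply: funext => z; rewrite !mxE.
- move=> [s1 [[i j] ij]] [t1 [[k l] kl]] ne; rewrite phib sym_deltaE /=.
  have [e|_] := eqVneq s1 t1; last by rewrite mul0r.
  have /and3P[/= lij _ _] := ij; have /and3P[/= lkl _ _] := kl.
  move: ne; rewrite xpair_eqE e eqxx /= -[in X in X -> _]val_eqE /= xpair_eqE -!val_eqE /= => ne.
  rewrite (negPf ne) add0r mul1r; case: eqVneq => [il|//] /=; case: eqVneq => [jk|//].
  by exfalso; lia.
- move=> t; rewrite phib eqxx mul1r sym_deltaE !eqxx -natrD pnatr_eq0.
  by rewrite -lt0n addn_gt0.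
move=> q [qT q2] q0; apply: funext => x; apply/matrixP => i j; rewrite mxE.
wlog ij : i j / (i <= j)%N => [hw|].
  by case/orP: (leq_total i j) => [/hw //|ji]; rewrite -(qT x) mxE hw.
have [c cE] := poly_fun2_quad hv (q2 i j); rewrite cE.
have c0 (a e : I) : (a <= e)%N -> (if a == e then c a a else c a e + c e a) = 0.
  move=> ae; rewrite -(nodal_quad hv).
  have aeP : [&& ((a, e).1 <= (a, e).2)%N, (a, e).1 \in [set: I]%SET & (a, e).2 \in [set: I]%SET].
    by rewrite !inE ae.
  have ijP : [&& ((i, j).1 <= (i, j).2)%N, (i, j).1 \in [set: 'I_d]%SET & (i, j).2 \in [set: 'I_d]%SET].
    by rewrite !inE ij.
  have := q0 (exist _ (a, e) aeP, exist _ (i, j) ijP); rewrite /phi /= => <-.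
  by congr nodal; apply: funext => y; rewrite cE.
apply: (quad_eq0 (f := [set: I]%SET)) => [a _|a e _ _ ae|a]; last by rewrite inE.
  by have := c0 a a (leqnn a); rewrite eqxx.
by have := c0 a e (ltnW ae); rewrite -val_eqE /= ltn_eqF.
Qed.

Definition cubic_part : set ('cV[R]_d -> 'M[R]_d) :=
  [set tau | exists2 p, homog_fun 1 p & tau = fun x => p x *: (x *m x^T)].

Lemma outerE (x : 'cV[R]_d) i j : (x *m x^T) i j = x i 0 * x j 0.
Proof. by rewrite mxE big_ord1 [X in _ * X]mxE. Qed.

Lemma cubic_part_basis : exists b : 'I_d -> 'cV[R]_d -> 'M[R]_d,
  is_basis cubic_part b.
Proof.
suff : exists b : 'I_#|'I_d| -> 'cV[R]_d -> 'M[R]_d, is_basis cubic_part b.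
  by rewrite card_ord.
pose b (k : 'I_d) : 'cV[R]_d -> 'M[R]_d := fun x => x k 0 *: (x *m x^T).
pose phi (k : 'I_d) (q : 'cV[R]_d -> 'M[R]_d) := q (ee k) k k.
apply: (dual_basis (b := b) (phi := phi)).
- split=> [|a x y [p /homog_fun1P[c pc] ->] [p' /homog_fun1P[c' pc'] ->]].
    exists (fun=> 0); last by apply: funext => x; rewrite scale0r.
    by apply/homog_fun1P; exists (fun=> 0) => x; rewrite big1 // => i _; rewrite mul0r.
  exists (fun x => a * p x + p' x).
    apply/homog_fun1P; exists (fun i => a * c i + c' i) => z.
    by rewrite pc pc' mulr_sumr -big_split /=; apply: eq_bigr => i _; ring.
  apply: funext => z; rewrite scalerDl -scalerA //.
- move=> k; exists (fun x => x k 0) => //; apply/homog_fun1P.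
  exists (fun i => (i == k)%:R) => x; rewrite (bigD1 k) //= eqxx mul1r big1 ?addr0 // => i.
  by move=> /negPf ->; rewrite mul0r.
- by move=> k a x y _ _; rewrite /phi !mxE.
- by move=> i j ij; rewrite /phi /b !mxE eq_sym (negPf ij) mul0r.
- by move=> i; rewrite /phi /b mxE outerE !mxE !eqxx !mulr1 oner_eq0.
move=> _ [p /homog_fun1P[c pc] ->] p0; apply: funext => x.
suff -> : p x = 0 by rewrite scale0r.
rewrite pc big1 // => k _; have := p0 k; rewrite /phi mxE outerE !mxE !eqxx !mulr1 pc.
rewrite (bigD1 k) //= mxE !eqxx mulr1 big1 ?addr0 => [->|i /negPf ik].
  by rewrite mul0r.
by rewrite mxE ik mulr0.
Qed.

(** On the line through the [k]-th unit vector, the diagonal entry at [k] is a quadratic polynomial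
    in [t] plus [t ^+ 3 * c k]; its zeros at 0, 1, -1 and 2 force [c k = 0]. *)
Lemma sym_poly2_cubic_part (x y : 'cV[R]_d -> 'M[R]_d) :
  @sym_poly R d 2 x -> cubic_part y -> x + y = 0 -> x = 0.
Proof.
move=> [_ x2] [p /homog_fun1P[c pc] ->] xy0.
suff p0 k : c k = 0.
  have pz z : p z = 0 by rewrite pc big1 // => k _; rewrite p0 mul0r.
  apply: funext => z; have := congr1 (fun t : 'cV[R]_d -> 'M[R]_d => t z) xy0.
  have -> : (x + (fun x0 => p x0 *: (x0 *m x0^T))) z = x z + p z *: (z *m z^T) by [].
  by rewrite pz scale0r addr0.
have [q qE] := poly_fun2_quad hv (x2 k k).
have cube t : quad q (fun a => 1 * lam a 0 + t * dot (gl a) (ee k)) + t ^+ 3 * c k = 0.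
  have := congr1 (fun tau : 'cV[R]_d -> 'M[R]_d => tau (t *: (ee k)) k k) xy0.
  have -> : (x + (fun x0 => p x0 *: (x0 *m x0^T))) (t *: (ee k)) =
    x (t *: (ee k)) + p (t *: (ee k)) *: ((t *: (ee k)) *m (t *: (ee k))^T) by [].
  rewrite mxE [X in _ + X]mxE outerE qE pc.
  rewrite (bigD1 k) //= !mxE !eqxx big1 ?addr0 => [|i /negPf ik]; last first.
    by rewrite !mxE ik !mulr0.
  rewrite mulr1 => h; rewrite -[RHS]h; congr (_ + _); last by ring.
  by congr quad; apply: funext => a; rewrite [RHS]lamE dotZr mul1r.
have := cube 0; have := cube 1; have := cube (-1); have := cube 2.
rewrite !quad_comb; lra.
Qed.

Lemma Sigma2plus_basis : exists b : 'I_(#|sym_poly2_index| + d) -> 'cV[R]_d -> 'M[R]_d,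
  is_basis (@Sigma2plus R d) b.
Proof.
have [b1 h1] := sym_poly2_basis; have [b2 h2] := cubic_part_basis.
have [b hb] := basis_sum h1 h2 sym_poly2_cubic_part.
exists b; suff -> : @Sigma2plus R d =
  [set z | exists x y, [/\ @sym_poly R d 2 x, cubic_part y & z = x + y]] by [].
apply/seteqP; split=> [_ [x [p [xs p1 ->]]]|z [x [y [xs [p p1 ->] ->]]]].
  by exists x, (fun z => p z *: (z *m z^T)); split=> //; exists p.
by exists x, p.
Qed.

End MatrixSpaces.

(** * Counting the functionals *)

Section DofCount.
Local Open Scope nat_scope.

Definition dof_size d (k : dof_index d) : nat :=
  match k with
  | inl e => #|le_pairs (val e)|
  | inr (inl F) => #|le_pairs (val F)|
  | inr (inr (inl F)) => #|val F|
  | inr (inr (inr (inl r))) => #|lt_pairs (initial_simplex d (val r - 2))|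
  | inr (inr (inr (inr tt))) => #|hook_index d|
  end.

Lemma card_initial_simplex d l : l <= d -> #|initial_simplex d l| = l.+1.
Proof.
move=> ld; rewrite cardsE -sum1_card big_mkcond /=.
rewrite (eq_bigr (fun i : 'I_d.+1 => (i < l.+1 : nat))) => [|i _]; last first.
  by rewrite unfold_in -[eqn _ _]/(i <= l) ltnS; case: (i <= l).
have sum_lt n : \sum_(i < n) (i < l.+1 : nat) = minn n l.+1.
  elim: n => [|n IH]; first by rewrite big_ord0 min0n.
  by rewrite big_ord_recr /= IH; case: ltnP; lia.
by rewrite sum_lt; apply/minn_idPr.
Qed.

Lemma card_subsimplex d l : #|subsimplex d l| = 'C(d.+1, l.+1).
Proof.
rewrite card_sig -[d.+1 in RHS]card_ord -card_draws.
by apply: eq_card => A; rewrite !inE.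
Qed.

(** For a given largest index [j], counted from zero, there are [j] choices of [k] and [j + 1] of
    [i]. *)
Lemma card_hook_index d : 3 * #|hook_index d| + d = d * d * d.
Proof.
have -> : #|hook_index d| = \sum_(j < d) (j * j.+1).
  rewrite card_sig -sum1_card big_mkcond /=.
  transitivity (\sum_(j < d) \sum_(k < d) \sum_(i < d) ((k < j) * (i <= j))).
    rewrite exchange_big /=; under [in RHS]eq_bigr do rewrite exchange_big /=.
    rewrite pair_big pair_big /=; apply: eq_bigr => -[[k i] j] _ /=.
    by rewrite inE /=; case: (k < j); case: (i <= j).
  apply: eq_bigr => j _.
  have cnt m : m <= d -> \sum_(i < d) (i < m : nat) = m.
    move=> md; have : forall n, \sum_(i < n) (i < m : nat) = minn n m.
      elim=> [|n IH]; first by rewrite big_ord0 min0n.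
      by rewrite big_ord_recr /= IH; case: ltnP; lia.
    by move->; apply/minn_idPr.
  under eq_bigr do rewrite -big_distrr /= (cnt j.+1) //.
  by rewrite -big_distrl /= cnt // ltnW.
elim: d => [|d IH]; first by rewrite big_ord0.
rewrite big_ord_recr /= mulnDr; move: IH; set S := bigop.body _ _ _; move=> IH. nia.
Qed.

(** Every binomial count is carried along with its denominator 2, 3 or 6 cleared, which leaves a
    polynomial identity in [d]. The tangential set contributes 'C(D, 3), here [S]. *)
Lemma sum_dof_size d : 2 <= d ->
  \sum_k @dof_size d k = #|sym_poly2_index d| + d.
Proof.
case: d => [|[|d]] // _; set D := d.+2.
have le2 n (f : {set 'I_n}) : 2 * #|le_pairs f| = #|f| * #|f| + #|f|.
  by have := card_lt_pairs f; rewrite card_le_pairs; lia.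
have sumc (T : finType) (F : T -> nat) c : (forall x, F x = c) -> \sum_x F x = #|T| * c.
  by move=> Fc; rewrite (eq_bigr (fun=> c)) ?sum_nat_const.
have -> : \sum_k @dof_size D k = \sum_(e : subsimplex D d) #|le_pairs (val e)| +
    (\sum_(F : subsimplex D d.+1) #|le_pairs (val F)| +
    (\sum_(F : subsimplex D d.+1) #|val F| +
    (\sum_(r : {r : 'I_D.+1 | 2 < r}) #|lt_pairs (initial_simplex D (val r - 2))| +
     #|hook_index D|))).
  rewrite !big_sumType; do 4 congr (_ + _).
  by rewrite (bigD1 tt) //= [X in _ + X]big1 ?addn0 // => -[].
pose S := \sum_(r < D.+1 | 2 < r) #|lt_pairs (initial_simplex D (r - 2))|.
have -> : \sum_(i : {r : 'I_D.+1 | 2 < r}) #|lt_pairs (initial_simplex D (\val i - 2))| = S.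
  by rewrite /S -(big_sub [pred r : 'I_D.+1 | 2 < r] (fun r : 'I_D.+1 => #|lt_pairs (initial_simplex D (r - 2))|)).
have S6 : 6 * S = D * (D - 1) * (D - 2).
  pose F r := #|lt_pairs (initial_simplex D (r - 2))|.
  (* For [n <= 3] the sum is empty, and truncated subtraction makes the right side zero as well. *)
  have : forall n, n <= D.+1 -> 6 * (\sum_(0 <= r < n | 2 < r) F r) =
      (n - 1) * (n - 2) * (n - 3).
    elim=> [|n IH] nD; first by rewrite big_nil.
    rewrite big_mkcond big_nat_recr //= -big_mkcond mulnDr (IH (ltnW nD)).
    have [n2|n2] := ltnP 2 n; last first.
      by case: n n2 {IH nD} => [|[|[|]]].
    have := card_lt_pairs (initial_simplex D (n - 2)).
    rewrite card_initial_simplex -/(F n); last by lia.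
    move: (F n) => Fn; case: n n2 {IH nD} => [|[|[|n]]] // _.
    rewrite !subSS !subn0 => h; nia.
  by move=> /(_ D.+1 (leqnn _)); rewrite big_mkord -/S => ->; rewrite !subSS !subn0.
set LE := (d.+1 * d.+1 + d.+1) %/ 2; set LF := (D * D + D) %/ 2.
have dbl n (f : {set 'I_n}) m : #|f| = m -> #|le_pairs f| = (m * m + m) %/ 2.
  by move=> fm; have := le2 _ f; rewrite fm => <-; rewrite mulKn.
rewrite (sumc (subsimplex D d) (fun e => #|le_pairs (val e)|) LE) => [|e]; last by apply: dbl; rewrite (eqP (valP e)).
rewrite (sumc (subsimplex D d.+1) (fun e => #|le_pairs (val e)|) LF) => [|F]; last by apply: dbl; rewrite (eqP (valP F)).
rewrite (sumc (subsimplex D d.+1) (fun e => #|val e|) D) => [|F]; last by rewrite (eqP (valP F)).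
rewrite !card_subsimplex /sym_poly2_index card_prod /=.
have := card_hook_index D; have := le2 _ [set: 'I_D.+1]%SET; have := le2 _ [set: 'I_D]%SET.
rewrite !cardsT !card_ord binSn.
have : 2 * 'C(D.+1, d.+1) = D.+1 * D.
  have -> : 'C(D.+1, d.+1) = 'C(D.+1, 2).
    by rewrite -[RHS]bin_sub // !subSS subn0.
  by rewrite bin2 mul2n -[RHS]odd_double_half oddM /= andNb.
have : 2 * LE = d.+1 * d.+1 + d.+1.
  by rewrite /LE mulnC divnK // dvdn2 oddD oddM andbb addbb.
have : 2 * LF = D * D + D.
  by rewrite /LF mulnC divnK // dvdn2 oddD oddM andbb addbb.
move: S S6 LE LF #|hook_index D| 'C(D.+1, d.+1) #|le_pairs [set: 'I_D]%SET| #|le_pairs [set: 'I_D.+1]%SET|.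
move=> S S6 LE LF H B X Y hLF hLE hB hX hY hH.
rewrite /D in S6 hLF hLE hB hX hY hH *.
(* The two products of halved counts are replaced by products of doubled ones before [nia] is
   called. *)
have e1 : 4 * (B * LE) = (2 * B) * (2 * LE) by lia.
have e2 : 4 * (Y * X) = (2 * Y) * (2 * X) by lia.
rewrite hB hLE in e1; rewrite hX hY in e2; rewrite !subSS !subn0 in S6.
nia.
Qed.

End DofCount.

(** * The functions in Sigma2plus and their traces *)

(** For [t != 0] the difference quotient equals a polynomial in [t], so its limit is the constant
    term. *)
Lemma derive_cubic (R : realType) (d : nat) (h : 'cV[R]_d -> R) x u c1 c2 c3 :
  (forall t, h (x + t *: u) = h x + t * c1 + t ^+ 2 * c2 + t ^+ 3 * c3) ->
  'D_u h x = c1.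
Proof.
move=> hE; apply: cvg_lim => //.
pose P : {poly R} := c1%:P + c2 *: 'X + c3 *: 'X^2.
have -> : c1 = P.[0] by rewrite /P !hornerE /= mulr0 addr0.
have : P.[t] @[t --> 0^'] --> P.[0].
  by apply: cvg_within_filter; exact: continuous_horner.
apply: cvg_trans; apply: near_eq_cvg; near=> t.
have t0 : t != 0 by near: t; exact: nbhs_dnbhs_neq.
rewrite /P !hornerE /= [t *: u + x]addrC hE.
by apply: (mulfI t0); rewrite -[X in _ = X]/(t * (t^-1 * _)) mulVKf //; ring.
Unshelve. all: by end_near.
Qed.

Section Representation.
Variables (R : realType) (d : nat) (v : 'I_d.+1 -> 'cV[R]_d).
Hypothesis hv : affinely_independent v.
Local Notation I := 'I_d.+1.
Local Notation lam := (lam v).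
Local Notation gl := (gl v).

Lemma coord_lam x i : \sum_a lam a x * v a i 0 = x i 0.
Proof.
rewrite -[in RHS](sum_lam_vertex hv x) summxE.
by apply: eq_bigr => a _; rewrite mxE.
Qed.

(** The coefficients are averaged over both orders of [a], [b] and both orders of the matrix
    indices, whence the factor 1/4. The linear factor is recorded by its vertex values, and the
    condition on them says that it vanishes at the origin. *)
Lemma Sigma2plus_rep tau : @Sigma2plus R d tau ->
  exists (A : I -> I -> 'M[R]_d) (p : I -> R),
  [/\ forall a b, (A a b)^T = A a b, forall a b, A a b = A b a,
      \sum_a lam a 0 * p a = 0 &
      forall x, tau x = \sum_a \sum_b (lam a x * lam b x) *: A a b +
        (\sum_a lam a x * p a) *: (x *m x^T)].
Proof.
move=> [tau0 [p [[sT s2] /homog_fun1P[c pc] ->]]].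
have /choice[q qE] i : exists q : 'I_d -> I -> I -> R,
    forall j x, tau0 x i j = quad (q j) (lam ^~ x).
  have /choice[q qE] j := poly_fun2_quad hv (s2 i j).
  by exists q.
exists (fun a b => \matrix_(i, j) ((q i j a b + q i j b a + q j i a b + q j i b a) / 4)).
exists (fun a => \sum_i c i * v a i 0); split=> [a b|a b||x].
- by apply/matrixP => i j; rewrite !mxE; ring.
- by apply/matrixP => i j; rewrite !mxE; ring.
- under eq_bigr do rewrite mulr_sumr; rewrite exchange_big big1 //= => i _.
  under eq_bigr do rewrite mulrCA; rewrite -mulr_sumr.
  have -> : \sum_a lam a 0 * v a i 0 = (0 : 'cV[R]_d) i 0; last by rewrite mxE mulr0.
  by rewrite coord_lam.
congr (_ + _ *: _).
  apply/matrixP => i j; rewrite summxE.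
  have -> : tau0 x i j = (tau0 x i j + tau0 x i j + tau0 x j i + tau0 x j i) / 4.
    by rewrite -[in X in (_ + _ + X + X) / 4](sT x) mxE; field.
  rewrite !qE [X in (X + _ + _ + _) / 4]quad_sym [X in (_ + X + _ + _) / 4]quad_sym.
  rewrite [X in (_ + _ + X + _) / 4]quad_sym [X in (_ + _ + _ + X) / 4]quad_sym.
  rewrite -!big_split mulr_suml; apply: eq_bigr => a _; rewrite summxE /=.
  rewrite -!big_split mulr_suml; apply: eq_bigr => b _; rewrite !mxE /=.
  by field.
rewrite pc; under [in RHS]eq_bigr do rewrite mulr_sumr.
rewrite [in RHS]exchange_big; apply: eq_bigr => i _ /=.
under [in RHS]eq_bigr do rewrite mulrCA; rewrite -mulr_sumr; congr (_ * _).
by rewrite coord_lam.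
Qed.

Section Tau.
Variables (A : I -> I -> 'M[R]_d) (p : I -> R).
Hypothesis AT : forall a b, (A a b)^T = A a b.
Hypothesis AC : forall a b, A a b = A b a.
Definition cubic_coef x := \sum_a lam a x * p a.
Local Notation P := cubic_coef.
Hypothesis P0 : P 0 = 0.
Definition sigma_fun x := \sum_a \sum_b (lam a x * lam b x) *: A a b + P x *: (x *m x^T).
Local Notation tau := sigma_fun.
Let dP u := \sum_a dot (gl a) u * p a.

Let PE x : P x = dP x.
Proof.
rewrite -[RHS]add0r -[X in X + _]P0 /cubic_coef /dP -big_split; apply: eq_bigr => a _.
by rewrite /= lamE mulrDl.
Qed.

(* The derivative of [sigma_fun] at [x] in the direction [u]. *)
Definition dtau u x : 'M[R]_d :=
  \sum_a \sum_b (dot (gl a) u * lam b x + lam a x * dot (gl b) u) *: A a b +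
  dP u *: (x *m x^T) + P x *: (u *m x^T + x *m u^T).

Lemma tau_taylor x u : exists E2 E3 : 'M[R]_d, forall t,
  tau (x + t *: u) = tau x + t *: dtau u x + t ^+ 2 *: E2 + t ^+ 3 *: E3.
Proof.
exists (\sum_a \sum_b (dot (gl a) u * dot (gl b) u) *: A a b +
   dP u *: (u *m x^T + x *m u^T) + P x *: (u *m u^T)).
exists (dP u *: (u *m u^T)) => t.
have Pt : P (x + t *: u) = P x + t * dP u.
  rewrite /cubic_coef /dP mulr_sumr -big_split; apply: eq_bigr => a _ /=.
  by rewrite lamD dotZr; ring.
apply/matrixP => i j; rewrite /sigma_fun Pt /dtau.
have q (F : I -> I -> R) : (\sum_a \sum_b F a b *: A a b) i j = \sum_a \sum_b A a b i j * F a b.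
  rewrite summxE; apply: eq_bigr => a _; rewrite summxE; apply: eq_bigr => b _.
  by rewrite mxE mulrC.
have m (c e : 'cV[R]_d) : (c *m e^T) i j = c i 0 * e j 0.
  by rewrite mxE big_ord1 [X in _ * X]mxE.
do ?[rewrite (q, m) | rewrite [(_ + _ : 'M[R]__) i j]mxE | rewrite [(_ *: _ : 'M[R]__) i j]mxE].
rewrite [(x + _) i 0]mxE [(x + _) j 0]mxE [(t *: u) i 0]mxE [(t *: u) j 0]mxE.
have -> : \sum_a \sum_b A a b i j * (lam a (x + t *: u) * lam b (x + t *: u)) =
   \sum_a \sum_b A a b i j * (lam a x * lam b x) +
   t * (\sum_a \sum_b A a b i j * (dot (gl a) u * lam b x + lam a x * dot (gl b) u)) +
   t ^+ 2 * (\sum_a \sum_b A a b i j * (dot (gl a) u * dot (gl b) u)).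
  rewrite !mulr_sumr -!big_split; apply: eq_bigr => a _ /=.
  rewrite !mulr_sumr -!big_split; apply: eq_bigr => b _ /=.
  by rewrite !lamD !dotZr; ring.
ring.
Qed.

Local Notation ee i := (delta_mx i 0 : 'cV[R]_d).

Lemma vec_expand (u : 'cV[R]_d) : u = \sum_i u i 0 *: ee i.
Proof.
apply/colP => k; rewrite summxE (bigD1 k) //= !mxE !eqxx mulr1 big1 ?addr0 // => l /negPf lk.
by rewrite !mxE eq_sym lk mulr0.
Qed.

Lemma dtauD a u w x : dtau (a *: u + w) x = a *: dtau u x + dtau w x.
Proof.
have dPD : dP (a *: u + w) = a * dP u + dP w.
  rewrite /dP mulr_sumr -big_split; apply: eq_bigr => b _ /=.
  by rewrite dotDr dotZr; ring.
have trE : (a *: u + w)^T = a *: u^T + w^T by rewrite linearD linearZ.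
rewrite /dtau dPD trE mulmxDl mulmxDr -!scalemxAl -!scalemxAr.
have -> : \sum_a0 \sum_b (dot (gl a0) (a *: u + w) * lam b x + lam a0 x * dot (gl b) (a *: u + w)) *: A a0 b
  = a *: (\sum_a \sum_b (dot (gl a) u * lam b x + lam a x * dot (gl b) u) *: A a b) +
    \sum_a \sum_b (dot (gl a) w * lam b x + lam a x * dot (gl b) w) *: A a b.
  rewrite scaler_sumr -big_split; apply: eq_bigr => i _ /=.
  rewrite scaler_sumr -big_split; apply: eq_bigr => j _ /=.
  by rewrite scalerA -scalerDl !dotDr !dotZr; congr (_ *: _); ring.
apply/matrixP => i j.
do ?[rewrite [(_ + _ : 'M[R]__) i j]mxE | rewrite [(_ *: _ : 'M[R]__) i j]mxE].
ring.
Qed.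

Lemma dtau0 x : dtau 0 x = 0.
Proof. by have := dtauD (-1) 0 0 x; rewrite scaler0 addr0 scaleN1r addNr. Qed.

Lemma dtau_sum (J : Type) (r : seq J) (c : J -> R) (u : J -> 'cV[R]_d) x :
  dtau (\sum_(i <- r) c i *: u i) x = \sum_(i <- r) c i *: dtau (u i) x.
Proof.
by elim: r => [|i r IH]; rewrite ?big_nil ?dtau0 // !big_cons dtauD IH.
Qed.

Lemma dtauZ c u x : dtau (c *: u) x = c *: dtau u x.
Proof. by have := dtauD c u 0 x; rewrite !addr0 dtau0 addr0. Qed.

Lemma tr_dtau u x : (dtau u x)^T = dtau u x.
Proof.
have tD (B C : 'M[R]_d) : (B + C)^T = B^T + C^T by rewrite linearD.
have tZ c (B : 'M[R]_d) : (c *: B)^T = c *: B^T by rewrite linearZ.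
rewrite /dtau tD tD !tZ tD !trmx_mul !trmxK [x *m u^T + _]addrC.
congr (_ + _ + _); rewrite linear_sum /=; apply: eq_bigr => a _.
by rewrite linear_sum /=; apply: eq_bigr => b _; rewrite linearZ /= AT.
Qed.

Lemma tr_sigma_fun x : (tau x)^T = tau x.
Proof.
rewrite /sigma_fun linearD linearZ /= trmx_mul trmxK; congr (_ + _).
rewrite linear_sum /=; apply: eq_bigr => a _.
by rewrite linear_sum /=; apply: eq_bigr => b _; rewrite linearZ /= AT.
Qed.

Lemma derive_tau u w z x :
  'D_u (fun y => dot w (tau y *m z)) x = dot w (dtau u x *m z).
Proof.
have [E2 [E3 tE]] := tau_taylor x u.
apply: (derive_cubic (c2 := dot w (E2 *m z)) (c3 := dot w (E3 *m z))) => t.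
by rewrite tE; move: (tau x) (dtau u x) => T D; rewrite !mulmxDl -!scalemxAl !dotDr !dotZr.
Qed.

Lemma row_div_tau n x :
  dot n (row_div tau x) = \sum_i dot n (dtau (ee i) x *m ee i).
Proof.
rewrite dotE; under eq_bigr do rewrite mxE mulr_sumr; rewrite exchange_big /=.
apply: eq_bigr => j _; rewrite dotE; apply: eq_bigr => i _; congr (_ * _).
rewrite /partial.
have -> : (fun y => tau y i j) = (fun y => dot (ee i) (tau y *m ee j)).
  by apply: funext => y; rewrite mx_entry.
by rewrite derive_tau dot_delta.
Qed.

(** As the projection is symmetric and idempotent, the surface divergence is the full divergence of
    [tau n] minus its normal derivative; the symmetry of [tau] turns the former into
    [n . div tau]. *)
Lemma surface_div_tau n x : dot n n = 1 ->
  surface_div n (fun y => tau y *m n) x =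
  \sum_i dot n (dtau (ee i) x *m ee i) - dot n (dtau n x *m n).
Proof.
move=> n1; pose Q := face_proj n.
have QT : Q^T = Q by rewrite /Q /face_proj linearB /= trmx1 trmx_mul trmxK.
have Qz (z : 'cV[R]_d) : Q *m z = z - dot n z *: n.
  rewrite /Q /face_proj mulmxBl mul1mx -mulmxA; congr (_ - _).
  by rewrite [n^T *m z]mx11_scalar mul_mx_scalar.
have QQ (z : 'cV[R]_d) : Q *m (Q *m z) = Q *m z.
  by rewrite !Qz dotBr dotZr n1 mulr1 subrr scale0r subr0.
have part i j : partial i (fun y => (face_proj n *m (tau y *m n)) j 0) x =
    (Q *m (dtau (ee i) x *m n)) j 0.
  rewrite -[RHS]dot_delta (dot_mulC _ _ QT) dotC -[dot _ _]derive_tau /partial.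
  congr (derive _ _ _); apply: funext => y.
  by rewrite -[LHS]dot_delta (dot_mulC _ _ QT) dotC.
rewrite /surface_div; under eq_bigr do under eq_bigr do rewrite part.
transitivity (\sum_i (Q *m (Q *m (dtau (ee i) x *m n))) i 0).
  by apply: eq_bigr => i _; rewrite [RHS]mxE.
have -> : \sum_i dot n (dtau (ee i) x *m ee i) = \sum_i (dtau (ee i) x *m n) i 0.
  by apply: eq_bigr => i _; rewrite (dot_mulC _ _ (tr_dtau _ _)) dot_delta.
have -> : dot n (dtau n x *m n) = \sum_i n i 0 * dot n (dtau (ee i) x *m n).
  rewrite [in LHS](vec_expand n) dtau_sum -(vec_expand n) mulmx_suml dot_sumr.
  by apply: eq_bigr => i _; rewrite -scalemxAl dotZr.
rewrite -sumrB; apply: eq_bigr => i _; rewrite QQ Qz !mxE; congr (_ - _).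
by rewrite mulrC.
Qed.

Definition g_raw a b j k := dot (gl j) (A a b *m gl k).

(* The value of [gl j . tau x *m gl k] where [lam j x = lam k x = 0] is the
   quadratic form with these coefficients. *)
Definition g_coef a b j k := g_raw a b j k + lam j 0 * lam k 0 * (p a + p b) / 2.

Lemma g_coefC a b j k : g_coef a b j k = g_coef b a j k.
Proof. by rewrite /g_coef /g_raw AC [p b + _]addrC. Qed.

Lemma g_rawT a b j k : g_raw a b j k = g_raw a b k j.
Proof. exact: dot_mulC. Qed.

Lemma g_coefT a b j k : g_coef a b j k = g_coef a b k j.
Proof. by rewrite /g_coef g_rawT [lam k 0 * _]mulrC. Qed.

Lemma g_coef_row a b j : \sum_k g_coef a b j k = lam j 0 * (p a + p b) / 2.
Proof.
rewrite /g_coef big_split /=.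
have -> : \sum_k g_raw a b j k = 0.
  by rewrite /g_raw -dot_sumr -mulmx_sumr (sum_gl hv) mulmx0 dot0r.
by rewrite add0r -!mulr_suml -mulr_sumr (sum_lam hv) mulr1.
Qed.

Lemma outer_mul (u w z : 'cV[R]_d) : (u *m w^T) *m z = dot w z *: u.
Proof. by rewrite -mulmxA [w^T *m z]mx11_scalar mul_mx_scalar. Qed.

Lemma sigma_funE u w x : dot u (tau x *m w) =
  \sum_a \sum_b lam a x * lam b x * dot u (A a b *m w) + P x * (dot u x * dot x w).
Proof.
rewrite /sigma_fun mulmxDl dotDr -scalemxAl outer_mul !dotZr; congr (_ + _); last by ring.
rewrite mulmx_suml dot_sumr; apply: eq_bigr => a _.
rewrite mulmx_suml dot_sumr; apply: eq_bigr => b _.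
by rewrite -scalemxAl dotZr.
Qed.

Lemma sum_weights (w : I -> R) c : \sum_a \sum_b w a * w b * (c * (p a + p b) / 2) =
  c * (\sum_a w a) * (\sum_a w a * p a).
Proof.
have e1 : \sum_a \sum_b w a * w b * p a = (\sum_a w a) * (\sum_a w a * p a).
  rewrite mulrC mulr_suml; apply: eq_bigr => a _.
  by rewrite mulr_sumr; apply: eq_bigr => b _; ring.
have e2 : \sum_a \sum_b w a * w b * p b = (\sum_a w a) * (\sum_a w a * p a).
  rewrite mulr_suml; apply: eq_bigr => a _.
  by rewrite mulr_sumr; apply: eq_bigr => b _; ring.
transitivity (c / 2 * (\sum_a \sum_b w a * w b * p a + \sum_a \sum_b w a * w b * p b)).
  rewrite -big_split mulr_sumr; apply: eq_bigr => a _ /=.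
  by rewrite -big_split mulr_sumr; apply: eq_bigr => b _ /=; field.
by rewrite e1 e2; field.
Qed.

(** The cubic term contributes [P x] times the product of [lam j x - lam j 0] and
    [lam k x - lam k 0]. The constant part of this product, made quadratic by [sum_weights], is the
    correction in [g_coef]; the rest vanishes on the intersection of faces [j] and [k]. *)
Lemma sigma_fun_gl j k x : dot (gl j) (tau x *m gl k) =
  quad (fun a b => g_coef a b j k) (lam ^~ x) +
  P x * (lam j x * lam k x - lam j 0 * lam k x - lam k 0 * lam j x).
Proof.
rewrite sigma_funE [dot x _]dotC.
have -> : quad (fun a b => g_coef a b j k) (lam ^~ x) =
    \sum_a \sum_b lam a x * lam b x * g_raw a b j k + lam j 0 * lam k 0 * P x.
  have := sum_weights (lam ^~ x) (lam j 0 * lam k 0).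
  rewrite (sum_lam hv) mulr1 -/(P x) => <-; rewrite -big_split; apply: eq_bigr => a _ /=.
  by rewrite -big_split; apply: eq_bigr => b _ /=; rewrite /g_coef; ring.
by rewrite /g_raw !(lamE v j x, lamE v k x); ring.
Qed.

Lemma dtauE u z w x : dot z (dtau u x *m w) =
  \sum_a \sum_b (dot (gl a) u * lam b x + lam a x * dot (gl b) u) * dot z (A a b *m w) +
  dP u * (dot z x * dot x w) + P x * (dot z u * dot x w + dot z x * dot u w).
Proof.
rewrite /dtau !mulmxDl -!scalemxAl !mulmxDl !outer_mul !dotDr !dotZr !dotDr !dotZr.
congr (_ + _ + _); last by ring.
  rewrite mulmx_suml dot_sumr; apply: eq_bigr => a _.
  rewrite mulmx_suml dot_sumr; apply: eq_bigr => b _.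
  by rewrite -scalemxAl dotZr.
by ring.
Qed.

Lemma sum_ee (u w : 'cV[R]_d) : \sum_i dot u (ee i) * dot w (ee i) = dot u w.
Proof. by rewrite dotE; apply: eq_bigr => i _; rewrite ![dot _ (ee i)]dotC !dot_delta. Qed.

Let dPE u : dP u = dot (\sum_a p a *: gl a) u.
Proof. by rewrite dot_suml; apply: eq_bigr => a _; rewrite dotZl mulrC. Qed.

(** The constant [d + 2]: the row divergence of [x *m x^T] is [d + 1] times [x], and by Euler's
    relation the derivative of the homogeneous linear factor adds [P x] once more. *)
Lemma div_sigma_fun j x : \sum_i dot (gl j) (dtau (ee i) x *m ee i) =
  2 * (\sum_a \sum_b lam a x * g_raw a b j b) + d.+2%:R * P x * dot (gl j) x.
Proof.
under eq_bigr do rewrite dtauE; rewrite !big_split /=.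
have -> : \sum_i dP (ee i) * (dot (gl j) x * dot x (ee i)) = P x * dot (gl j) x.
  have -> : P x = \sum_i dP (ee i) * dot x (ee i).
    by rewrite PE dPE -[LHS]sum_ee; apply: eq_bigr => i _; rewrite -dPE.
  by rewrite mulr_suml; apply: eq_bigr => i _; ring.
have -> : \sum_i P x * (dot (gl j) (ee i) * dot x (ee i) + dot (gl j) x * dot (ee i) (ee i))
    = (1 + d%:R) * P x * dot (gl j) x.
  rewrite -mulr_sumr big_split /= sum_ee -mulr_sumr.
  have -> : \sum_i dot (ee i) (ee i) = d%:R :> R.
    under eq_bigr do rewrite dot_delta mxE !eqxx.
    by rewrite sumr_const card_ord.
  by ring.
have e a b (F : 'cV[R]_d) : \sum_i dot F (ee i) * dot (gl j) (A a b *m ee i) =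
    dot (gl j) (A a b *m F).
  rewrite (dot_mulC _ _ (AT a b)) -sum_ee; apply: eq_bigr => i _.
  by rewrite (dot_mulC _ _ (AT a b)) [dot (ee i) _]dotC.
have -> : \sum_i \sum_a \sum_b (dot (gl a) (ee i) * lam b x + lam a x * dot (gl b) (ee i)) *
    dot (gl j) (A a b *m ee i) =
    \sum_a \sum_b lam b x * g_raw a b j a + \sum_a \sum_b lam a x * g_raw a b j b.
  rewrite -big_split exchange_big; apply: eq_bigr => a _ /=.
  rewrite -big_split exchange_big; apply: eq_bigr => b _ /=.
  rewrite /g_raw -!e !mulr_sumr -big_split; apply: eq_bigr => i _ /=; ring.
rewrite exchange_big /=.
have -> : \sum_b \sum_a lam b x * g_raw a b j a = \sum_a \sum_b lam a x * g_raw a b j b.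
  by apply: eq_bigr => a _; apply: eq_bigr => b _; rewrite /g_raw AC.
by rewrite -[d.+2]addn2 natrD; ring.
Qed.

(** The trace is twice [n . div tau] minus the normal derivative of [n . tau n]. Apart from the
    cubic term, the hypothesis obtained from (b) leaves only the coefficients [g_coef a j j j] in
    that derivative. *)
Lemma tr2_face j k x n : n = - k *: gl j -> k ^+ 2 * dot (gl j) (gl j) = 1 ->
  (forall a b, a != j -> b != j -> g_coef a b j j = 0) -> lam j x = 0 ->
  dot n (row_div tau x) + surface_div n (fun y => tau y *m n) x =
  - 2 * k * \sum_a lam a x * (2 * (\sum_b g_coef a b j b) - g_coef a j j j
      - d.+2%:R * lam j 0 * p a).
Proof.
move=> nE k1 gZ xj.
have n1 : dot n n = 1 by rewrite nE dotZl dotZr -k1; ring.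
rewrite row_div_tau surface_div_tau //.
set s := lam j 0; have glx : dot (gl j) x = - s by have := lamE v j x; rewrite xj -/s; lra.
have -> : \sum_i dot n (dtau (ee i) x *m ee i) =
    - k * (2 * (\sum_a \sum_b lam a x * g_raw a b j b) - d.+2%:R * P x * s).
  transitivity (- k * \sum_i dot (gl j) (dtau (ee i) x *m ee i)).
    by rewrite mulr_sumr; apply: eq_bigr => i _; rewrite nE dotZl.
  by rewrite div_sigma_fun glx; ring.
pose q a := dot (gl a) (gl j).
have sq : \sum_a q a = 0 by rewrite -dot_suml (sum_gl hv) dot0l.
have -> : dot n (dtau n x *m n) = - k * (2 * (\sum_a lam a x * g_coef a j j j) - 2 * P x * s).
  rewrite nE dtauZ -scalemxAl -scalemxAr scalerA dotZr dotZl dtauE.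
  rewrite [dot x _]dotC glx -/(q j).
  have -> : \sum_a \sum_b (dot (gl a) (gl j) * lam b x + lam a x * dot (gl b) (gl j)) *
      dot (gl j) (A a b *m gl j) = 2 * q j * (\sum_a lam a x * g_coef a j j j) - s ^+ 2 * dP (gl j).
    have e1 : \sum_a \sum_b lam a x * q b * g_coef a b j j = q j * \sum_a lam a x * g_coef a j j j.
      rewrite mulr_sumr; apply: eq_bigr => a _.
      have [->|aj] := eqVneq a j.
        by rewrite xj big1 => [|b _]; ring.
      rewrite (bigD1 j) //= big1 ?addr0; first by ring.
      by move=> b bj; rewrite gZ // mulr0.
    have e2 : \sum_a \sum_b lam a x * q b * (p a + p b) = dP (gl j).
      transitivity ((\sum_a lam a x * p a) * (\sum_b q b) + (\sum_a lam a x) * (\sum_b q b * p b)).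
        rewrite !mulr_suml -big_split; apply: eq_bigr => a _ /=.
        by rewrite !mulr_sumr -big_split; apply: eq_bigr => b _ /=; ring.
      by rewrite sq mulr0 add0r (sum_lam hv) mul1r.
    have e3 : \sum_a \sum_b lam a x * q b * g_raw a b j j =
        q j * (\sum_a lam a x * g_coef a j j j) - s ^+ 2 / 2 * dP (gl j).
      rewrite -e1 -e2 mulr_sumr -sumrB; apply: eq_bigr => a _.
      by rewrite mulr_sumr -sumrB; apply: eq_bigr => b _; rewrite /g_coef -/s; field.
    transitivity (\sum_a \sum_b lam b x * q a * g_raw a b j j + \sum_a \sum_b lam a x * q b * g_raw a b j j).
      rewrite -big_split; apply: eq_bigr => a _ /=; rewrite -big_split.
      by apply: eq_bigr => b _ /=; rewrite -/(g_raw a b j j) -/(q a) -/(q b); ring.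
    rewrite exchange_big /=.
    have -> : \sum_b \sum_a lam b x * q a * g_raw a b j j = \sum_a \sum_b lam a x * q b * g_raw a b j j.
      by apply: eq_bigr => a _; apply: eq_bigr => b _; rewrite /g_raw AC.
    by rewrite e3; field.
  have k1' : k * k * q j = 1 by rewrite -k1 expr2.
  set S := \sum_a _; transitivity (- k * (k * k * q j) * (2 * S - 2 * P x * s)); first by ring.
  by rewrite k1'; ring.
have -> : \sum_a lam a x * (2 * (\sum_b g_coef a b j b) - g_coef a j j j - d.+2%:R * s * p a) =
    2 * (\sum_a \sum_b lam a x * g_raw a b j b) + s * P x - \sum_a lam a x * g_coef a j j j
     - d.+2%:R * s * P x.
  rewrite /cubic_coef !mulr_sumr -big_split -!sumrB; apply: eq_bigr => a _ /=.
  have -> : \sum_b g_coef a b j b = \sum_b g_raw a b j b + s * p a / 2.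
    rewrite /g_coef big_split /=; congr (_ + _).
    have -> : \sum_b lam j 0 * lam b 0 * (p a + p b) / 2 =
       s / 2 * ((\sum_b lam b 0) * p a + \sum_b lam b 0 * p b).
      by rewrite mulr_suml -big_split mulr_sumr; apply: eq_bigr => b _ /=; rewrite -/s; field.
    by rewrite (sum_lam hv) -/(P 0) P0; field.
  by rewrite -mulr_sumr; field.
by ring.
Qed.

End Tau.
End Representation.

(** * Unisolvence *)

Section Vanishing.
Variables (R : realType) (d : nat) (v : 'I_d.+1 -> 'cV[R]_d).
Hypothesis hv : affinely_independent v.
Local Notation I := 'I_d.+1.
Local Notation lam := (lam v).
Local Notation gl := (gl v).

Lemma quad_coef_eq0 (c : I -> I -> R) (f : {set I}) : (forall a b, c a b = c b a) ->
  (forall x, points v f x -> quad c (lam ^~ x) = 0) ->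
  forall a b, a \in f -> b \in f -> c a b = 0.
Proof.
move=> cC q0; have cv a : a \in f -> c a a = 0.
  by move=> af; rewrite -(quad_vertex hv) q0 //; apply: points_vertex.
move=> a b af bf; have := q0 _ (points_midpoint hv af bf).
by rewrite quad_midpoint // !cv // (cC b a); lra.
Qed.

(** A trace of the tested degree, cut off outside [f], is itself a test function, so the integral of
    its square is zero. *)
Lemma vanish_scalar (f : {set I}) k h p n (b : 'I_n -> 'cV[R]_d -> R) :
  f != finset.set0 -> (forall q, poly_on k (points v f) q -> quad_on v f q) ->
  poly_fun k p -> (forall x, points v f x -> h x = p x) ->
  is_basis (poly_on k (points v f)) b ->
  (forall j, integral_on v f (fun x => h x * b j x) = 0) ->
  forall x, points v f x -> h x = 0.
Proof.
move=> f0 quadP pk hp hb int0.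
pose q := patch (fun=> 0) (points v f) p.
have qS : poly_on k (points v f) q by exists p.
have qE x : points v f x -> q x = h x by move=> fx; rewrite /q patchT ?inE // hp.
have hlp : lam_poly_on v f h.
  by apply: lam_poly_on_ext (quad_on_lam_poly (quadP _ qS)).
have hbq : integral_on v f (fun x => h x * q x) = 0.
  apply: (basis_ext0 (phi := fun q => integral_on v f (fun x => h x * q x))
    (poly_on_subspace k (points v f)) _ hb int0 qS).
  move=> a q1 q2 q1S q2S; rewrite -(integral_onD hv _ f0).
  - by apply: integral_on_congr => // x _; rewrite mulrDr mulrCA.
  - by apply: lam_poly_onM => //; apply/quad_on_lam_poly/quadP.
  - by apply: lam_poly_onM => //; apply/quad_on_lam_poly/quadP.
have sq0 : integral_on v f (fun x => \sum_(i < 1) q x * q x) = 0.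
  by apply: etrans hbq; apply: integral_on_congr => // x fx; rewrite big_ord1 -qE.
move=> x fx; rewrite -qE //.
exact: (integral_sqr_eq0 hv (h := fun _ : 'I_1 => q) f0 (fun=> quadP _ qS) sq0 ord0).
Qed.

(** The field [w], cut off outside [f], is its own test function; being paired with tangential
    fields only, it may replace its projection. *)
Lemma vanish_tangential (f : {set I}) (w : 'cV[R]_d -> 'cV[R]_d) n (b : 'I_n -> 'cV[R]_d -> 'cV[R]_d) :
  (2 <= #|f|)%N ->
  (forall i, poly_fun 2 (fun x => w x i 0)) ->
  (forall x, points v f x -> tangent v f (w x)) ->
  (forall i x, points v f x -> lam i x = 0 -> dot (gl i) (w x) = 0) ->
  is_basis (B2div v f) b ->
  (forall j, integral_on v f (fun x => dot (tangent_proj v f (w x)) (b j x)) = 0) ->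
  forall x, points v f x -> w x = 0.
Proof.
move=> f2 w2 wt wn hb int0.
have f0 : f != finset.set0 by rewrite -card_gt0 ltnW.
pose q x := if x \in points v f then w x else 0.
have qS : B2div v f q by apply: (B2div_intro hv f2).
have qE x : points v f x -> q x = w x by move=> fx; rewrite /q ifT // inE.
have quadP q' i : B2div v f q' -> quad_on v f (fun x => q' x i 0).
  by move=> [q'2 _ _]; apply: (poly_on2_quad_on hv).
have projE q' x : B2div v f q' -> dot (tangent_proj v f (w x)) (q' x) = dot (w x) (q' x).
  by move=> [_ q't _]; rewrite (dot_tangent_proj hv).
have lp q' : B2div v f q' ->
    lam_poly_on v f (fun x => dot (tangent_proj v f (w x)) (q' x)).
  move=> q'S; apply: (@lam_poly_on_ext _ _ _ _ (fun x => \sum_i q x i 0 * q' x i 0)).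
    by move=> x fx; rewrite projE // -qE // dotE.
  by apply: lam_poly_on_sum => i _; apply: lam_poly_onM; apply/quad_on_lam_poly/quadP.
have hbq : integral_on v f (fun x => dot (tangent_proj v f (w x)) (q x)) = 0.
  apply: (basis_ext0 (phi := fun q => integral_on v f (fun x => dot (tangent_proj v f (w x)) (q x)))
    (B2div_subspace hv f) _ hb int0 qS).
  move=> a q1 q2 q1S q2S; rewrite -(integral_onD hv _ f0); try exact: lp.
  by apply: integral_on_congr => // x _; rewrite -dotZr -dotDr.
have sq0 : integral_on v f (fun x => \sum_i q x i 0 * q x i 0) = 0.
  by apply: etrans hbq; apply: integral_on_congr => // x fx; rewrite projE // -qE // dotE.
move=> x fx; rewrite -qE //; apply/colP => i; rewrite [RHS]mxE.
exact: (integral_sqr_eq0 hv (h := fun i x => q x i 0) f0 (fun i => quadP _ i qS) sq0 i).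
Qed.

Lemma mem_opp_face (i k : I) : (k \in opp_face i) = (k != i).
Proof. by rewrite !inE. Qed.

Lemma card_opp_face i : #|@opp_face d i| = d.
Proof. by have := cardsC [set i]; rewrite cards1 card_ord add1n => -[]. Qed.

Lemma points_opp_face i x : points v (opp_face i) x -> lam i x = 0.
Proof. by move=> /(pointsP hv)[_]; apply; rewrite mem_opp_face eqxx. Qed.

End Vanishing.

(** * Consequences of the vanishing functionals *)

Section Unisolvence.
Variables (R : realType) (d : nat) (hd : (2 <= d)%N) (v : 'I_d.+1 -> 'cV[R]_d).
Hypothesis hv : affinely_independent v.
Local Notation I := 'I_d.+1.
Local Notation lam := (lam v).
Local Notation gl := (gl v).
Variables (A : I -> I -> 'M[R]_d) (p : I -> R).
Hypothesis AT : forall a b, (A a b)^T = A a b.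
Hypothesis AC : forall a b, A a b = A b a.
Hypothesis P0 : \sum_a lam a 0 * p a = 0.
Local Notation tau := (sigma_fun v A p).
Local Notation g := (g_coef v A p).
Variables (n : dof_index d -> nat) (b : forall i, 'I_(n i) -> test_type (dofs v i)).
Hypothesis hb : forall i, is_basis (@test_space _ _ (dofs v i)) (@b i).
Hypothesis tau0 : forall i (j : 'I_(n i)), pairing tau (@b i j) = 0.

Let d_gt0 : (0 < d)%N.
Proof. exact: ltnW. Qed.

Lemma sigma_fun_face j k x : lam j x = 0 -> lam k x = 0 ->
  dot (gl j) (tau x *m gl k) = quad (fun a b => g a b j k) (lam ^~ x).
Proof. by move=> xj xk; rewrite sigma_fun_gl // xj xk; ring. Qed.

Lemma normal_normal_vanish j a c : a != j -> c != j -> g a c j j = 0.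
Proof.
have Fj : #|@opp_face d j| == d.-1.+1 by rewrite card_opp_face prednK.
pose F : subsimplex d d.-1 := exist _ (opp_face j) Fj.
have [k k0 [nE _]] := face_normalP hv j d_gt0.
have F0 : opp_face j != finset.set0 by rewrite -card_gt0 card_opp_face.
have nn x : points v (opp_face j) x -> normal_normal v tau (opp_face j) x =
    k ^+ 2 * quad (fun a b => g a b j j) (lam ^~ x).
  move=> /(points_opp_face hv) xj; rewrite /normal_normal dot_mul nE.
  by rewrite -scalemxAr dotZl dotZr sigma_fun_face //; ring.
move=> aj cj; apply: (quad_coef_eq0 hv (f := opp_face j) (c := fun a b => g a b j j)).
- by move=> ? ?; apply: g_coefC.
- move=> x fx.
  have := vanish_scalar hv F0 (fun q qS => poly_on2_quad_on hv qS)
    (poly_funZ (k ^+ 2) (poly_fun_quad v (fun a b => g a b j j))) nn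
    (hb (inr (inl F))) (tau0 (i := inr (inl F))) fx.
  rewrite nn // => /eqP; rewrite mulf_eq0 sqrf_eq0 gt_eqF //= => /eqP //.
- by rewrite mem_opp_face.
- by rewrite mem_opp_face.
Qed.

Lemma normal_normal_eq0 j x : lam j x = 0 -> dot (gl j) (tau x *m gl j) = 0.
Proof.
move=> xj; rewrite sigma_fun_face //.
apply: (quad_eq0 (f := opp_face j)) => [a|a c|a].
- by rewrite mem_opp_face => aj; apply: normal_normal_vanish.
- by rewrite !mem_opp_face => aj cj _; rewrite !normal_normal_vanish // addr0.
- by rewrite mem_opp_face negbK => /eqP ->.
Qed.

Lemma tr2_vanish j a : a != j ->
  2 * (\sum_c g a c j c) - g a j j j - d.+2%:R * lam j 0 * p a = 0.
Proof.
have Fj : #|@opp_face d j| == d.-1.+1 by rewrite card_opp_face prednK.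
pose F : subsimplex d d.-1 := exist _ (opp_face j) Fj.
have [k k0 [nE k1]] := face_normalP hv j d_gt0.
have F0 : opp_face j != finset.set0 by rewrite -card_gt0 card_opp_face.
pose t a := - 2 * k * (2 * (\sum_c g a c j c) - g a j j j - d.+2%:R * lam j 0 * p a).
have trE x : points v (opp_face j) x ->
    tr2 v tau (opp_face j) x = \sum_a t a * lam a x.
  move=> /(points_opp_face hv) xj; rewrite /tr2.
  rewrite (tr2_face hv AT AC P0 nE k1 _ xj); last exact: normal_normal_vanish.
  by rewrite mulr_sumr; apply: eq_bigr => i _; rewrite /t; ring.
move=> aj; have af : a \in opp_face j by rewrite mem_opp_face.
have := vanish_scalar hv F0 (fun q qS => poly_on1_quad_on hv qS)
    (poly_fun_linear v t) trE
    (hb (inr (inr (inl F)))) (tau0 (i := inr (inr (inl F)))) (points_vertex hv af).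
rewrite trE; last exact: points_vertex.
rewrite (bigD1 a) //= lam_vertex // eqxx mulr1 big1 ?addr0 => [|c ca]; last first.
  by rewrite lam_vertex // (negPf ca) mulr0.
by move=> /eqP; rewrite /t !mulf_eq0 oppr_eq0 pnatr_eq0 (gt_eqF k0) /= => /eqP.
Qed.

(** Once (b) has been used, both facets through [e] contribute positive multiples of the same
    quantity [gl j . tau gl k], so nothing cancels in the trace. *)
Lemma tr_e_vanish j k a c : j != k ->
  a != j -> a != k -> c != j -> c != k -> g a c j k = 0.
Proof.
move=> jk.
pose e := (~: [set j; k])%SET.
have eE i : (i \in e) = (i != j) && (i != k) by rewrite !inE negb_or.
have ec : #|e| == d.-2.+1.
  by have := cardsC [set j; k]; rewrite cards2 jk card_ord -/e => h; lia.
pose E : subsimplex d d.-2 := exist _ e ec.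
have e0 : e != finset.set0 by rewrite -card_gt0 (eqP ec).
have [l le] : exists l, l \in e by apply/set0Pn.
have Fc i : #|@opp_face d i| == d.-1.+1 by rewrite card_opp_face prednK.
pose F i : subsimplex d d.-1 := exist _ (opp_face i) (Fc i).
have Fe i : (e \proper opp_face i) = (i == j) || (i == k).
  rewrite properEcard card_opp_face (eqP ec); have -> : (d.-2.+1 < d)%N by lia.
  rewrite andbT; apply/fintype.subsetP/idP => [h|h m].
    by apply: contraLR isT; rewrite negb_or => ijk; have := h i; rewrite eE ijk mem_opp_face eqxx => /(_ isT).
  by rewrite eE mem_opp_face => /andP[mj mk]; case/orP: h => /eqP ->.
have FE (G : subsimplex d d.-1) : exists i, G = F i.
  have : #|~: val G|%SET = 1%N.
    have := cardsC (val G); rewrite (eqP (valP G)) card_ord; lia.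
  move=> /eqP/cards1P[i Gi]; exists i; apply: val_inj => /=.
  by rewrite -[LHS]finset.setCK Gi.
have Finj i i' : (F i == F i') = (i == i').
  apply/eqP/eqP => [/(congr1 val) /= h|-> //].
  by apply/eqP; have := mem_opp_face i i'; rewrite h mem_opp_face eqxx => /esym/negbFE; rewrite eq_sym.
have trE x : tr_e v tau e x =
    dot (outward_normal v (opp_face j) e) (tau x *m normal v (opp_face j)) +
    dot (outward_normal v (opp_face k) e) (tau x *m normal v (opp_face k)).
  rewrite /tr_e (bigD1 (F j)) /=; last by rewrite Fe eqxx.
  rewrite (bigD1 (F k)) /=; last by rewrite Fe Finj eqxx orbT eq_sym.
  rewrite big1 ?addr0 ?dot_mul // => G.
  have [i ->] := FE G; rewrite /= Fe !Finj => /andP[/andP[h ij] ik].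
  by move: h; rewrite (negPf ij) (negPf ik).
(* [tau x *m n_i] is tangent to the face F_i at x, so only its component along
   [gl i'] contributes. *)
have half i i' : i != i' -> e = (opp_face i :\ i')%SET -> exists2 r, 0 < r &
    forall x, points v e x ->
    dot (outward_normal v (opp_face i) e) (tau x *m normal v (opp_face i)) =
    r * dot (gl i') (tau x *m gl i).
  move=> ii' eii'; have [r r0 [nE _]] := face_normalP hv i d_gt0.
  have i'F : i' \in opp_face i by rewrite mem_opp_face eq_sym.
  have : l \in e by []. rewrite {1}eii' !inE => /andP[li' li].
  have [] := outward_normalP hv i'F (_ : l \in opp_face i) _; rewrite ?inE // 1?eq_sym //.
  rewrite -eii' => _ _ [m m0 mt]; exists (m * r) => [|x ex]; first exact: mulr_gt0.
  have xi : lam i x = 0.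
    by have /(pointsP hv)[_] := ex; apply; rewrite eii' !inE eqxx andbF.
  rewrite mt nE -!scalemxAr ?dotZr; first by ring.
  apply/(tangentP hv) => q; rewrite mem_opp_face negbK => /eqP ->.
  by rewrite dotZr normal_normal_eq0 // mulr0.
have [r1 r10 h1] : exists2 r, 0 < r & forall x, points v e x ->
    dot (outward_normal v (opp_face j) e) (tau x *m normal v (opp_face j)) =
    r * dot (gl k) (tau x *m gl j).
  by apply: half => //; apply/setP => i; rewrite eE !inE andbC.
have [r2 r20 h2] : exists2 r, 0 < r & forall x, points v e x ->
    dot (outward_normal v (opp_face k) e) (tau x *m normal v (opp_face k)) =
    r * dot (gl j) (tau x *m gl k).
  by apply: half; rewrite 1?eq_sym //; apply/setP => i; rewrite eE !inE.
have tauT x : (tau x)^T = tau x by exact: tr_sigma_fun.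
have hE x : points v e x ->
    tr_e v tau e x = (r1 + r2) * quad (fun a b => g a b j k) (lam ^~ x).
  move=> ex; have /(pointsP hv)[_ xe] := ex.
  have xj : lam j x = 0 by apply: xe; rewrite eE eqxx.
  have xk : lam k x = 0 by apply: xe; rewrite eE eqxx andbF.
  rewrite trE h1 // h2 // (dot_mulC _ _ (tauT x)) sigma_fun_face //; ring.
move=> aj ak cj ck; apply: (quad_coef_eq0 hv (f := e) (c := fun a b => g a b j k)).
- by move=> ? ?; apply: g_coefC.
- move=> x fx.
  have := vanish_scalar hv e0 (fun q qS => poly_on2_quad_on hv qS)
    (poly_funZ (r1 + r2) (poly_fun_quad v (fun a b => g a b j k))) hE
    (hb (inl E)) (tau0 (i := inl E)) fx.
  by rewrite hE // => /eqP; rewrite mulf_eq0 gt_eqF ?addr_gt0 //= => /eqP.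
- by rewrite eE aj.
- by rewrite eE cj.
Qed.

Lemma g_coef_vanish a c j k :
  a != j -> a != k -> c != j -> c != k -> g a c j k = 0.
Proof.
have [<-|jk] := eqVneq j k; first by move=> aj _ cj _; apply: normal_normal_vanish.
exact: tr_e_vanish.
Qed.

Let g_coef_tr2 a j : a != j ->
  2 * (\sum_k g a k j k) - g a j j j = d.+2%:R * lam j 0 * p a.
Proof. by move=> aj; apply/eqP; rewrite -subr_eq0 tr2_vanish. Qed.

Lemma sigma_fun_cubic_eq0 a : p a = 0.
Proof.
exact: (cubic_part_eq0 (g_coefC v p AC) (g_coefT v p AT) g_coef_vanish
  (g_coef_row hv A p) g_coef_tr2 (sum_lam hv 0) P0).
Qed.

Lemma g_coef_total j k : \sum_a \sum_c g a c j k = 0.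
Proof.
exact: (total_eq0 (g_coefC v p AC) (g_coefT v p AT) g_coef_vanish
  (g_coef_row hv A p) g_coef_tr2 (sum_lam hv 0) P0).
Qed.

Let grow0 a c j : \sum_k g a c j k = 0.
Proof. by rewrite g_coef_row // !sigma_fun_cubic_eq0 addr0 mulr0 mul0r. Qed.

Let gtr0 a j : a != j -> 2 * (\sum_k g a k j k) - g a j j j = 0.
Proof. by move=> aj; rewrite g_coef_tr2 // sigma_fun_cubic_eq0 mulr0. Qed.

Let cubic_coef0 x : cubic_coef v p x = 0.
Proof. by rewrite /cubic_coef big1 // => a _; rewrite sigma_fun_cubic_eq0 mulr0. Qed.

Lemma sigma_fun_quad j k x :
  dot (gl j) (tau x *m gl k) = quad (fun a c => g a c j k) (lam ^~ x).
Proof. by rewrite sigma_fun_gl // cubic_coef0 mul0r addr0. Qed.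

Let T0 : [set: I]%SET != finset.set0.
Proof. by apply/set0Pn; exists ord0; rewrite inE. Qed.

Definition sym_outer (u w : 'cV[R]_d) : 'M[R]_d := u *m w^T + w *m u^T.

Lemma tr_sym_outer u w : (sym_outer u w)^T = sym_outer u w.
Proof. by rewrite /sym_outer linearD /= !trmx_mul !trmxK addrC. Qed.

Lemma form_sym_outer u w x : dot x (sym_outer u w *m x) = 2 * (dot u x * dot w x).
Proof.
rewrite /sym_outer mulmxDl !outer_mul dotDr !dotZr ![dot x _]dotC; ring.
Qed.

Lemma trace_sym_outer (B : 'M[R]_d) u w : B^T = B ->
  \tr (B^T *m sym_outer u w) = 2 * dot u (B *m w).
Proof.
move=> BT; have tr1 y z : \tr (B *m (y *m z^T)) = dot z (B *m y).
  by rewrite mulmxA mxtrace_mulC trace_mx11.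
by rewrite BT /sym_outer mulmxDr mxtraceD !tr1 (dot_mulC w u BT); ring.
Qed.

Definition hook_test (u1 u2 u3 : 'cV[R]_d) x : 'M[R]_d :=
  (2 * dot u1 x) *: sym_outer u2 u3 - dot u2 x *: sym_outer u1 u3
   - dot u3 x *: sym_outer u1 u2.

Lemma poly_fun_dot (u : 'cV[R]_d) : poly_fun 1 (dot u).
Proof.
apply: (poly_fun_ext (p := fun x => \sum_i u i 0 * x i 0)) => [x|].
  by rewrite dotE.
by apply: poly_fun_sum => i _; apply: poly_funZ; apply: poly_fun_coord.
Qed.

Lemma hook_test_cubic_free u1 u2 u3 : cubic_free (hook_test u1 u2 u3).
Proof.
split=> [|x]; last first.
  rewrite dot_mul /hook_test !mulmxBl -!scalemxAl !dotBr !dotZr !form_sym_outer; ring.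
split=> [x|i j]; first by rewrite /hook_test !linearB !linearZ /= !tr_sym_outer.
apply: (poly_fun_ext (p := fun x => 2 * sym_outer u2 u3 i j * dot u1 x +
   (- sym_outer u1 u3 i j * dot u2 x + - sym_outer u1 u2 i j * dot u3 x))) => [x|].
  rewrite /hook_test; do ?[rewrite [(_ + _ : 'M[R]__) i j]mxE |
    rewrite [(- _ : 'M[R]__) i j]mxE | rewrite [(_ *: _ : 'M[R]__) i j]mxE]; ring.
by apply: poly_funD; [|apply: poly_funD]; apply: poly_funZ; apply: poly_fun_dot.
Qed.

Let tauT x : (tau x)^T = tau x.
Proof. exact: tr_sigma_fun. Qed.

Lemma lam_poly_on_sigma_fun f i j : lam_poly_on v f (fun x => tau x i j).
Proof.
apply: (@lam_poly_on_ext _ _ _ _ (fun x => \sum_a \sum_c A a c i j * (lam a x * lam c x))).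
  move=> x _; rewrite /sigma_fun cubic_coef0 scale0r addr0 summxE; apply: eq_bigr => a _.
  by rewrite summxE; apply: eq_bigr => c _; rewrite mxE mulrC.
apply: lam_poly_on_sum => a _; apply: lam_poly_on_sum => c _.
by apply: lam_poly_onZ; apply: lam_poly_onM; apply: lam_poly_on_lam.
Qed.

Lemma interior_vanish q : cubic_free q ->
  integral_on v [set: I]%SET (fun x => \tr ((tau x)^T *m q x)) = 0.
Proof.
move=> qS.
have lp q' : cubic_free q' -> lam_poly_on v [set: I]%SET (fun x => \tr ((tau x)^T *m q' x)).
  move=> [[_ q'1] _].
  apply: (@lam_poly_on_ext _ _ _ _ (fun x => \sum_i \sum_j tau x j i * q' x j i)).
    move=> x _; apply: eq_bigr => i _; rewrite [RHS]mxE; apply: eq_bigr => j _.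
    by rewrite [in RHS]mxE.
  apply: lam_poly_on_sum => i _; apply: lam_poly_on_sum => j _.
  apply: lam_poly_onM; first exact: lam_poly_on_sigma_fun.
  have [c cE] := poly_fun1_lam hv (q'1 j i).
  apply: (@lam_poly_on_ext _ _ _ _ (fun x => \sum_a c a * lam a x)).
    by move=> x _; rewrite cE.
  by apply: lam_poly_on_sum => a _; apply: lam_poly_onZ; apply: lam_poly_on_lam.
apply: (basis_ext0 (phi := fun q => integral_on v [set: I]%SET (fun x => \tr ((tau x)^T *m q x)))
    (cubic_free_subspace R d) _ (hb (inr (inr (inr (inr tt)))))
    (tau0 (i := inr (inr (inr (inr tt))))) qS).
move=> a q1 q2 q1S q2S; rewrite -(integral_onD hv _ T0); try exact: lp.
apply: integral_on_congr => // x _.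
have -> : (a *: q1 + q2) x = a *: q1 x + q2 x by [].
by rewrite mulmxDr -scalemxAr mxtraceD mxtraceZ.
Qed.

(* The weights of [cubic_weight] reduce to this because [g a a j k = 0] and the sum
   of all [g a c j k] vanishes. *)
Lemma moment_integral : exists2 K : R, K != 0 & forall e j k,
  integral_on v [set: I]%SET (fun x => lam e x * quad (fun a c => g a c j k) (lam ^~ x)) =
  K * moment g e j k.
Proof.
have [K K0 KE] := integral_cubic hv.
exists (K * 2) => [|e j k]; first by rewrite mulf_neq0 ?pnatr_eq0.
pose G (ac : I * I) := g ac.1 ac.2 j k.
pose h (ac : I * I) x := lam ac.1 x * lam ac.2 x * lam e x.
transitivity (integral_on v [set: I]%SET (fun x => \sum_ac G ac * h ac x)).
  apply: integral_on_congr => // x _; rewrite /quad pair_big mulr_sumr.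
  by apply: eq_bigr => -[a c] _; rewrite /G /h /=; ring.
rewrite integral_on_sum //; last first.
  by move=> ac; apply: lam_poly_onM; [apply: lam_poly_onM|]; apply: lam_poly_on_lam.
under eq_bigr do rewrite /h KE.
rewrite -(pair_big xpredT xpredT (fun a c => g a c j k * (K * cubic_weight R a c e))) /=.
have -> : \sum_a \sum_c g a c j k * (K * cubic_weight R a c e) =
   K * (\sum_a \sum_c g a c j k + \sum_a (a == e)%:R * moment g a j k +
     \sum_c (c == e)%:R * moment g c j k).
  rewrite [X in _ = _ * (_ + X)](_ : _ = \sum_a \sum_c (c == e)%:R * g a c j k).
    rewrite -!big_split mulr_sumr; apply: eq_bigr => a _ /=.
    rewrite mulr_sumr -!big_split mulr_sumr; apply: eq_bigr => c _ /=.
    rewrite /cubic_weight; case: (eqVneq a c) => [<-|_]; last by rewrite /=; ring.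
    rewrite (g_vertex (g_coefT v p AT) g_coef_vanish grow0 (sum_lam hv 0)); ring.
  rewrite exchange_big /=; apply: eq_bigr => c _.
  rewrite mulr_sumr; apply: eq_bigr => a _; by rewrite (g_coefC v p AC).
have pick : \sum_a (a == e)%:R * moment g a j k = moment g e j k.
  by rewrite (bigD1 e) //= eqxx mul1r big1 ?addr0 // => a /negPf ->; rewrite mul0r.
by rewrite g_coef_total pick; ring.
Qed.

(** The linear function [gl j . x] differs from [lam j] by the constant [lam j 0], whose
    contribution is a multiple of the vanishing total [g_coef_total]. Testing with [hook_test]
    therefore gives a relation between moments alone. *)
Lemma moment_orthogonal a c e :
  2 * moment g a c e = moment g c a e + moment g e a c.
Proof.
have [K K0 KE] := moment_integral.
pose N j k l x := (lam j x - lam j 0) * quad (fun a c => g a c k l) (lam ^~ x).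
have lq j k l : lam_poly_on v [set: I]%SET
    (fun x => lam j x * quad (fun a c => g a c k l) (lam ^~ x)).
  apply: lam_poly_onM; first exact: lam_poly_on_lam.
  by apply: quad_on_lam_poly; exists (fun a c => g a c k l).
have NE j k l x : N j k l x = \sum_i ((i == j)%:R - lam j 0) *
    (lam i x * quad (fun a c => g a c k l) (lam ^~ x)).
  rewrite /N; set Q := quad _ _; under eq_bigr do rewrite mulrA.
  rewrite -mulr_suml; congr (_ * _); under eq_bigr do rewrite mulrBl.
  rewrite sumrB -mulr_sumr (sum_lam hv) mulr1 (bigD1 j) //= eqxx mul1r big1 ?addr0 // => i.
  by move=> /negPf ->; rewrite mul0r.
have Nlp j k l : lam_poly_on v [set: I]%SET (N j k l).
  apply: lam_poly_on_ext (fun x _ => esym (NE j k l x)) _.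
  by apply: lam_poly_on_sum => i _; apply: lam_poly_onZ.
have Nint j k l : integral_on v [set: I]%SET (N j k l) = K * moment g j k l.
  transitivity (integral_on v [set: I]%SET (fun x => \sum_i ((i == j)%:R - lam j 0) *
    (lam i x * quad (fun a c => g a c k l) (lam ^~ x)))).
    by apply: integral_on_congr => // x _.
  rewrite integral_on_sum //; under eq_bigr do rewrite KE mulrBl.
  rewrite sumrB -!mulr_sumr [\sum_i moment _ _ _ _]g_coef_total mulr0 mulr0 subr0.
  by rewrite (bigD1 j) //= eqxx mul1r big1 ?addr0 // => i /negPf ->; rewrite mul0r.
have := interior_vanish (hook_test_cubic_free (gl a) (gl c) (gl e)).
(* The factors are twice those of [hook_test], by [trace_sym_outer]; the final zero gives the last
   summand the shape required by [integral_onD]. *)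
have -> : integral_on v [set: I]%SET
    (fun x => \tr ((tau x)^T *m hook_test (gl a) (gl c) (gl e) x)) =
  integral_on v [set: I]%SET (fun x => 4 * N a c e x + (-2 * N c a e x + (-2 * N e a c x + 0))).
  apply: integral_on_congr => // x _.
  rewrite /hook_test !mulmxBr -!scalemxAr !raddfB /= !mxtraceZ.
  rewrite !trace_sym_outer // !sigma_fun_quad /N !(lamE v _ x).
  by ring.
have lp0 : lam_poly_on v [set: I]%SET (fun=> 0) by exact: lam_poly_on_cst.
have lp1 : lam_poly_on v [set: I]%SET (fun x => -2 * N e a c x + 0).
  by apply: lam_poly_onD => //; apply: lam_poly_onZ.
have lp2 : lam_poly_on v [set: I]%SET (fun x => -2 * N c a e x + (-2 * N e a c x + 0)).
  by apply: lam_poly_onD => //; apply: lam_poly_onZ.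
rewrite !integral_onD // integral_on0 //.
rewrite !Nint => h; apply: (mulfI K0); lra.
Qed.

(** Since [r] is outside [f], [g_coef_vanish] makes [tau n_r] tangential on [f] with zero normal
    component on its boundary, so it can be tested with itself. At the midpoint of the edge [i], [l]
    only the mixed coefficient survives. *)
Lemma tangential_vanish (i l r : I) : (3 <= r)%N ->
  (i <= r - 2)%N -> (l <= r - 2)%N -> i != l -> g i l i r = 0.
Proof.
move=> r3 ir lr il; pose f := initial_simplex d (r - 2).
have rd := ltn_ord r.
have fc : (2 <= #|f|)%N by rewrite card_initial_simplex; lia.
have rf : r \notin f by rewrite inE -ltnNge; lia.
have [k k0 [nE _]] := face_normalP hv r d_gt0.
pose w x := tau x *m normal v (opp_face r).
have wE j x : dot (gl j) (w x) = - k * quad (fun a c => g a c j r) (lam ^~ x).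
  by rewrite /w nE -scalemxAr dotZr sigma_fun_quad.
have w0 : forall x, points v f x -> w x = 0.
  apply: (vanish_tangential hv fc (n := n (inr (inr (inr (inl (exist _ r r3))))))
    (b := @b (inr (inr (inr (inl (exist _ r r3))))))).
  - move=> j; apply: (poly_fun_ext (p := fun x => - k *
        quad (fun a c => dot (delta_mx j 0) (A a c *m gl r)) (lam ^~ x))) => [x|].
      rewrite -dot_delta /w nE -scalemxAr dotZr; congr (_ * _).
      rewrite sigma_funE cubic_coef0 mul0r addr0.
      by apply: eq_bigr => a _; apply: eq_bigr => c _; ring.
    by apply: poly_funZ; apply: poly_fun_quad.
  - move=> x fx; apply/(tangentP hv) => j jf; rewrite wE.
    have /(pointsP hv)[_ xf] := fx.
    have neq m m' : m \in f -> m' \notin f -> m != m'.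
      by move=> mf; apply: contraNneq => <-.
    rewrite (quad_eq0 (f := f)) ?mulr0 // => [a af|a c af cf _].
      by rewrite g_coef_vanish // neq.
    by rewrite !g_coef_vanish ?addr0 // neq.
  - move=> j x fx xj; rewrite wE.
    have /(pointsP hv)[_ xf] := fx.
    have neq m : m \in f :\ j -> m != j /\ m != r.
      by rewrite !inE => /andP[mj mf]; split=> //; apply: contraNneq rf => <-; rewrite inE.
    rewrite (quad_eq0 (f := (f :\ j)%SET)) ?mulr0 // => [a /neq[]|a c /neq[? ?] /neq[? ?] _|a].
    + by move=> ? ?; rewrite g_coef_vanish.
    + by rewrite !g_coef_vanish // addr0.
    by rewrite !inE negb_and negbK => /orP[/eqP -> //|/= af]; apply: xf; rewrite inE.
  - exact: (hb (inr (inr (inr (inl (exist _ r r3)))))).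
  - exact: (tau0 (i := inr (inr (inr (inl (exist _ r r3)))))).
have fi : i \in f by rewrite inE.
have fl : l \in f by rewrite inE.
have := wE i (midpoint v i l); rewrite w0; last exact: points_midpoint.
have gv m := g_vertex (g_coefT v p AT) g_coef_vanish grow0 (sum_lam hv 0) m.
rewrite dot0r quad_midpoint // !gv (g_coefC v p AC l i) => /esym/eqP.
by rewrite mulf_eq0 oppr_eq0 gt_eqF //= => /eqP; lra.
Qed.

Lemma sigma_fun_eq0 : tau = 0.
Proof.
have g0 a c j k : g a c j k = 0.
  apply: (coefficients_eq0 (g_coefC v p AC) (g_coefT v p AT) g_coef_vanish grow0
    gtr0 (sum_lam hv 0) _ moment_orthogonal tangential_vanish) => //.
have A0 a c : A a c = 0.
  apply: (gl_mx_eq0 hv) => j k; have := g0 a c j k.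
  by rewrite /g_coef !sigma_fun_cubic_eq0 addr0 mulr0 mul0r addr0.
apply: funext => x; rewrite /sigma_fun cubic_coef0 scale0r addr0.
by rewrite big1 // => a _; rewrite big1 // => c _; rewrite A0 scaler0.
Qed.

End Unisolvence.

Lemma dof_basis (R : realType) (d : nat) (hd : (2 <= d)%N)
    (v : 'I_d.+1 -> 'cV[R]_d) (hv : affinely_independent v) (k : dof_index d) :
  exists b : 'I_(dof_size k) -> test_type (dofs v k),
    is_basis (@test_space _ _ (dofs v k)) b.
Proof.
case: k => [e|[F|[F|[[r r3]|[]]]]] /=.
- exact: poly_on2_basis.
- exact: poly_on2_basis.
- exact: poly_on1_basis.
- apply: B2div_basis => //; rewrite card_initial_simplex; have := ltn_ord r; lia.
- exact: (cubic_free_basis hv).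
Qed.

Theorem theoremA5 (R : realType) (d : nat) (hd : (2 <= d)%N)
    (v : 'I_d.+1 -> 'cV[R]_d) (hv : affinely_independent v) :
  unisolvent (@Sigma2plus R d) (dofs v).
Proof.
split=> [k|n b hb].
  by have [b hb] := dof_basis hd hv k; exists (dof_size k), b.
split=> [|tau /(Sigma2plus_rep hv)[A [p [AT AC P0 tauE]]] tau0].
  (* The given bases have the sizes of the explicit ones, by invariance of dimension. *)
  have -> : (\sum_i n i = #|sym_poly2_index d| + d)%N.
    rewrite -sum_dof_size //; apply: eq_bigr => i _.
    by have [b' hb'] := dof_basis hd hv i; apply: basis_size (hb i) hb'.
  exact: (Sigma2plus_basis hv).
have tauE' : tau = sigma_fun v A p by apply: funext => x; rewrite tauE.
rewrite tauE'; apply: (sigma_fun_eq0 hd hv AT AC P0 hb) => i j.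
by rewrite -tauE'.
Qed.
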